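(* Let $w_1,\ldots,w_\ell$ be $\ell$ distinct positive integers. For $i=1,\ldots,\ell$ let $V_i$ be a finite set of values in $\overline{k_\infty}^{\times}$ having the MZ property with weight $w_i$, and suppose that $V_i$ is a linearly independent set over $k$. Then the union \[\{1\}\cup\bigcup_{i=1}^\ell V_i\] is a linearly independent set over $\bar{k}$.
   Context: Let $q$ be a power of a prime $p$, $\theta,t$ independent variables, $k=\mathbb{F}_q(\theta)$, $k_\infty=\mathbb{F}_q(\!(1/\theta)\!)$, $\overline{k_\infty}$ a fixed algebraic closure of $k_\infty$, $\bar{k}$ the algebraic closure of $k$ in $\overline{k_\infty}$, $\mathbb{C}_\infty$ the completion of $\overline{k_\infty}$, and $|\cdot|_\infty$ the absolute value on $\mathbb{C}_\infty$ with $|\theta|_\infty=q$. $\mathbb{N}$ is the set of positive integers. For an integer $n$ and $f=\sum a_it^i\in\mathbb{C}_\infty(\!(t)\!)$, the $n$-fold twist is $f^{(n)}:=\sum a_i^{q^n}t^i$; it is extended entrywise to matrices. Fix a $(q-1)$-th root $\tilde{\theta}$ of $-\theta$ in $\overline{k_\infty}$, put $\Omega(t)=\tilde{\theta}^{-q}\prod_{i=1}^\infty(1-t/\theta^{q^i})$ and $\tilde{\pi}:=1/\Omega(\theta)$. $\mathcal{E}$ is the ring of power series $\sum_{n\ge0}a_nt^n\in\bar{k}[\![t]\!]$ with $\lim_{n\to\infty}\sqrt[n]{|a_n|_\infty}=0$ and $[k_\infty(a_0,a_1,a_2,\ldots):k_\infty]<\infty$ (entire functions). MZ property: let $w$ be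 a positive integer. A nonzero $Z\in\overline{k_\infty}^\times$ has the MZ property with weight $w$ if there exist $d\ge2$, $\Phi\in\mathrm{Mat}_d(\bar{k}[t])$ and $\psi\in\mathrm{Mat}_{d\times1}(\mathcal{E})$ such that (1) $\psi^{(-1)}=\Phi\psi$, and $\det\Phi=b(t-\theta)^s$ for some $b\in\bar{k}^\times$ and some integer $s\ge0$; (2) the last column of $\Phi$ is $(0,\ldots,0,1)^{\mathrm{tr}}$; (3) for some $c\in k^\times$, the first entry of $\psi(\theta)$ is $1/\tilde{\pi}^w$ and the last entry of $\psi(\theta)$ is $cZ/\tilde{\pi}^w$; (4) with the same $c$, for every positive integer $N$, all entries of $\psi(\theta^{q^N})$ are zero except the last one, which equals $(cZ/\tilde{\pi}^w)^{q^N}$. *)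

(* Defs.v *)
From HB Require Import structures.
From mathcomp Require Import all_boot all_order all_algebra.
From mathcomp Require Import all_classical all_reals all_analysis.
Import Order.TTheory GRing.Theory Num.Theory.
Import numFieldNormedType.Exports.

Set Implicit Arguments.
Unset Strict Implicit.
Unset Printing Implicit Defensive.

Local Open Scope classical_set_scope.
Local Open Scope ring_scope.

(* Subfields of the ambient field are represented by their underlying sets. *)
Section Subfields.
Context {C : fieldType}.

Definition subfield (L : set C) : Prop :=
  [/\ L 1, forall x y, L x -> L y -> L (x - y)
    & forall x y, L x -> L y -> L (x / y)].

Definition adjoin (K A : set C) : set C := smallest subfield (K `|` A).

Definition finite_degree (L K : set C) : Prop :=
  exists (n : nat) (e : 'I_n -> C), (forall i, L (e i)) /\
    (forall x, L x -> exists c : 'I_n -> C,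
       (forall i, K (c i)) /\ x = \sum_i c i * e i).

Definition algebraic_over (K : set C) : set C :=
  [set x | exists p : {poly C},
     [/\ p != 0, forall i : nat, K p`_i & root p x]].

Definition linearly_independent (K S : set C) : Prop :=
  forall (s : seq C) (c : C -> C),
    uniq s -> (forall x, x \in s -> S x) -> (forall x, x \in s -> K (c x)) ->
    \sum_(x <- s) c x * x = 0 -> forall x, x \in s -> c x = 0.

End Subfields.

(* An algebraically closed extension of the finite field F with an absolute
   value and a marked element theta.  (MathComp's norms satisfy
   `|x *+ n| = `|x| *+ n, which fails here, hence the separate absv.) *)
Record valued_closed_field (F : finFieldType) (R : realType) := ValuedClosedField {
  vcf_field :> closedFieldType;
  embF : {rmorphism F -> vcf_field};
  theta : vcf_field;
  absv : vcf_field -> R;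
  absv_ge0 : forall x, 0 <= absv x;
  absv_eq0 : forall x, absv x = 0 <-> x = 0;
  absvM : forall x y, absv (x * y) = absv x * absv y;
  absvD : forall x y, absv (x + y) <= Num.max (absv x) (absv y) }.

Arguments embF {F R} _.
Arguments theta {F R} _.
Arguments absv {F R} _.

Section ValuedField.
Context {F : finFieldType} {R : realType} (C : valued_closed_field F R).

Definition converges (u : nat -> C) (l : C) : Prop :=
  absv C (u n - l) @[n --> \oo] --> (0 : R).

Definition cauchy_sequence (u : nat -> C) : Prop :=
  forall e : R, 0 < e -> exists N : nat, forall m n : nat,
    (N <= m)%N -> (N <= n)%N -> absv C (u m - u n) < e.

(* The limit of u, and 0 if u diverges. *)
Definition limit (u : nat -> C) : C := xget 0 [set l | converges u l].

(* F(theta) *)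
Definition kfield : set C :=
  [set x | exists P Q : {poly F}, Q != 0 /\
     x = (map_poly (embF C) P).[theta C] / (map_poly (embF C) Q).[theta C]].

(* F((1/theta)): sums of series \sum_(i >= 0) a_i theta^(m - i) with a_i in F *)
Definition kinf : set C :=
  [set x | exists (m : int) (a : nat -> F),
     converges (fun n => \sum_(i < n) embF C (a i) * theta C ^ (m - i%:Z)) x].

Definition kinfbar : set C := algebraic_over kinf.

Definition kbar : set C := kinfbar `&` algebraic_over kfield.

End ValuedField.

Arguments kfield {F R} C _.
Arguments kinf {F R} C _.
Arguments kinfbar {F R} C _.
Arguments kbar {F R} C _.

(* C_infty, the completion of an algebraic closure of k_infty = F((1/theta)).
   These conditions determine (C, embF, theta, absv) up to isometric
   isomorphism.  As #|F| > 1, absv_theta makes theta transcendental over F. *)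
Record Cinfty (F : finFieldType) (R : realType) := CinftyOf {
  Cinf_base :> valued_closed_field F R;
  absv_theta : absv Cinf_base (theta Cinf_base) = #|F|%:R;
  Cinf_complete : forall u : nat -> Cinf_base,
    cauchy_sequence u -> exists l, converges u l;
  kinfbar_dense : forall (x : Cinf_base) (e : R), 0 < e ->
    exists2 y, kinfbar Cinf_base y & absv Cinf_base (x - y) < e }.

Section MZ.
Context {F : finFieldType} {R : realType} (C : Cinfty F R).
Local Notation q := #|F|.
Local Notation theta := (theta C).

(* A power series \sum_n f_n t^n over C is its coefficient sequence. *)
Local Notation powser := (nat -> C).

(* x^(q^n) for n : int; for n < 0 this is the (unique) q^|n|-th root of x. *)
Definition qpower (n : int) (x : C) : C :=
  match n with
  | Posz m => x ^+ (q ^ m)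
  | Negz m => xget 0 [set y : C | y ^+ (q ^ m.+1) = x]
  end.

Definition twist (n : int) (f : powser) : powser := fun i => qpower n (f i).

Definition ps_mul (f g : powser) : powser :=
  fun n => \sum_(i < n.+1) f i * g (n - i)%N.

Definition ps_eval (f : powser) (x : C) : C :=
  limit (fun n => \sum_(i < n) f i * x ^+ i).

Definition mx_ps_mul (m n : nat) (A : 'M[{poly C}]_(m, n)) (f : 'cV[powser]_n) :
    'cV[powser]_m :=
  \col_i (fun l => \sum_j ps_mul (nth 0 (A i j)) (f j 0) l).

(* At n = 0 the n-th root is read as a 0-th power, irrelevant for the limit. *)
Definition entire (f : powser) : Prop :=
  [/\ forall n, kbar C (f n),
      absv C (f n) `^ (n%:R^-1) @[n --> \oo] --> (0 : R)
    & finite_degree (adjoin (kinf C) (range f)) (kinf C)].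

(* tt is the chosen (q-1)-th root of - theta. *)
Definition Omega (tt t : C) : C :=
  limit (fun n => tt ^- q * \prod_(1 <= i < n.+1) (1 - t / theta ^+ (q ^ i))).

Definition pitilde (tt : C) : C := 1 / Omega tt theta.

(* The size of the system is d.+2, i.e. an arbitrary integer >= 2. *)
Definition MZ_property (tt : C) (w : nat) (Z : C) : Prop :=
  [/\ kinfbar C Z, Z != 0 &
   exists (d : nat) (Phi : 'M[{poly C}]_d.+2) (psi : 'cV[powser]_d.+2),
   [/\ forall i j (n : nat), kbar C (Phi i j)`_n,
       forall i, entire (psi i 0),
       map_mx (twist (- 1)) psi = mx_ps_mul Phi psi /\
       (exists (b : C) (s : nat),
          [/\ kbar C b, b != 0 & \det Phi = b%:P * ('X - theta%:P) ^+ s]),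
       forall i, Phi i ord_max = (i == ord_max)%:R &
       exists c : C,
       [/\ kfield C c /\ c != 0,
           ps_eval (psi ord0 0) theta = 1 / pitilde tt ^+ w,
           ps_eval (psi ord_max 0) theta = c * Z / pitilde tt ^+ w &
           forall N : nat, (0 < N)%N ->
             (forall i, i != ord_max ->
                ps_eval (psi i 0) (theta ^+ (q ^ N)) = 0) /\
             ps_eval (psi ord_max 0) (theta ^+ (q ^ N)) =
               (c * Z / pitilde tt ^+ w) ^+ (q ^ N)]]].

End MZ.

(* Main.v *)
(* A k-bar-linear relation of top weight W is propagated by the criterion of
   Anderson, Brownawell and Papanikolas: put the systems of the values involved
   in one block diagonal system psi = Phi^(1) psi^(1), those of weight w < W being
   multiplied by Omega^(W - w). The relation at t = theta lifts to polynomials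
   f_Z with f_Z(theta) = rho_Z, and evaluating at theta^(q^N) kills every
   block except the values of weight W, leaving
   sum_Z f_Z(theta^(q^N)) (c_Z Z)^(q^N) = 0.
   For a minimal relation in a single weight, the q^N-th roots of these relations
   are proportional to it, so f_Z / f_Z' is fixed by the Frobenius twist, hence
   lies in F(t), and the relation is defined over k. For several weights,
   independence in weight W forces f_Z(theta^(q^N)) = 0 for all N, so f_Z = 0.

   The criterion itself is proved by a transcendence argument. The relation
   rho psi(theta) = 0 transports to relations u_m psi^(M)(theta^(q^m)) = 0 for
   1 <= m <= M. Siegel's lemma gives a row G of polynomials of degree about
   (1 - 1/(2n)) M with G(theta^(q^m)) proportional to u_m, so that
   E = G psi^(M) has M zeros. The first nonzero coefficient e of E satisfies an
   equation sum_j a_j e^(q^j) = 0 with a_j of bounded height, hence is not too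
   small (Liouville), and by the Schwarz lemma it is too small unless E = 0. Then
   G = l u_m at some theta^(q^m) with l != 0, and inverting Phi brings G back to a
   polynomial relation specializing to rho. *)
Require Import Defs.
From HB Require Import structures.
From mathcomp Require Import all_boot all_order all_algebra finfield.
From mathcomp Require Import all_classical all_reals all_analysis.
From mathcomp Require Import zify ring.
Import Order.TTheory GRing.Theory Num.Theory.
Import numFieldNormedType.Exports.

Set Implicit Arguments.
Unset Strict Implicit.
Unset Printing Implicit Defensive.

Local Open Scope classical_set_scope.
Local Open Scope ring_scope.

(** * Frobenius and power series *)

(** All twists go in the positive direction: the coefficients of Phi^(j) are q^j-th powers, so they
    stay in one finite extension of F(theta), and q^m-th roots are extracted only from a finished
    relation. Heights in this extension are measured by a filtration of an order, where counting
    replaces norms and integral closure: it yields both Siegel's lemma and the Liouville bound. The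
    price is that heights grow like q^M, and the constants balance as follows. On the disc of radius
    r = Q^(K0 q^M), M zeros contribute r^M while a row G of degree less than M - T costs r^(M - T),
    so the gain is r^T = Q^(K0 T q^M). Everything else is at most T q^M times a constant independent
    of K0 and T, except for the bound Q^(B q^M) on psi^(M). Hence K0 is chosen first, B depends on
    K0, and T = B + 1 comes last. Siegel's lemma allows a deficit T proportional to M because the
    factors of proportionality to the u_m are unknowns too: with M = 2nT they add M unknowns,
    against the nT lost by lowering the degree. *)

Section Frobenius.
Context {F : finFieldType} {R : realType} (C : valued_closed_field F R).
Local Notation q := #|F|.

Lemma exprDq (x y : C) m : (x + y) ^+ (q ^ m) = x ^+ (q ^ m) + y ^+ (q ^ m).
Proof.
have [p pr_p pF] := finPcharP F.
have pC : p \in [pchar C] by rewrite (fmorph_pchar (embF C)).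
apply: exprDn_pchar; rewrite (eq_pnat _ (pcharf_eq pC)).
by rewrite (card_pprimeChar pF) -expnM pnatX pnat_id.
Qed.

Lemma q_gt1 : (1 < q)%N.
Proof. exact: finNzRing_gt1. Qed.

Lemma q_gt0 : (0 < q)%N.
Proof. exact: ltnW q_gt1. Qed.

Lemma expq_gt0 m : (0 < q ^ m)%N.
Proof. by rewrite expn_gt0 q_gt0. Qed.

Definition frob (m : nat) (x : C) : C := x ^+ (q ^ m).

Lemma frob_zmod m : zmod_morphism (frob m).
Proof.
move=> x y; apply/eqP; rewrite eq_sym subr_eq; apply/eqP.
by rewrite -exprDq subrK.
Qed.

Lemma frob_monoid m : monoid_morphism (frob m).
Proof. by split=> [|x y]; rewrite /frob ?expr1n ?exprMn. Qed.

HB.instance Definition _ m := GRing.isZmodMorphism.Build C C (frob m) (frob_zmod m).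
HB.instance Definition _ m := GRing.isMonoidMorphism.Build C C (frob m) (frob_monoid m).

Lemma frobD m n x : frob (m + n) x = frob m (frob n x).
Proof. by rewrite /frob -exprM -expnD addnC. Qed.

Lemma frob0 x : frob 0 x = x.
Proof. by rewrite /frob expn0 expr1. Qed.

Lemma frob_surj m (x : C) : exists y, frob m y = x.
Proof.
have q0 := expq_gt0 m.
have [y] := solve_monicpoly (fun i => if i is 0%N then x else 0) q0.
move=> Hy; exists y; rewrite /frob Hy -(prednK q0) big_ord_recl /= expr0 mulr1.
by rewrite big1 ?addr0 // => i _; rewrite mul0r.
Qed.

Lemma frob_inj m : injective (frob m).
Proof. exact: fmorph_inj. Qed.

End Frobenius.

Section PowerSeries.
Variable K : comNzRingType.

(** Under its own name the function type carries the Cauchy product instead of the pointwise product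
    of functions. *)
Definition psr := nat -> K.
HB.instance Definition _ := gen_eqMixin psr.
HB.instance Definition _ := gen_choiceMixin psr.

Definition ps_add (f g : psr) : psr := fun n => f n + g n.
Definition ps_opp (f : psr) : psr := fun n => - f n.
Definition ps_zero : psr := fun n => 0.
Definition ps_one : psr := fun n => (n == 0)%:R.
Definition psM (f g : psr) : psr := fun n => \sum_(i < n.+1) f i * g (n - i)%N.

Lemma ps_addA : associative ps_add.
Proof. by move=> f g h; apply: funext => n; apply: addrA. Qed.
Lemma ps_addC : commutative ps_add.
Proof. by move=> f g; apply: funext => n; apply: addrC. Qed.
Lemma ps_add0 : left_id ps_zero ps_add.
Proof. by move=> f; apply: funext => n; apply: add0r. Qed.
Lemma ps_addN : left_inverse ps_zero ps_opp ps_add.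
Proof. by move=> f; apply: funext => n; apply: addNr. Qed.
HB.instance Definition _ := GRing.isZmodule.Build psr ps_addA ps_addC ps_add0 ps_addN.

Definition trunc n (f : psr) : {poly K} := \poly_(i < n) f i.

(** Each coefficient of a product sees only finitely many coefficients of the factors; this reduces
    the ring laws of series to those of polynomials. *)
Lemma psM_trunc N f g n : (n < N)%N -> psM f g n = (trunc N f * trunc N g)`_n.
Proof.
move=> nN; rewrite coefM; apply: eq_bigr => i _; rewrite !coef_poly.
by rewrite (leq_ltn_trans _ nN) ?(leq_ltn_trans (leq_subr _ _) nN) // -ltnS.
Qed.

Lemma psMA : associative psM.
Proof.
move=> f g h; apply: funext => n.
have coefM_eq (a b c d : {poly K}) : (forall i, (i <= n)%N -> a`_i = c`_i) ->
    (forall i, (i <= n)%N -> b`_i = d`_i) -> (a * b)`_n = (c * d)`_n.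
  move=> ac bd; rewrite !coefM; apply: eq_bigr => i _.
  by rewrite ac ?bd ?leq_subr // -ltnS.
rewrite !(psM_trunc _ _ (leqnn n.+1)).
transitivity (trunc n.+1 f * (trunc n.+1 g * trunc n.+1 h))`_n.
  by apply: coefM_eq => // i iN; rewrite coef_poly ltnS iN (@psM_trunc n.+1).
rewrite mulrA; apply: coefM_eq => // i iN.
by rewrite [RHS]coef_poly ltnS iN (@psM_trunc n.+1).
Qed.

Lemma psMC : commutative psM.
Proof.
by move=> f g; apply: funext => n; rewrite !(psM_trunc _ _ (leqnn n.+1)) mulrC.
Qed.

Lemma psM1 : left_id ps_one psM.
Proof.
move=> f; apply: funext => n; rewrite /psM big_ord_recl /= mul1r subn0.
by rewrite big1 ?addr0 // => i _; rewrite mul0r.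
Qed.

Lemma psMDl : left_distributive psM ps_add.
Proof.
move=> f g h; apply: funext => n; rewrite /psM /ps_add -big_split /=.
by apply: eq_bigr => i _; rewrite mulrDl.
Qed.

Lemma ps_one_neq0 : ps_one != ps_zero.
Proof. by apply/eqP => /(congr1 (fun f : psr => f 0%N)) /eqP; rewrite oner_eq0. Qed.

HB.instance Definition _ :=
  GRing.Zmodule_isComNzRing.Build psr psMA psMC psM1 psMDl ps_one_neq0.

Lemma psD (f g : psr) n : (f + g) n = f n + g n. Proof. by []. Qed.
Lemma psE0 n : (0 : psr) n = 0. Proof. by []. Qed.
Lemma psE1 n : (1 : psr) n = (n == 0)%:R. Proof. by []. Qed.
Lemma psEM (f g : psr) n : (f * g) n = \sum_(i < n.+1) f i * g (n - i)%N.
Proof. by []. Qed.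
Lemma psN (f : psr) n : (- f) n = - f n. Proof. by []. Qed.
Lemma ps_sum I (r : seq I) (P : pred I) (f : I -> psr) n :
  (\sum_(i <- r | P i) f i) n = \sum_(i <- r | P i) f i n.
Proof. by elim/big_rec2: _ => [//|i y x _ <-]. Qed.

Definition psP (p : {poly K}) : psr := fun n => p`_n.

Lemma psP_zmod : zmod_morphism psP.
Proof. by move=> p r; apply: funext => n; rewrite /psP coefB. Qed.
Lemma psP_monoid : monoid_morphism psP.
Proof.
split=> [|p r]; apply: funext => n; rewrite /psP ?coef1 //.
by rewrite coefM.
Qed.
HB.instance Definition _ := GRing.isZmodMorphism.Build {poly K} psr psP psP_zmod.
HB.instance Definition _ := GRing.isMonoidMorphism.Build {poly K} psr psP psP_monoid.

End PowerSeries.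

Section PSMap.
Variables (K L : comNzRingType) (f : {rmorphism K -> L}).
Definition psmap (g : psr K) : psr L := fun n => f (g n).

Lemma psmap_zmod : zmod_morphism psmap.
Proof. by move=> p r; apply: funext => n; rewrite /psmap rmorphB. Qed.
Lemma psmap_monoid : monoid_morphism psmap.
Proof.
split=> [|p r]; apply: funext => n; rewrite /psmap; first exact: rmorph_nat.
by rewrite rmorph_sum; apply: eq_bigr => i _; rewrite rmorphM.
Qed.
HB.instance Definition _ := GRing.isZmodMorphism.Build (psr K) (psr L) psmap psmap_zmod.
HB.instance Definition _ := GRing.isMonoidMorphism.Build (psr K) (psr L) psmap psmap_monoid.

Lemma psmapP p : psmap (psP p) = psP (map_poly f p).
Proof. by apply: funext => n; rewrite /psmap /psP coef_map. Qed.

End PSMap.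

(** * Absolute values, limits and entire series *)

Section AbsoluteValue.
Context {F : finFieldType} {R : realType} (C : valued_closed_field F R).
Local Notation Q := (#|F|%:R : R).
Local Notation abs := (absv C).
Implicit Types (x y : C) (u v : nat -> C).

Lemma Q_gt1 : 1 < Q.
Proof. by rewrite ltr1n q_gt1. Qed.

Lemma Q_gt0 : 0 < Q.
Proof. exact: lt_trans Q_gt1. Qed.

Lemma QX_gt0 n : 0 < Q ^+ n.
Proof. by rewrite exprn_gt0 ?Q_gt0. Qed.

Lemma QX_ge1 n : 1 <= Q ^+ n.
Proof. by rewrite exprn_ege1 // ltW ?Q_gt1. Qed.

Lemma ler_QX m n : (Q ^+ m <= Q ^+ n) = (m <= n)%N.
Proof. by rewrite ler_eXn2l // Q_gt1. Qed.

Lemma QX_unbounded (r : R) : exists n, r <= Q ^+ n.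
Proof.
exists (Num.bound r); apply: le_trans (ler_norm r) (ltW (lt_le_trans (archi_boundP (normr_ge0 r)) _)).
rewrite -natrX ler_nat; apply: leq_trans (ltnW (ltn_expl _ q_gt1)).
by rewrite /Num.bound normr_id.
Qed.

Lemma absv0 : abs 0 = 0.
Proof. exact/absv_eq0. Qed.

Lemma absv_eq0b x : (abs x == 0) = (x == 0).
Proof. by apply/eqP/eqP => /absv_eq0. Qed.

Lemma absv_gt0 x : (0 < abs x) = (x != 0).
Proof. by rewrite lt_neqAle absv_ge0 andbT eq_sym absv_eq0b. Qed.

Lemma absv1 : abs 1 = 1.
Proof.
have a0 : abs 1 != 0 by rewrite absv_eq0b oner_eq0.
by apply: (mulfI a0); rewrite -absvM !mulr1.
Qed.

Lemma absvX x n : abs (x ^+ n) = abs x ^+ n.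
Proof. by elim: n => [|n IH]; rewrite ?expr0 ?absv1 // !exprS absvM IH. Qed.

Lemma absvN x : abs (- x) = abs x.
Proof.
have : abs (- x) ^+ 2 == abs x ^+ 2 by rewrite -!absvX sqrrN.
by rewrite eqrXn2 ?absv_ge0 // => /eqP.
Qed.

Lemma absvB x y : abs (x - y) <= Num.max (abs x) (abs y).
Proof. by rewrite -(absvN y) absvD. Qed.

Lemma absvBC x y : abs (x - y) = abs (y - x).
Proof. by rewrite -absvN opprB. Qed.

Lemma absvD_le x y r : abs x <= r -> abs y <= r -> abs (x + y) <= r.
Proof. by move=> xr yr; apply: le_trans (absvD x y) _; rewrite ge_max xr. Qed.

Lemma absvB_le x y r : abs x <= r -> abs y <= r -> abs (x - y) <= r.
Proof. by move=> xr yr; apply: absvD_le; rewrite ?absvN. Qed.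

Lemma absvV x : abs x^-1 = (abs x)^-1.
Proof.
have [->|x0] := eqVneq x 0; first by rewrite invr0 absv0 invr0.
have a0 : abs x != 0 by rewrite absv_eq0b.
by apply: (mulfI a0); rewrite -absvM !divff // absv1.
Qed.

Lemma absv_sum I (r : seq I) (P : pred I) (f : I -> C) b :
  0 <= b -> (forall i, P i -> abs (f i) <= b) ->
  abs (\sum_(i <- r | P i) f i) <= b.
Proof.
move=> b0 fb; elim/big_rec: _ => [|i x Pi xb]; first by rewrite absv0.
by apply: absvD_le => //; apply: fb.
Qed.

Lemma absv_prod I (r : seq I) (P : pred I) (f : I -> C) :
  abs (\prod_(i <- r | P i) f i) = \prod_(i <- r | P i) abs (f i).
Proof. by elim/big_rec2: _ => [|i x y _ <-]; rewrite ?absv1 ?absvM. Qed.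

Lemma absvD_eq x y : abs y < abs x -> abs (x + y) = abs x.
Proof.
move=> yx; apply/eqP; rewrite eq_le absvD_le ?(ltW yx) //=.
rewrite leNgt; apply/negP => xyx.
have : abs (x + y - y) < abs x.
  by apply: le_lt_trans (absvB _ _) _; rewrite gt_max xyx.
by rewrite addrK ltxx.
Qed.

Lemma absv_frob m x : abs (frob m x) = abs x ^+ (#|F| ^ m).
Proof. exact: absvX. Qed.

(** Nonzero elements of F are roots of unity, so the absolute value is trivial on them. *)
Lemma absv_embF (a : F) : a != 0 -> abs (embF C a) = 1.
Proof.
move=> a0; have : abs (embF C a) ^+ #|F|.-1 == 1 ^+ #|F|.-1.
  rewrite -absvX -rmorphXn expr1n /= (_ : a ^+ _ = 1) ?rmorph1 ?absv1 //.
  by apply: (mulfI a0); rewrite -exprS prednK ?q_gt0 // mulr1 expf_card.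
rewrite eqrXn2 ?absv_ge0 // => [/eqP //|].
by rewrite -ltnS prednK ?q_gt0 // q_gt1.
Qed.

Lemma absv_embF_le1 (a : F) : abs (embF C a) <= 1.
Proof.
have [->|a0] := eqVneq a 0; first by rewrite rmorph0 absv0.
by rewrite absv_embF.
Qed.

Lemma convergesP u l : converges u l <->
  forall e : R, 0 < e -> exists N, forall n, (N <= n)%N -> abs (u n - l) < e.
Proof.
split.
  move=> /cvgr0Pnorm_lt ul e /ul [N _ Nu]; exists N => n /Nu /=.
  by rewrite ger0_norm ?absv_ge0.
move=> H; apply/cvgr0Pnorm_lt => e /H [N Nu]; exists N => // n /Nu /=.
by rewrite ger0_norm ?absv_ge0.
Qed.

Lemma converges_uniq u l l' : converges u l -> converges u l' -> l = l'.
Proof.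
move=> /convergesP ul /convergesP ul'; apply/eqP; rewrite -subr_eq0 -absv_eq0b.
rewrite eq_le absv_ge0 andbT leNgt; apply/negP => d0.
have [N uN] := ul _ d0; have [N' uN'] := ul' _ d0.
have := uN _ (leq_maxl N N'); have := uN' _ (leq_maxr N N').
set n := maxn _ _ => a1 a2.
have : abs (l - l') < abs (l - l'); last by rewrite ltxx.
rewrite {1}(_ : l - l' = (u n - l') - (u n - l)); last by ring.
by apply: le_lt_trans (absvB _ _) _; rewrite gt_max a1.
Qed.

Lemma limit_eq u l : converges u l -> limit u = l.
Proof. by move=> ul; apply: xget_unique => // l' /= ul'; apply: converges_uniq ul' ul. Qed.

Lemma convergesD u v l l' :
  converges u l -> converges v l' -> converges (fun n => u n + v n) (l + l').
Proof.
move=> /convergesP ul /convergesP vl; apply/convergesP => e e0.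
have [N uN] := ul _ e0; have [N' uN'] := vl _ e0.
exists (maxn N N') => n; rewrite geq_max => /andP[/uN a1 /uN' a2].
rewrite (_ : _ - _ = (u n - l) + (v n - l')); last by ring.
by apply: le_lt_trans (absvD _ _) _; rewrite gt_max a1.
Qed.

Lemma convergesZ u l c : converges u l -> converges (fun n => c * u n) (c * l).
Proof.
move=> /convergesP ul; apply/convergesP => e e0.
have [->|c0] := eqVneq c 0; first by exists 0%N => n _; rewrite !mul0r subrr absv0.
have ac : 0 < abs c by rewrite absv_gt0.
have [N uN] := ul _ (divr_gt0 e0 ac).
by exists N => n /uN; rewrite -mulrBr absvM ltr_pdivlMr // mulrC.
Qed.

Lemma convergesB u v l l' :
  converges u l -> converges v l' -> converges (fun n => u n - v n) (l - l').
Proof.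
move=> ul vl; have := convergesD ul (convergesZ (-1) vl); rewrite mulN1r.
by congr converges; apply: funext => n; rewrite mulN1r.
Qed.

Lemma converges_bound u l b :
  converges u l -> (forall n, abs (u n) <= b) -> abs l <= b.
Proof.
move=> /convergesP ul ub; rewrite leNgt; apply/negP => bl.
have l0 : 0 < abs l by apply: le_lt_trans (absv_ge0 _) (le_lt_trans (ub 0%N) bl).
have [N /(_ N (leqnn _)) uN] := ul _ l0.
have : abs (u N + (l - u N)) <= Num.max (abs (u N)) (abs (l - u N)) by exact: absvD.
rewrite addrC subrK leNgt gt_max absvBC uN andbT.
by rewrite (le_lt_trans (ub N) bl).
Qed.

Lemma convergesM u v l l' :
  converges u l -> converges v l' -> converges (fun n => u n * v n) (l * l').
Proof.
move=> cu cv; have ul := convergesZ l' cu.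
suff : converges (fun n => u n * (v n - l')) 0.
  move=> h; have := convergesD h ul; rewrite add0r mulrC.
  by congr converges; apply: funext => n; ring.
move: cu cv => /convergesP cu /convergesP cv; apply/convergesP => e e0.
have [N uN] := cu 1 ltr01.
pose B := Num.max 1 (abs l).
have B0 : 0 < B by rewrite lt_max ltr01.
have [N' vN] := cv _ (divr_gt0 e0 B0).
exists (maxn N N') => n; rewrite geq_max => /andP[/uN a1 /vN a2].
rewrite subr0 absvM; apply: (@le_lt_trans _ _ (B * abs (v n - l'))); last first.
  by rewrite mulrC -ltr_pdivlMr.
apply: ler_wpM2r; first exact: absv_ge0.
rewrite -(subrK l (u n)); apply: absvD_le; rewrite le_max ?lexx ?orbT //.
by rewrite (ltW a1).
Qed.

Lemma converges_cst (l : C) : converges (fun=> l) l.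
Proof. by apply/convergesP => e e0; exists 0%N => n _; rewrite subrr absv0. Qed.

Lemma converges_frob m u l :
  converges u l -> converges (fun n => frob m (u n)) (frob m l).
Proof.
move=> /convergesP ul; apply/convergesP => e e0.
have d0 : 0 < Num.min e 1 by rewrite lt_min e0 ltr01.
have [N uN] := ul _ d0; exists N => n /uN.
rewrite -rmorphB absv_frob lt_min => /andP[ae a1].
apply: le_lt_trans ae; rewrite -[leRHS]expr1.
by rewrite ler_wiXn2l ?absv_ge0 // ?ltW // expq_gt0.
Qed.

Lemma converges_geom u l b :
  (forall n, abs (u n - l) * Q ^+ n <= b) -> converges u l.
Proof.
move=> ub; apply/convergesP => e e0.
have [N bN] := QX_unbounded ((b + 1) / e); exists N => n Nn.
rewrite -(ltr_pM2r (QX_gt0 n)); apply: le_lt_trans (ub n) _.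
apply: (@lt_le_trans _ _ (b + 1)); first by rewrite ltrDl.
by rewrite mulrC -ler_pdivrMr //; apply: le_trans bN _; rewrite ler_QX.
Qed.

Lemma converges_tail u v l N :
  (forall n, (N <= n)%N -> u n = v n) -> converges u l -> converges v l.
Proof.
move=> uv /convergesP ul; apply/convergesP => e /ul [N' uN].
exists (maxn N N') => n; rewrite geq_max => /andP[/uv <- /uN]; exact.
Qed.

End AbsoluteValue.

Section Entire.
Context {F : finFieldType} {R : realType} (C : Cinfty F R).
Local Notation Q := (#|F|%:R : R).
Local Notation abs := (absv C).
Local Notation theta := (theta C).
Implicit Types (x y : C) (u v : nat -> C) (f g : psr C) (p : {poly C}).

Lemma theta_neq0 : theta != 0.
Proof. by rewrite -absv_gt0 absv_theta Q_gt0. Qed.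

Lemma cauchy_geom u b : (forall n m, (n <= m)%N -> abs (u m - u n) * Q ^+ n <= b) ->
  exists2 l, converges u l & forall n, abs (l - u n) * Q ^+ n <= b.
Proof.
move=> ub.
have [l ul] : exists l, converges u l.
  apply: Cinf_complete => e e0.
  have [N bN] := @QX_unbounded F R ((b + 1) / e); exists N => m n.
  wlog mn : m n / (m <= n)%N => [H Nm Nn|Nm _].
    by have [mn|/ltnW nm] := leqP m n; [|rewrite absvBC]; apply: H.
  rewrite -(ltr_pM2r (@QX_gt0 F R m)) absvBC; apply: le_lt_trans (ub _ _ mn) _.
  apply: (@lt_le_trans _ _ (b + 1)); first by rewrite ltrDl.
  by rewrite mulrC -ler_pdivrMr //; apply: le_trans bN _; rewrite ler_QX.
exists l => // n; rewrite -ler_pdivlMr ?QX_gt0 //.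
apply: (@converges_bound _ _ C (fun m => u (n + m)%N - u n)).
  apply: convergesB; last exact: converges_cst.
  apply/convergesP => e e0.
  have /convergesP /(_ _ e0) [N uN] := ul; exists N => m Nm.
  by apply: uN; rewrite (leq_trans Nm) ?leq_addl.
by move=> m; rewrite ler_pdivlMr ?QX_gt0 // ub // leq_addr.
Qed.

(** Infinite radius of convergence, in integral exponents: f is bounded on every disc of radius Q^K.
    This part of [entire] is stable under products, twists and division by a zero. *)
Definition egrow f := forall K, exists b, forall n, abs (f n) * Q ^+ (K * n) <= Q ^+ b.

Lemma egrowD f g : egrow f -> egrow g -> egrow (f + g).
Proof.
move=> ef eg K; have [b fb] := ef K; have [c gc] := eg K.
exists (maxn b c) => n; rewrite -ler_pdivlMr ?QX_gt0 //.
apply: absvD_le; rewrite ler_pdivlMr ?QX_gt0 //.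
  by apply: le_trans (fb n) _; rewrite ler_QX leq_maxl.
by apply: le_trans (gc n) _; rewrite ler_QX leq_maxr.
Qed.

Lemma egrow0 : egrow 0.
Proof. by move=> K; exists 0%N => n; rewrite psE0 absv0 mul0r. Qed.

Lemma egrow_sum I (r : seq I) (P : pred I) (f : I -> psr C) :
  (forall i, P i -> egrow (f i)) -> egrow (\sum_(i <- r | P i) f i).
Proof. by move=> H; elim/big_rec: _ => [|i g /H ? ?]; [exact: egrow0|exact: egrowD]. Qed.

Lemma egrowM f g : egrow f -> egrow g -> egrow (f * g).
Proof.
move=> ef eg K; have [b fb] := ef K; have [c gc] := eg K.
exists (b + c)%N => n; rewrite -ler_pdivlMr ?QX_gt0 //.
apply: absv_sum => [|i _]; first by rewrite divr_ge0 ?ltW ?QX_gt0.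
have i_n : (i <= n)%N by rewrite -ltnS.
rewrite ler_pdivlMr ?QX_gt0 // absvM.
have -> : (K * n = K * i + K * (n - i))%N by rewrite -mulnDr subnKC.
rewrite !exprD mulrACA; apply: ler_pM => //; rewrite mulr_ge0 ?absv_ge0 ?ltW ?QX_gt0 //.
Qed.

Lemma egrowX f n : egrow f -> egrow (f ^+ n).
Proof.
move=> ef; elim: n => [|n IH]; last by rewrite exprS; apply: egrowM.
rewrite expr0 => K; exists 0%N => -[|n]; rewrite psE1 ?absv0 ?mul0r //.
by rewrite absv1 muln0 mulr1.
Qed.

Lemma egrowP p : egrow (psP p).
Proof.
move=> K; have [b pb] : exists b, forall i : 'I_(size p), abs p`_i * Q ^+ (K * i) <= Q ^+ b.
  have H i : exists b, abs p`_i * Q ^+ (K * i) <= Q ^+ b by apply: QX_unbounded.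
  pose b i := sval (cid (H i)).
  exists (\max_(i < size p) b i)%N => i; apply: le_trans (svalP (cid (H i))) _.
  by rewrite ler_QX (leq_bigmax i).
exists b => n; have [np|np] := ltnP n (size p); first exact: (pb (Ordinal np)).
by rewrite /psP nth_default // absv0 mul0r ltW ?QX_gt0.
Qed.

Lemma egrow_frob m f : egrow f -> egrow (psmap (frob m) f).
Proof.
move=> ef K; have [b fb] := ef K; exists (b * #|F| ^ m)%N => n.
rewrite [Q ^+ (b * _)]exprM /psmap absv_frob.
apply: (@le_trans _ _ ((abs (f n) * Q ^+ (K * n)) ^+ (#|F| ^ m))).
  rewrite exprMn; apply: ler_wpM2l; first by rewrite exprn_ge0 ?absv_ge0.
  by rewrite -exprM ler_QX leq_pmulr ?expq_gt0.
by apply: lerXn2r (fb n); rewrite nnegrE ?mulr_ge0 ?absv_ge0 // ltW ?QX_gt0.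
Qed.

(** Taking K one larger than [abs x] requires leaves a factor Q^-n, hence geometric convergence at
    x. *)
Lemma egrow_term f x : egrow f ->
  exists b, forall n, abs (f n) * abs x ^+ n * Q ^+ n <= Q ^+ b.
Proof.
have [k xk] := @QX_unbounded F R (abs x) => /(_ k.+1) [b fb]; exists b => n.
apply: le_trans (fb n); rewrite -mulrA; apply: ler_wpM2l; first exact: absv_ge0.
rewrite mulSn exprD mulrC; apply: ler_wpM2l; first by rewrite ltW ?QX_gt0.
by rewrite exprM; apply: lerXn2r => //; rewrite nnegrE ?absv_ge0 ?ltW ?QX_gt0.
Qed.

Definition hasval f x y := converges (fun n => \sum_(i < n) f i * x ^+ i) y.

Lemma egrow_hasval f x : egrow f -> hasval f x (ps_eval f x).
Proof.
move=> ef; have [b fb] := egrow_term x ef.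
suff [l fl] : exists l, hasval f x l by rewrite /ps_eval (limit_eq fl).
have [|l ul _] := @cauchy_geom (fun n => \sum_(i < n) f i * x ^+ i) (Q ^+ b); last by exists l.
move=> n m nm; rewrite -(subnKC nm) big_split_ord /= addrAC subrr add0r.
rewrite -ler_pdivlMr ?QX_gt0 //; apply: absv_sum => [|i _].
  by rewrite divr_ge0 ?ltW ?QX_gt0.
rewrite ler_pdivlMr ?QX_gt0 //; apply: le_trans (fb (n + i)%N).
rewrite absvM absvX; apply: ler_wpM2l; last by rewrite ler_QX leq_addr.
by rewrite mulr_ge0 ?exprn_ge0 ?absv_ge0.
Qed.

Lemma hasval_eval f x y : hasval f x y -> ps_eval f x = y.
Proof. exact: limit_eq. Qed.

Lemma hasvalD f g x y z : hasval f x y -> hasval g x z -> hasval (f + g) x (y + z).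
Proof.
move=> fy gz; have := convergesD fy gz; congr converges.
by apply: funext => n; rewrite -big_split; apply: eq_bigr => i _; rewrite mulrDl.
Qed.

Lemma ps_evalD f g x : egrow f -> egrow g ->
  ps_eval (f + g) x = ps_eval f x + ps_eval g x.
Proof.
by move=> ef eg; apply: hasval_eval; apply: hasvalD; apply: egrow_hasval.
Qed.

Lemma ps_eval0 x : ps_eval (0 : psr C) x = 0.
Proof.
apply: hasval_eval; apply: (@converges_tail _ _ C (fun=> 0) _ _ 0) => [n _|].
  by rewrite big1 // => i _; rewrite mul0r.
exact: converges_cst.
Qed.

Lemma ps_eval_sum I (r : seq I) (P : pred I) (f : I -> psr C) x :
  (forall i, P i -> egrow (f i)) ->
  ps_eval (\sum_(i <- r | P i) f i) x = \sum_(i <- r | P i) ps_eval (f i) x.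
Proof.
move=> H; elim: r => [|i r IH]; first by rewrite !big_nil ps_eval0.
rewrite !big_cons; case: ifPn => // Pi.
by rewrite ps_evalD ?IH //; [exact: H|exact: egrow_sum].
Qed.

Lemma ps_evalP p x : ps_eval (psP p) x = p.[x].
Proof.
apply: hasval_eval.
apply: (@converges_tail _ _ C (fun=> p.[x]) _ _ (size p)) => [n pn|].
  by rewrite (horner_coef_wide _ pn).
exact: converges_cst.
Qed.

Lemma trunc_horner n f x : (trunc n f).[x] = \sum_(i < n) f i * x ^+ i.
Proof. by rewrite horner_poly. Qed.

(** The truncated product and the product of the truncations agree below degree n, and their terms
    of degree k >= n are at most Q^(b + c - k), so the difference tends to 0. *)
Lemma ps_evalM f g x : egrow f -> egrow g ->
  ps_eval (f * g) x = ps_eval f x * ps_eval g x.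
Proof.
move=> ef eg.
have /hasval_eval -> // : hasval (f * g) x (ps_eval f x * ps_eval g x).
have fg := convergesM (egrow_hasval x ef) (egrow_hasval x eg).
suff h : converges (fun n => \sum_(i < n) (f * g) i * x ^+ i -
    (\sum_(i < n) f i * x ^+ i) * (\sum_(i < n) g i * x ^+ i)) 0.
  have := convergesD h fg; rewrite add0r; congr converges.
  by apply: funext => n; rewrite subrK.
have [b fb] := egrow_term x ef; have [c gc] := egrow_term x eg.
apply: (@converges_geom _ _ _ _ _ (Q ^+ (b + c))) => n; rewrite subr0 -!trunc_horner.
rewrite -hornerM -hornerN -hornerD.
set p := _ - _; rewrite horner_coef -ler_pdivlMr ?QX_gt0 //.
apply: absv_sum => [|k _]; first by rewrite divr_ge0 ?ltW ?QX_gt0.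
have [kn|nk] := ltnP k n.
  have fgk : (f * g) k = (trunc n f * trunc n g)`_k by apply: psM_trunc.
  rewrite /p coefB coef_poly kn fgk subrr mul0r absv0.
  by rewrite divr_ge0 ?ltW ?QX_gt0.
rewrite ler_pdivlMr ?QX_gt0 //.
apply: (@le_trans _ _ (abs (p`_k * x ^+ k) * Q ^+ k)).
  by apply: ler_wpM2l; rewrite ?absv_ge0 ?ler_QX.
rewrite -ler_pdivlMr ?QX_gt0 // /p coefB coef_poly ltnNge nk /= add0r mulNr absvN.
rewrite coefM mulr_suml; apply: absv_sum => [|i _]; first by rewrite divr_ge0 ?ltW ?QX_gt0.
rewrite ler_pdivlMr ?QX_gt0 // !coef_poly.
case: ifP => _; last by rewrite !mul0r absv0 mul0r ltW ?QX_gt0.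
case: ifP => _; last by rewrite mulr0 mul0r absv0 mul0r ltW ?QX_gt0.
have ik : (i <= k)%N by rewrite -ltnS.
have -> : Q ^+ k = Q ^+ i * Q ^+ (k - i) by rewrite -exprD subnKC.
rewrite !absvM absvX.
have -> : abs x ^+ k = abs x ^+ i * abs x ^+ (k - i) by rewrite -exprD subnKC.
rewrite [X in X * _ <= _]mulrACA [X in X <= _]mulrACA.
by rewrite [Q ^+ (b + c)]exprD; apply: ler_pM => //; rewrite !mulr_ge0 ?exprn_ge0 ?absv_ge0.
Qed.

Lemma ps_eval_frob m f x : egrow f ->
  ps_eval (psmap (frob m) f) (frob m x) = frob m (ps_eval f x).
Proof.
move=> /(egrow_hasval x) /(converges_frob m) H; apply: hasval_eval.
move: H; congr converges; apply: funext => n; rewrite rmorph_sum.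
by apply: eq_bigr => i _; rewrite rmorphM rmorphXn.
Qed.

End Entire.

(** * Zeros of entire series *)

Section Zeros.
Context {F : finFieldType} {R : realType} (C : Cinfty F R).
Local Notation Q := (#|F|%:R : R).
Local Notation abs := (absv C).
Local Notation theta := (theta C).
Implicit Types (x y : C) (f g : psr C) (p : {poly C}).

Lemma entire_egrow f : entire f -> egrow f.
Proof.
case=> _ /cvgr0Pnorm_lt f0 _ K.
have [N _ fN] := f0 _ (divr_gt0 ltr01 (@QX_gt0 F R K)).
have bound n : exists b, abs (f n) * Q ^+ (K * n) <= Q ^+ b by apply: QX_unbounded.
pose b n := sval (cid (bound n)).
(* The maximum includes the index N, so that the root bound is used only for n > 0, where the n-th
   root is a genuine one. *)
exists (\max_(i < N.+1) b i)%N => n; have [nN|Nn] := ltnP n N.+1.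
  apply: le_trans (svalP (cid (bound n))) _.
  by rewrite ler_QX (leq_bigmax (Ordinal nN)).
apply: (@le_trans _ _ 1); last exact: QX_ge1.
have n0 : (0 < n)%N by apply: leq_trans Nn.
have := fN n (ltnW Nn); rewrite /= ger0_norm ?powR_ge0 // => /ltW H.
rewrite -ler_pdivlMr ?QX_gt0 //.
have -> : abs (f n) = (abs (f n) `^ n%:R^-1) ^+ n.
  rewrite -powR_mulrn ?powR_ge0 // -powRrM mulVf ?powRr1 ?absv_ge0 //.
  by rewrite pnatr_eq0 -lt0n.
have -> : 1 / Q ^+ (K * n) = (1 / Q ^+ K) ^+ n by rewrite expr_div_n expr1n exprM.
apply: lerXn2r => //; rewrite nnegrE.
  exact: powR_ge0.
by rewrite divr_ge0 // ltW ?QX_gt0.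
Qed.

(** The expansion of f / (t - x) at t = 0, from 1 / (t - x) = - sum of x^-(n+1) t^n. *)
Definition ps_div f x : psr C := fun n => - (x ^- n.+1 * \sum_(k < n.+1) f k * x ^+ k).

Lemma ps_divK f x : x != 0 -> psP ('X - x%:P) * ps_div f x = f.
Proof.
move=> x0; apply: funext => n; rewrite psEM.
have -> : \sum_(i < n.+1) psP ('X - x%:P) i * ps_div f x (n - i)%N =
    - x * ps_div f x n + (n != 0)%:R * ps_div f x n.-1.
  case: n => [|n]; rewrite !big_ord_recl /=.
    by rewrite big_ord0 /psP coefB coefX coefC /= sub0r mul0r subn0.
  rewrite big1 ?addr0 => [|i _].
    by rewrite /psP !coefB !coefX !coefC /= sub0r subr0 subn0 subn1.
  by rewrite /psP !coefB !coefX !coefC /= subr0 mul0r.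
case: n => [|n] /=.
  by rewrite /ps_div big_ord_recl big_ord0 !expr0 expr1 mulrNN; field.
rewrite /ps_div big_ord_recr /= [x ^+ n.+2]exprS.
have xn : x ^+ n.+1 != 0 by rewrite expf_neq0.
set S := \sum_(_ < _) _; move: (x ^+ n.+1) xn => X X0.
by field; rewrite x0 X0.
Qed.

(** As f(x) = 0, the partial sum in [ps_div] is minus a tail of the series, whose powers of x
    compensate x^-(n+1). Division by t - x thus lowers the sup norm on the disc of radius r by a
    factor r, although x may be much smaller than r. *)
Lemma ps_div_bound f x (r B : R) : egrow f -> x != 0 -> ps_eval f x = 0 -> abs x <= r ->
  (forall k, abs (f k) * r ^+ k <= B) ->
  forall n, abs (ps_div f x n) * r ^+ n.+1 <= B.
Proof.
move=> ef x0 fx0 xr fB n.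
have ax : 0 < abs x by rewrite absv_gt0.
have r0 : 0 < r by apply: lt_le_trans xr.
have B0 : 0 <= B by apply: le_trans (fB 0%N); rewrite expr0 mulr1 absv_ge0.
rewrite /ps_div absvN absvM absvV absvX mulrAC mulrC -ler_pdivlMr; last first.
  by rewrite mulr_gt0 ?invr_gt0 ?exprn_gt0.
rewrite invfM invrK.
set S := fun m => \sum_(k < m) f k * x ^+ k.
have Sn : converges (fun m => S n.+1 - S (n.+1 + m)%N) (S n.+1).
  rewrite -[X in converges _ X]subr0; apply: convergesB; first exact: converges_cst.
  have /convergesP := egrow_hasval x ef; rewrite fx0 => H; apply/convergesP => e /H [N HN].
  by exists N => m Nm; apply: HN; apply: leq_trans Nm (leq_addl _ _).
apply: (converges_bound Sn) => m.
rewrite /S big_split_ord /= opprD addrA subrr sub0r absvN.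
have xn0 : 0 < abs x ^+ n.+1 / r ^+ n.+1 by rewrite divr_gt0 ?exprn_gt0.
apply: absv_sum => [|i _]; first by rewrite mulr_ge0 // ltW.
rewrite -ler_pdivrMr // absvM absvX exprD.
have -> : abs (f (n.+1 + i)%N) * (abs x ^+ n.+1 * abs x ^+ i) / (abs x ^+ n.+1 / r ^+ n.+1) =
    abs (f (n.+1 + i)%N) * (abs x ^+ i * r ^+ n.+1).
  have : abs x ^+ n.+1 != 0 by rewrite gt_eqF ?exprn_gt0.
  have : r ^+ n.+1 != 0 by rewrite gt_eqF ?exprn_gt0.
  by move: (r ^+ n.+1) (abs x ^+ n.+1) => y z y0 z0; field; rewrite y0 z0.
apply: le_trans (fB (n.+1 + i)%N); apply: ler_wpM2l; first exact: absv_ge0.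
rewrite exprD mulrC; apply: ler_wpM2l; first by rewrite exprn_ge0 ?(ltW r0).
by apply: lerXn2r => //; rewrite nnegrE ?absv_ge0 ?(ltW r0).
Qed.

Lemma egrow_div f x : egrow f -> x != 0 -> ps_eval f x = 0 -> egrow (ps_div f x).
Proof.
move=> ef x0 fx0 K; have [k xk] := @QX_unbounded F R (abs x).
have [b fb] := ef (K + k)%N; exists b => n.
have xr : abs x <= Q ^+ (K + k) by apply: le_trans xk _; rewrite ler_QX leq_addl.
have fb' k0 : abs (f k0) * Q ^+ (K + k) ^+ k0 <= Q ^+ b by rewrite -exprM; apply: fb.
apply: le_trans (@ps_div_bound f x _ (Q ^+ b) ef x0 fx0 xr fb' n).
apply: ler_wpM2l; first exact: absv_ge0.
by rewrite -exprM ler_QX; nia.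
Qed.

Lemma ps_div_first f x v : x != 0 -> (forall k, (k < v)%N -> f k = 0) ->
  (forall k, (k < v)%N -> ps_div f x k = 0) /\ abs (f v) = abs x * abs (ps_div f x v).
Proof.
move=> x0 fv; split=> [k kv|]; rewrite /ps_div.
  by rewrite big1 ?mulr0 ?oppr0 // => i _; rewrite fv ?mul0r // (leq_ltn_trans _ kv) // -ltnS.
rewrite big_ord_recr big1 /= => [|i _]; last by rewrite fv ?mul0r.
rewrite add0r absvN -absvM; congr (absv C _).
have : x ^+ v != 0 by rewrite expf_neq0.
by rewrite exprS; move: (x ^+ v) => X X0; field; rewrite x0 X0.
Qed.

(* Schwarz lemma: each zero costs a factor r/|x| in the leading coefficient. *)
Lemma leading_coef_zeros (s : seq C) f (r B : R) v : egrow f -> 0 < r -> uniq s ->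
  (forall x, x \in s -> [/\ x != 0, abs x <= r & ps_eval f x = 0]) ->
  (forall k, abs (f k) * r ^+ k <= B) ->
  (forall k, (k < v)%N -> f k = 0) ->
  abs (f v) * r ^+ (v + size s) <= B * \prod_(x <- s) abs x.
Proof.
elim: s f B => [|x s IH] f B ef r0.
  by move=> _ _ fB _; rewrite big_nil addn0 mulr1.
move=> /= /andP[xs us] fs fB fv.
have [x0 xr fx0] := fs x (mem_head _ _).
have [gv ->] := ps_div_first x0 fv.
have := IH (ps_div f x) (B / r) (egrow_div ef x0 fx0) r0 us.
rewrite big_cons => H.
have ax : 0 < abs x by rewrite absv_gt0.
have -> : abs x * abs (ps_div f x v) * r ^+ (v + (size s).+1) =
    abs x * r * (abs (ps_div f x v) * r ^+ (v + size s)) by rewrite addnS exprSr; ring.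
have -> : B * (abs x * \prod_(j <- s) abs j) = abs x * r * (B / r * \prod_(j <- s) abs j).
  by field; rewrite gt_eqF.
apply: ler_wpM2l; first by rewrite mulr_ge0 ?ltW.
apply: H => [y ys|k|//].
  have [|y0 yr fy0] := fs y; first by rewrite inE ys orbT.
  split=> //; apply/eqP; have : y - x != 0.
    by rewrite subr_eq0; apply: contraNneq xs => <-.
  move/mulfI/inj_eq => <-; rewrite mulr0 -fy0 -{2}(ps_divK f x0) ps_evalM ?ps_evalP.
  - by rewrite hornerXsubC.
  - exact: egrowP.
  - exact: egrow_div.
rewrite ler_pdivlMr // -mulrA -exprSr.
exact: (ps_div_bound ef).
Qed.

End Zeros.

(** * The field F(theta) and its algebraic elements *)

Section BaseField.
Context {F : finFieldType} {R : realType} (C : Cinfty F R).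
Local Notation Q := (#|F|%:R : R).
Local Notation abs := (absv C).
Local Notation theta := (theta C).
Local Notation kf := (kfield C).

Implicit Types p : {poly F}.
Definition ev : {poly F} -> C := horner_eval theta \o map_poly (embF C).
HB.instance Definition _ := GRing.RMorphism.copy ev (horner_eval theta \o map_poly (embF C)).

Lemma evE p : ev p = (map_poly (embF C) p).[theta]. Proof. by []. Qed.

Lemma evX : ev 'X = theta.
Proof. by rewrite evE map_polyX hornerX. Qed.

Lemma ev_coef p : ev p = \sum_(i < size p) embF C p`_i * theta ^+ i.
Proof.
by rewrite evE horner_coef size_map_poly; apply: eq_bigr => i _; rewrite coef_map.
Qed.

(** The leading term strictly dominates. This gives the transcendence of theta over F and the lower
    bound 1 on nonzero elements of F[theta], from which all other lower bounds derive. *)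
Lemma absv_ev p : p != 0 -> abs (ev p) = Q ^+ (size p).-1.
Proof.
move=> p0; rewrite ev_coef -[in LHS](@prednK (size p)) ?size_poly_gt0 // big_ord_recr /=.
set S := \sum_(_ < _) _; set T := _ * theta ^+ _.
have aT : abs T = Q ^+ (size p).-1.
  by rewrite absvM absvX absv_theta absv_embF ?mul1r // -lead_coefE lead_coef_eq0.
rewrite addrC absvD_eq // aT {aT T}; rewrite /S; case: (size p).-1 => [|n].
  by rewrite big_ord0 absv0 expr0 ltr01.
apply: (@le_lt_trans _ _ (Q ^+ n)); last by rewrite ltr_eXn2l // Q_gt1.
apply: absv_sum => [|i _]; first by rewrite ltW ?QX_gt0.
rewrite absvM -[leRHS]mul1r; apply: ler_pM; rewrite ?absv_ge0 ?absv_embF_le1 //.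
by rewrite absvX absv_theta ler_QX -ltnS.
Qed.

Lemma ev_eq0 p : (ev p == 0) = (p == 0).
Proof.
have [->|p0] := eqVneq p 0; first by rewrite rmorph0 eqxx.
by apply/negbTE; rewrite -absv_gt0 absv_ev ?QX_gt0.
Qed.

Lemma absv_ev_ge1 p : p != 0 -> 1 <= abs (ev p).
Proof. by move=> /absv_ev ->; rewrite QX_ge1. Qed.

Lemma absv_ev_le p n : (size p <= n.+1)%N -> abs (ev p) <= Q ^+ n.
Proof.
have [->|p0] := eqVneq p 0; first by rewrite rmorph0 absv0 ltW ?QX_gt0.
by move=> pn; rewrite absv_ev // ler_QX; case: (size p) pn.
Qed.

Lemma kfieldP x : kf x <-> exists P, exists2 S, S != 0 & x = ev P / ev S.
Proof. by split=> [[P [S [S0 ->]]]|[P [S S0 ->]]]; exists P, S. Qed.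

Lemma kfield_ev p : kf (ev p).
Proof. by apply/kfieldP; exists p, 1; rewrite ?oner_eq0 // rmorph1 divr1. Qed.

Lemma kfieldB x y : kf x -> kf y -> kf (x - y).
Proof.
move=> /kfieldP[P [S S0 ->]] /kfieldP[P' [S' S'0 ->]]; apply/kfieldP.
exists (P * S' - P' * S), (S * S'); first by rewrite mulf_neq0.
by rewrite !rmorphB !rmorphM; field; rewrite !ev_eq0 S0 S'0.
Qed.

Lemma kfield_div x y : kf x -> kf y -> kf (x / y).
Proof.
move=> /kfieldP[P [S S0 ->]] /kfieldP[P' [S' S'0 ->]]; apply/kfieldP.
have [->|P'0] := eqVneq P' 0.
  by exists 0, 1; rewrite ?oner_eq0 // !rmorph0 !mul0r invr0 mulr0.
exists (P * S'), (P' * S); first by rewrite mulf_neq0.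
by rewrite !rmorphM; field; rewrite !ev_eq0 S0 P'0 S'0.
Qed.

Lemma kfield1 : kf 1.
Proof. by rewrite -(rmorph1 ev); apply: kfield_ev. Qed.

Definition kpred : {pred C} := fun x => `[< kf x >].
Lemma kpredP x : reflect (kf x) (x \in kpred). Proof. exact: asboolP. Qed.

Lemma kpred_divring : divring_closed kpred.
Proof.
split=> [|x y /kpredP ? /kpredP ?|x y /kpredP ? /kpredP ?]; apply/kpredP.
- exact: kfield1.
- exact: kfieldB.
- exact: kfield_div.
Qed.
HB.instance Definition _ := GRing.isDivringClosed.Build C kpred kpred_divring.

(** F(theta) as a field type, so that the closure properties of [algebraicOver] transfer to
    [alg]. *)
Record kT := KT { kval : C; kvalP : kval \in kpred }.
HB.instance Definition _ := [isSub for kval].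
HB.instance Definition _ := [Choice of kT by <:].
HB.instance Definition _ := [SubChoice_isSubIntegralDomain of kT by <:].
HB.instance Definition _ := [SubIntegralDomain_isSubField of kT by <:].

HB.instance Definition _ := GRing.RMorphism.copy kval (\val : kT -> C).

Lemma kfield0 : kf 0. Proof. exact/kpredP/rpred0. Qed.
Lemma kfieldD x y : kf x -> kf y -> kf (x + y).
Proof. by move=> /kpredP kx /kpredP ky; apply/kpredP/rpredD. Qed.
Lemma kfieldN x : kf x -> kf (- x).
Proof. by move=> /kpredP kx; apply/kpredP; rewrite rpredN. Qed.
Lemma kfieldM x y : kf x -> kf y -> kf (x * y).
Proof. by move=> /kpredP kx /kpredP ky; apply/kpredP/rpredM. Qed.

Definition alg (x : C) : Prop := algebraic_over (kfield C) x.

Lemma algP x : alg x <-> algebraicOver (kval : {rmorphism kT -> C}) x.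
Proof.
split=> [[p [p0 kp px]]|[p p0 px]].
  exists (\poly_(i < size p) (KT (introT (kpredP _) (kp i)))).
    apply/eqP => /(congr1 (fun r : {poly kT} => kval r`_(size p).-1)).
    rewrite coef_poly prednK ?size_poly_gt0 // leqnn coef0 /= => /eqP.
    by rewrite -lead_coefE lead_coef_eq0 (negPf p0).
  rewrite (_ : map_poly _ _ = p) //; apply/polyP => i.
  rewrite coef_map coef_poly; case: ltnP => // ?.
  by rewrite [RHS]nth_default ?(rmorph0 (kval : {rmorphism kT -> C})).
exists (map_poly kval p); split=> [|i|//]; first by rewrite map_poly_eq0.
by rewrite coef_map; apply/kpredP/kvalP.
Qed.

Lemma algD x y : alg x -> alg y -> alg (x + y).
Proof. by rewrite !algP; apply: algebraic_add. Qed.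
Lemma algM x y : alg x -> alg y -> alg (x * y).
Proof. by rewrite !algP; apply: algebraic_mul. Qed.
Lemma algN x : alg x -> alg (- x).
Proof. by rewrite !algP; apply: algebraic_opp. Qed.
Lemma algV x : alg x -> alg x^-1.
Proof. by rewrite !algP; apply: algebraic_inv. Qed.
Lemma alg_kfield x : kf x -> alg x.
Proof.
by move=> /kpredP kx; rewrite algP; apply: (algebraic_id (kval : {rmorphism kT -> C}) (KT kx)).
Qed.
Lemma alg0 : alg 0. Proof. exact/alg_kfield/kfield0. Qed.
Lemma alg1 : alg 1. Proof. exact/alg_kfield/kfield1. Qed.
Lemma alg_theta : alg theta. Proof. by rewrite -evX; apply/alg_kfield/kfield_ev. Qed.
Lemma algX x n : alg x -> alg (x ^+ n).
Proof. by move=> ax; elim: n => [|n IH]; rewrite ?expr0 ?exprS; [exact: alg1|exact: algM]. Qed.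
Lemma alg_sum I (r : seq I) (P : pred I) (f : I -> C) :
  (forall i, P i -> alg (f i)) -> alg (\sum_(i <- r | P i) f i).
Proof. by move=> H; elim/big_rec: _ => [|i x /H ? ?]; [exact: alg0|exact: algD]. Qed.

Lemma alg_root x n : (0 < n)%N -> alg (x ^+ n) -> alg x.
Proof.
move=> n0 [p [p0 kp px]]; exists (p \Po 'X^n); split.
- by rewrite comp_poly_eq0 // size_polyXn.
- by move=> i; rewrite coef_comp_poly_Xn //; case: ifP => _; [exact: kp|exact: kfield0].
- by rewrite /root horner_comp hornerXn.
Qed.

Lemma kbar_alg x : kbar C x -> alg x. Proof. by case. Qed.

End BaseField.

(** * Finite extensions of F(theta) *)

Section FiniteExtensions.
Context {F : finFieldType} {R : realType} (C : Cinfty F R).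
Local Notation kf := (kfield C).

Definition kspan (I : finType) (e : I -> C) (x : C) : Prop :=
  exists2 c : I -> C, (forall i, kf (c i)) & x = \sum_i c i * e i.

Lemma kspan_gen (I : finType) (e : I -> C) i : kspan e (e i).
Proof.
exists (fun j => (j == i)%:R) => [j|]; first exact/kpredP/rpred_nat.
by rewrite (bigD1 i) //= eqxx mul1r big1 ?addr0 // => j /negPf ->; rewrite mul0r.
Qed.

Lemma kspan0 (I : finType) (e : I -> C) : kspan e 0.
Proof.
by exists (fun=> 0) => [i|]; [exact: kfield0|rewrite big1 // => i _; rewrite mul0r].
Qed.

Lemma kspanD (I : finType) (e : I -> C) x y : kspan e x -> kspan e y -> kspan e (x + y).
Proof.
move=> [c kc ->] [d kd ->]; exists (fun i => c i + d i) => [i|]; first exact: kfieldD.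
by rewrite -big_split; apply: eq_bigr => i _; rewrite mulrDl.
Qed.

Lemma kspanZ (I : finType) (e : I -> C) a x : kf a -> kspan e x -> kspan e (a * x).
Proof.
move=> ka [c kc ->]; exists (fun i => a * c i) => [i|]; first exact: kfieldM.
by rewrite mulr_sumr; apply: eq_bigr => i _; rewrite mulrA.
Qed.

Lemma kspan_sum (I : finType) (e : I -> C) J (r : seq J) (P : pred J) (f : J -> C) :
  (forall j, P j -> kspan e (f j)) -> kspan e (\sum_(j <- r | P j) f j).
Proof. by move=> H; elim/big_rec: _ => [|j x /H ? ?]; [exact: kspan0|exact: kspanD]. Qed.

(** A finite extension of F(theta), as a subring of C; inverses are not recorded, since a domain of
    finite dimension over a field is a field. *)
Record finalg (K : C -> Prop) : Prop := Finalg {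
  fa_kf : forall x, kf x -> K x;
  fa_sub : forall x y, K x -> K y -> K (x - y);
  fa_mul : forall x y, K x -> K y -> K (x * y);
  fa_alg : forall x, K x -> alg x;
  fa_fin : exists n (e : 'I_n -> C),
    (forall i, K (e i)) /\ (forall x, K x -> kspan e x) }.

Lemma fa_add K x y : finalg K -> K x -> K y -> K (x + y).
Proof.
move=> fK Kx Ky; rewrite -(opprK y) -[- y]sub0r; apply: (fa_sub fK) => //.
by apply: (fa_sub fK) => //; apply: (fa_kf fK); exact: kfield0.
Qed.

Lemma fa_sum K I (r : seq I) (P : pred I) (f : I -> C) : finalg K ->
  (forall i, P i -> K (f i)) -> K (\sum_(i <- r | P i) f i).
Proof.
move=> fK H; elim/big_rec: _ => [|i x /H ? ?]; last exact: fa_add.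
by apply: (fa_kf fK); exact: kfield0.
Qed.

Lemma finalg_kfield : finalg kf.
Proof.
split=> [//|x y kx ky|x y kx ky|x|]; [exact: kfieldB|exact: kfieldM|exact: alg_kfield|].
exists 1, (fun=> 1); split=> [i|x kx]; first exact: kfield1.
by exists (fun=> x) => //; rewrite big_ord1 mulr1.
Qed.

Lemma kspan_powers (a : C) : alg a ->
  exists d, forall n, kspan (fun i : 'I_d => a ^+ i) (a ^+ n).
Proof.
move=> [f [f0 kf_f fa]]; exists (size f).-1; set d := (size f).-1.
have df : size f = d.+1 by rewrite prednK // size_poly_gt0.
have ld : f`_d != 0 by rewrite -lead_coefE lead_coef_eq0.
have ad : a ^+ d = \sum_(i < d) (- f`_i / f`_d) * a ^+ i.
  move: fa; rewrite /root horner_coef df big_ord_recr /= addr_eq0 => /eqP fa.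
  apply: (mulfI ld); rewrite -[LHS]opprK -fa mulr_sumr -sumrN.
  by apply: eq_bigr => i _; field.
elim=> [|n [c kc IH]].
  have [d0|] := posnP d.
    move: df fa; rewrite d0 => /eqP /size_poly1P[c c0 ->]; rewrite /root hornerC.
    by rewrite (negPf c0).
  by move=> d0; apply: (kspan_gen (fun i : 'I_d => a ^+ i) (Ordinal d0)).
rewrite exprS IH mulr_sumr; apply: kspan_sum => i _.
rewrite mulrCA -exprS; apply: kspanZ => //.
have [id|] := ltnP i.+1 d; first exact: (kspan_gen (fun i : 'I_d => a ^+ i) (Ordinal id)).
move=> di; have -> : i.+1 = d by apply/eqP; rewrite eqn_leq di ltn_ord.
rewrite ad; apply: kspan_sum => j _; apply: kspanZ.
  by apply: kfield_div => //; apply: kfieldN.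
exact: (kspan_gen (fun i : 'I_d => a ^+ i) j).
Qed.

Lemma finalg_adjoin K a : finalg K -> alg a ->
  exists K', [/\ finalg K', forall x, K x -> K' x & K' a].
Proof.
move=> fK aa; exists (fun x => exists2 p : {poly C}, (forall i, K p`_i) & x = p.[a]).
have K0 : K 0 by apply: (fa_kf fK); exact: kfield0.
have K1 : K 1 by apply: (fa_kf fK); exact: kfield1.
have KC c : K c -> forall i, K (c%:P)`_i by move=> Kc i; rewrite coefC; case: ifP.
split; last by exists 'X => [i|]; rewrite ?hornerX // coefX; case: eqP.
  split.
  - by move=> x kx; exists x%:P; rewrite ?hornerC //; apply: KC; apply: (fa_kf fK).
  - move=> _ _ [p Kp ->] [r Kr ->]; exists (p - r); last by rewrite !hornerE.
    by move=> i; rewrite coefB; apply: fa_sub.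
  - move=> _ _ [p Kp ->] [r Kr ->]; exists (p * r); last by rewrite !hornerE.
    by move=> i; rewrite coefM; apply: fa_sum => // j _; apply: (fa_mul fK).
  - move=> _ [p Kp ->]; rewrite horner_coef; apply: alg_sum => i _.
    by apply: algM; [apply: (fa_alg fK)|apply: algX].
  - have [d ad] := kspan_powers aa; have [n [e [Ke eK]]] := fa_fin fK.
    pose e' (ij : 'I_n * 'I_d) := e ij.1 * a ^+ ij.2.
    exists #|{: 'I_n * 'I_d}|, (fun k => e' (enum_val k)); split=> [k|_ [p Kp ->]].
      exists ((e (enum_val k).1)%:P * 'X^((enum_val k).2)); last by rewrite !hornerE.
      by move=> i; rewrite coefCM coefXn; case: eqP => _; rewrite ?mulr1 ?mulr0.
    rewrite horner_coef; apply: kspan_sum => i _.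
    have [c kc ->] := eK _ (Kp i); have [b kb ->] := ad i.
    rewrite mulr_suml; apply: kspan_sum => j _; rewrite mulr_sumr; apply: kspan_sum => k _.
    rewrite mulrACA; apply: kspanZ; first exact: kfieldM.
    have := kspan_gen (fun k => e' (enum_val k)) (enum_rank (j, k)).
    by rewrite enum_rankK.
by move=> x Kx; exists x%:P; rewrite ?hornerC //; apply: KC.
Qed.

Lemma finalg_contains (s : seq C) : (forall a, a \in s -> alg a) ->
  exists2 K, finalg K & forall a, a \in s -> K a.
Proof.
elim: s => [|a s IH] H; first by exists kf => //; exact: finalg_kfield.
have [|K fK Ks] := IH; first by move=> b bs; apply: H; rewrite inE bs orbT.
have [K' [fK' KK' K'a]] := finalg_adjoin fK (H a (mem_head _ _)).
exists K' => // b; rewrite inE => /orP[/eqP -> //|/Ks]; exact: KK'.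
Qed.

(* A spanning family of minimal size among those starting with 1 is a basis. *)
Lemma finalg_basis K : finalg K -> exists m (e : 'I_m.+1 -> C),
  [/\ e ord0 = 1, forall i, K (e i), forall x, K x -> kspan e x
    & forall c : 'I_m.+1 -> C, (forall i, kf (c i)) ->
        \sum_i c i * e i = 0 -> forall i, c i = 0].
Proof.
move=> fK; pose good m := exists e : 'I_m.+1 -> C,
  [/\ e ord0 = 1, forall i, K (e i) & forall x, K x -> kspan e x].
have [m [e [e0 Ke eK]] min_m] : exists2 m, good m & forall n, good n -> (m <= n)%N.
  have /ex_minnP[m /asboolP gm min_m] : exists m, `[< good m >].
    have [n [e [Ke eK]]] := fa_fin fK; exists n; apply/asboolP.
    exists (fun i => oapp e 1 (unlift ord0 i)); split.
    - by rewrite unlift_none.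
    - move=> i; case: unliftP => [j _|_] /=; first exact: Ke.
      by apply: (fa_kf fK); exact: kfield1.
    - move=> x /eK[c kc ->]; apply: kspan_sum => j _; apply: kspanZ => //.
      have := kspan_gen (fun i => oapp e 1 (unlift ord0 i)) (lift ord0 j).
      by rewrite liftK.
  by exists m => // n gn; apply: min_m; apply/asboolP.
exists m, e; split=> // c kc ce0.
have cj0 j : j != ord0 -> c j = 0.
  move=> j0; apply/eqP/contraT => cj.
  case: m e c e0 Ke eK min_m kc ce0 j j0 cj => [|m] e c e0 Ke eK min_m kc ce0 j j0 cj.
    by rewrite ord1 eqxx in j0.
  suff /min_m : good m by rewrite ltnn.
  exists (fun i => e (lift j i)); split=> [|i|x /eK[b kb ->]]; last 2 first.
  - exact: Ke.
  - have -> : \sum_i b i * e i = \sum_i (b i - b j / c j * c i) * e i.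
      rewrite [RHS](eq_bigr (fun i => b i * e i - b j / c j * (c i * e i))) => [|i _]; last by rewrite mulrBl -!mulrA.
      by rewrite sumrB -mulr_sumr ce0 mulr0 subr0.
    rewrite (bigD1_ord j) //= divfK // subrr mul0r add0r.
    apply: kspan_sum => i _; apply: kspanZ.
      by apply: kfieldB => //; apply: kfieldM => //; apply: kfield_div.
    exact: (kspan_gen (fun i => e (lift j i)) i).
  rewrite -e0; congr e; apply/val_inj; rewrite /= /bump leqn0.
  by have /negPf -> : val j != 0%N by [].
move=> i; have [->|] := eqVneq i ord0; last exact: cj0.
move: ce0; rewrite (bigD1 ord0) //= e0 mulr1 big1 ?addr0 // => j /cj0 ->.
by rewrite mul0r.
Qed.

Lemma common_denominator (I : finType) (x : I -> C) : (forall i, kf (x i)) ->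
  exists2 b : {poly F}, b != 0 & exists p : I -> {poly F}, forall i, ev C b * x i = ev C (p i).
Proof.
move=> kx; have H i : exists PS : {poly F} * {poly F},
    PS.2 != 0 /\ x i = ev C PS.1 / ev C PS.2.
  by have /kfieldP[P [S S0 ->]] := kx i; exists (P, S).
pose PS i := sval (cid (H i)); have PSE i := svalP (cid (H i)).
exists (\prod_i (PS i).2).
  by rewrite prodf_seq_neq0; apply/allP => i _ /=; case: (PSE i).
exists (fun i => (PS i).1 * \prod_(j | j != i) (PS j).2) => i.
have [S0 ->] := PSE i; rewrite (bigD1 i) //= !rmorphM.
by have := S0; rewrite -(ev_eq0 C) -/(PS i) => S0'; field.
Qed.

End FiniteExtensions.

(** * Height filtrations and Siegel's lemma *)

Section Filtration.
Context {F : finFieldType} {R : realType} (C : Cinfty F R).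
Local Notation Q := (#|F|%:R : R).
Local Notation abs := (absv C).
Local Notation theta := (theta C).

(* A multiplicative filtration, by finite F-spaces of linearly growing
   dimension, of an order in a finite extension of F(theta): af_L X consists of
   the elements of "degree" at most X. *)
Record arith_filtration := ArithFiltration {
  af_L : nat -> C -> Prop;
  af_dim : nat;
  af_shift : nat;
  af_liou : nat;
  af_dim_gt0 : (0 < af_dim)%N;
  af_enum : forall X, exists s : seq C, [/\ uniq s,
    size s = (#|F| ^ (af_dim * (X - af_shift)))%N & forall x, x \in s <-> af_L X x];
  af_sub : forall X x y, af_L X x -> af_L X y -> af_L X (x - y);
  af_mono : forall X Y x, (X <= Y)%N -> af_L X x -> af_L Y x;
  af_mul : forall X Y x y, af_L X x -> af_L Y y -> af_L (X + Y) (x * y);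
  af_theta : forall X x, af_L X x -> af_L X.+1 (theta * x);
  af_abs : forall X x, af_L X x -> abs x <= Q ^+ X;
  af_liouville : forall X x, af_L X x -> x != 0 -> 1 <= abs x * Q ^+ (af_liou * X);
  af_alg : forall X x, af_L X x -> alg x }.

(** * The order spanned by a multiple of a basis, filtered by degree *)

Section OrderFiltration.
Variables (m : nat) (w : 'I_m.+1 -> C) (b : {poly F}) (c : nat).
Variable s : 'I_m.+1 -> 'I_m.+1 -> 'I_m.+1 -> {poly F}.
Hypotheses (b0 : b != 0) (w0 : w ord0 = ev C b).
Hypothesis wM : forall i j, w i * w j = \sum_k ev C (s i j k) * w k.
Hypothesis w_free : forall p : 'I_m.+1 -> {poly F},
  \sum_i ev C (p i) * w i = 0 -> forall i, p i = 0.
Hypothesis w_alg : forall i, alg (w i).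
Hypothesis s_size : forall i j k, (size (s i j k) <= c)%N.
Hypothesis w_abs : forall i, abs (w i) <= Q ^+ c.

Definition lev (n : nat) (A : 'M[F]_(m.+1, n)) : C := \sum_i ev C (rVpoly (row i A)) * w i.
(** The shift c bounds the structure constants and the size of the w_i. Paying it in advance makes
    degrees add under multiplication and bounds absolute values by Q^X; for X <= c only 0 is
    left. *)
Definition ordL (X : nat) (x : C) : Prop := exists A : 'M[F]_(m.+1, X - c), x = lev A.

Lemma levB n (A B : 'M[F]_(m.+1, n)) : lev (A - B) = lev A - lev B.
Proof.
rewrite /lev -sumrB; apply: eq_bigr => i _.
by rewrite !linearB /= rmorphB mulrBl.
Qed.

Lemma lev_eq0 n (A : 'M[F]_(m.+1, n)) : lev A = 0 -> A = 0.
Proof.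
move=> /w_free H; apply/row_matrixP => i.
by rewrite -(rVpolyK (row i A)) H !linear0.
Qed.

Lemma lev_inj n : injective (@lev n).
Proof.
move=> A B AB; apply/eqP; rewrite -subr_eq0; apply/eqP/lev_eq0.
by rewrite levB AB subrr.
Qed.

Lemma ordLP X x : ordL X x <->
  exists2 p : 'I_m.+1 -> {poly F}, (forall i, (size (p i) <= X - c)%N) & x = \sum_i ev C (p i) * w i.
Proof.
split=> [[A ->]|[p sp ->]].
  by exists (fun i => rVpoly (row i A)) => // i; apply: size_poly.
exists (\matrix_(i, j) (p i)`_j); apply: eq_bigr => i _.
rewrite (_ : row i _ = poly_rV (p i)) ?poly_rV_K //.
by apply/rowP => j; rewrite !mxE.
Qed.

Lemma ordL_sub X x y : ordL X x -> ordL X y -> ordL X (x - y).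
Proof. by move=> [A ->] [B ->]; exists (A - B); rewrite levB. Qed.

Lemma ordL_mono X Y x : (X <= Y)%N -> ordL X x -> ordL Y x.
Proof.
move=> XY /ordLP[p sp ->]; apply/ordLP; exists p => // i.
by apply: leq_trans (sp i) _; apply: leq_sub2r.
Qed.

Lemma ordL_theta X x : ordL X x -> ordL X.+1 (theta * x).
Proof.
move=> /ordLP[p sp ->]; apply/ordLP; exists (fun i => 'X * p i) => [i|].
  have [->|pi0] := eqVneq (p i) 0; first by rewrite mulr0 size_poly0.
  have := sp i; rewrite mulrC size_mulX //.
  by have := pi0; rewrite -size_poly_gt0; lia.
by rewrite mulr_sumr; apply: eq_bigr => i _; rewrite rmorphM /= evX mulrA.
Qed.

Lemma ordL_mul X Y x y : ordL X x -> ordL Y y -> ordL (X + Y) (x * y).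
Proof.
move=> /ordLP[p sp ->] /ordLP[r sr ->]; apply/ordLP.
exists (fun k => \sum_i \sum_j p i * r j * s i j k) => [k|].
  apply: (leq_trans (size_sum _ _ _)); apply/bigmax_leqP => i _.
  apply: (leq_trans (size_sum _ _ _)); apply/bigmax_leqP => j _.
  have [->|pi0] := eqVneq (p i) 0; first by rewrite !mul0r size_poly0.
  have [->|rj0] := eqVneq (r j) 0; first by rewrite mulr0 mul0r size_poly0.
  apply: (leq_trans (size_polyMleq _ _)).
  have := size_polyMleq (p i) (r j); have := sp i; have := sr j; have := s_size i j k.
  by move: pi0 rj0; rewrite -!size_poly_gt0; lia.
rewrite mulr_suml; under eq_bigr => i _ do rewrite mulr_sumr.
under eq_bigr => i _ do under eq_bigr => j _ do rewrite mulrACA wM mulr_sumr.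
under [RHS]eq_bigr => k _ do rewrite rmorph_sum mulr_suml.
rewrite [RHS]exchange_big; apply: eq_bigr => i _ /=.
under [RHS]eq_bigr => k _ do rewrite rmorph_sum mulr_suml.
rewrite [RHS]exchange_big; apply: eq_bigr => j _ /=.
by apply: eq_bigr => k _; rewrite !rmorphM mulrA.
Qed.

Lemma ordL_abs X x : ordL X x -> abs x <= Q ^+ X.
Proof.
move=> /ordLP[p sp ->]; apply: absv_sum => [|i _]; first by rewrite ltW ?QX_gt0.
have [->|pi0] := eqVneq (p i) 0; first by rewrite rmorph0 mul0r absv0 ltW ?QX_gt0.
have cX : (c < X)%N by have := sp i; move: pi0; rewrite -size_poly_gt0; lia.
rewrite absvM -(subnK (ltnW cX)) exprD; apply: ler_pM; rewrite ?absv_ge0 //.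
by apply: absv_ev_le; apply: leq_trans (sp i) _.
Qed.

Lemma ordL_enum X : exists t : seq C, [/\ uniq t,
  size t = (#|F| ^ (m.+1 * (X - c)))%N & forall x, x \in t <-> ordL X x].
Proof.
exists [seq lev A | A : 'M[F]_(m.+1, X - c)]; split.
- by rewrite map_inj_uniq ?enum_uniq //; apply: lev_inj.
- by rewrite size_map -cardE card_mx.
- by move=> x; split=> [/mapP[A _ ->]|[A ->]]; [exists A|apply: map_f; rewrite mem_enum].
Qed.

Lemma ordL_alg X x : ordL X x -> alg x.
Proof.
by move=> [A ->]; apply: alg_sum => i _; apply: algM => //; exact/alg_kfield/kfield_ev.
Qed.

(* Pigeonhole on x * y - p * w_0 with y of degree <= Y yields a nonzero multiple
   x * y of w_0 = b in F[theta], which has absolute value at least 1. *)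
Lemma ordL_liouville X x : ordL X x -> x != 0 -> 1 <= abs x * Q ^+ ((c + m + 1) * X).
Proof.
move=> Lx x0; have [Xc|cX] := leqP X c.
  move: Lx x0 => /ordLP[p sp ->]; rewrite big1 ?eqxx // => i _.
  have := sp i; rewrite (eqP (_ : X - c == 0)%N) ?subn_eq0 // leqn0 size_poly_eq0.
  by move=> /eqP ->; rewrite rmorph0 mul0r.
(* With Y - c = m X + 1 the exponent (m + 1)(Y - c) + (X + Y - c) of the number of pairs exceeds the
   exponent (m + 1)(X + Y - c) of the number of values by exactly 1. *)
pose Y := (c + (m * X).+1)%N.
pose T : finType := ('M[F]_(m.+1, Y - c) * 'rV[F]_(X + Y - c))%type.
have img (g : T) : exists B : 'M[F]_(m.+1, X + Y - c),
    x * lev g.1 - ev C (rVpoly g.2) * w ord0 = lev B.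
  apply: ordL_sub; first by apply: ordL_mul => //; exists g.1.
  apply/ordLP; exists (fun i => if i == ord0 then rVpoly g.2 else 0) => [i|].
    by case: ifP => _; rewrite ?size_poly0 ?size_poly.
  rewrite (bigD1 ord0) //= big1 ?addr0 // => i /negPf ->.
  by rewrite rmorph0 mul0r.
pose f g := sval (cid (img g)).
have fE g : x * lev g.1 - ev C (rVpoly g.2) * w ord0 = lev (f g) := svalP (cid (img g)).
have /injectivePn[g [h gh fgh]] : ~~ injectiveb f.
  apply/negP => /injectiveP /leq_card; rewrite card_prod !card_mx -expnD leqNgt.
  by rewrite ltn_exp2l ?q_gt1 // /Y; nia.
have E : x * lev (g.1 - h.1) = ev C (rVpoly (g.2 - h.2)) * ev C b.
  have e1 := fE g; rewrite fgh -(fE h) in e1.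
  rewrite -w0 levB linearB rmorphB; apply/eqP; rewrite -subr_eq0.
  rewrite (_ : _ - _ = x * lev g.1 - ev C (rVpoly g.2) * w ord0 -
    (x * lev h.1 - ev C (rVpoly h.2) * w ord0)); last by ring.
  by rewrite e1 subrr.
have A0 : g.1 - h.1 != 0.
  apply/eqP => A0; move/eqP: E; rewrite A0 (_ : lev 0 = 0) ?mulr0; last first.
    by rewrite -(subrr 0) levB subrr.
  rewrite eq_sym mulf_eq0 !ev_eq0 (negPf b0) orbF => /eqP v0.
  case/eqP: gh; case: g h A0 v0 {fgh} => [g1 g2] [h1 h2] /= /eqP.
  rewrite subr_eq0 => /eqP -> v0; congr (_, _).
  by apply/eqP; rewrite -subr_eq0 -(rVpolyK (g2 - h2)) v0 linear0.
have lA0 : lev (g.1 - h.1) != 0 by apply: contraNneq A0 => /lev_eq0 ->.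
have : 1 <= abs x * abs (lev (g.1 - h.1)).
  rewrite -absvM E absvM -[1]mulr1; apply: ler_pM; rewrite ?absv_ev_ge1 //.
  by rewrite -(ev_eq0 C); move: (mulf_neq0 x0 lA0); rewrite E mulf_eq0 negb_or => /andP[].
move/le_trans; apply; apply: ler_wpM2l; first exact: absv_ge0.
apply: (@le_trans _ _ (Q ^+ Y)); last by rewrite ler_QX /Y; nia.
by apply: ordL_abs; exists (g.1 - h.1).
Qed.

Lemma order_filtration : exists A : arith_filtration, af_L A = ordL.
Proof.
by exists (ArithFiltration (ltn0Sn m) ordL_enum ordL_sub ordL_mono ordL_mul ordL_theta
  ordL_abs ordL_liouville ordL_alg).
Qed.

End OrderFiltration.

(** If b clears the denominators of the structure constants of a basis e and of the coordinates of
    the elements of s, then w = b e has structure constants in F[theta], and b^2 a has coordinates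
    in F[theta] with respect to w. Hence the witness d = b^2. *)
Lemma arith_filtration_exists (s : seq C) : (forall a, a \in s -> alg a) ->
  exists (A : arith_filtration) (d : C) (S : nat),
    [/\ d != 0, alg d & forall a, a \in s -> af_L A S (d * a)].
Proof.
move=> s_alg; have [K fK sK] := finalg_contains s_alg.
have [m [e [e0 Ke eK e_free]]] := finalg_basis fK.
have structure i j : exists c : 'I_m.+1 -> C, (forall k, kfield C (c k)) /\
    e i * e j = \sum_k c k * e k.
  by have [c kc ->] := eK _ (fa_mul fK (Ke i) (Ke j)); exists c.
have coords (a : seq_sub s) : exists c : 'I_m.+1 -> C, (forall k, kfield C (c k)) /\
    val a = \sum_k c k * e k.
  by have [c kc ->] := eK _ (sK _ (valP a)); exists c.
pose cs i j := sval (cid (structure i j)).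
have csP i j := svalP (cid (structure i j)).
pose cc a := sval (cid (coords a)).
have ccP a := svalP (cid (coords a)).
pose x (z : 'I_m.+1 * 'I_m.+1 * 'I_m.+1 + seq_sub s * 'I_m.+1) : C :=
  match z with inl (i, j, k) => cs i j k | inr (a, k) => cc a k end.
have kx z : kfield C (x z).
  case: z => [[[i j] k]|[a k]] /=; first by have [kc _] := csP i j; apply: kc.
  by have [kc _] := ccP a; apply: kc.
have [b b0 [p px]] := common_denominator kx.
pose w i := ev C b * e i; pose sc i j k := p (inl (i, j, k)).
have evb0 : ev C b != 0 by rewrite ev_eq0.
have w_free (r : 'I_m.+1 -> {poly F}) : \sum_i ev C (r i) * w i = 0 -> forall i, r i = 0.
  move=> r0 i; have : ev C (r i) = 0.
    apply: (e_free (fun i => ev C (r i))) => [j|]; first exact: kfield_ev.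
    apply: (mulfI evb0); rewrite mulr0 -[RHS]r0 mulr_sumr.
    by apply: eq_bigr => j _; rewrite mulrCA.
  by move/eqP; rewrite ev_eq0 => /eqP.
have wM i j : w i * w j = \sum_k ev C (sc i j k) * w k.
  rewrite /w mulrACA; have [_ ->] := csP i j; rewrite /= mulr_sumr.
  apply: eq_bigr => k _; rewrite /w /sc -(px (inl (i, j, k))) /= /cs. ring.
have w0 : w ord0 = ev C b by rewrite /w e0 mulr1.
have algb : alg (ev C b) by exact/alg_kfield/kfield_ev.
have w_alg i : alg (w i) by apply: algM => //; apply: (fa_alg fK).
have [c1 c1P] : exists n, forall z : 'I_m.+1 * 'I_m.+1 * 'I_m.+1 + seq_sub s * 'I_m.+1,
    (size (p z) <= n)%N by exists (\max_z size (p z))%N => z; apply: leq_bigmax.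
have [c2 c2P] : exists n, forall i, abs (w i) <= Q ^+ n.
  have H i : exists n, abs (w i) <= Q ^+ n by apply: QX_unbounded.
  exists (\max_i sval (cid (H i)))%N => i; apply: le_trans (svalP (cid (H i))) _.
  by rewrite ler_QX; apply: (leq_bigmax i).
have sc_size i j k : (size (sc i j k) <= c1 + c2)%N by apply: leq_trans (c1P _) (leq_addr _ _).
have w_abs i : abs (w i) <= Q ^+ (c1 + c2).
  by apply: le_trans (c2P i) _; rewrite ler_QX leq_addl.
have [A AL] := order_filtration b0 w0 wM w_free w_alg sc_size w_abs.
exists A, (ev C b * ev C b), (c1 + c2 + c1)%N; split; first by rewrite mulf_neq0.
  exact: algM.
move=> a aS; rewrite AL; apply/ordLP; exists (fun k => p (inr (SeqSub aS, k))) => [k|].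
  by rewrite addKn; apply: c1P.
have [_ aE] := ccP (SeqSub aS); rewrite [X in _ * X](aE : a = _) mulr_sumr.
by apply: eq_bigr => k _; rewrite -(px (inr (SeqSub aS, k))) /=; rewrite /w /cc; ring.
Qed.

Section Siegel.
Variable A : arith_filtration.
Local Notation L := (af_L A).

Lemma af_0 X : L X 0.
Proof.
have [s [_ ss sL]] := af_enum A X.
have [x xs] : exists x, x \in s.
  by case: s ss {sL} => [/esym/eqP|x s _]; [rewrite expn_eq0 eqn0Ngt q_gt0|exists x; exact: mem_head].
by rewrite -(subrr x); apply: af_sub; apply/sL.
Qed.

Lemma af_N X x : L X x -> L X (- x).
Proof. by rewrite -sub0r; apply: af_sub; exact: af_0. Qed.

Lemma af_add X x y : L X x -> L X y -> L X (x + y).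
Proof. by move=> Lx /af_N Ly; rewrite -(opprK y); apply: af_sub. Qed.

Lemma af_sum X I (r : seq I) (P : pred I) (f : I -> C) :
  (forall i, P i -> L X (f i)) -> L X (\sum_(i <- r | P i) f i).
Proof. by move=> H; elim/big_rec: _ => [|i x /H ? ?]; [exact: af_0|exact: af_add]. Qed.

(** The cost of multiplying by a. It is used instead of membership in [L S] because 1 and theta need
    not lie in the order, yet they cost only 0 and 1. *)
Definition multiplier S a := forall X x, L X x -> L (X + S) (a * x).

(** Pigeonhole: the system maps I-tuples of L_X to J-tuples of L_(X + S), and the inequality says
    that the source is larger, the dimension of the order cancelling. Two tuples with the same image
    differ by a solution. *)
Lemma siegel (I J : finType) (a : J -> I -> C) X S :
  (forall j i, multiplier S (a j i)) ->
  (#|J| * (X + S - af_shift A) < #|I| * (X - af_shift A))%N ->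
  exists x : I -> C, [/\ forall i, L X (x i), exists i, x i != 0
    & forall j, \sum_i a j i * x i = 0].
Proof.
move=> aS IJ; have [s [us ss sL]] := af_enum A X; have [t [ut st tL]] := af_enum A (X + S).
have img (g : {ffun I -> seq_sub s}) j : \sum_i a j i * val (g i) \in t.
  by apply/tL/af_sum => i _; apply/aS/sL/valP.
pose f g : {ffun J -> seq_sub t} := [ffun j => SeqSub (img g j)].
have /injectivePn[g [h gh fgh]] : ~~ injectiveb f.
  apply/negP => /injectiveP /leq_card; rewrite !card_ffun !card_seq_sub // ss st.
  rewrite -!expnM leqNgt ltn_exp2l ?q_gt1 // -!mulnA ltn_pmul2l ?af_dim_gt0 //.
  by rewrite mulnC (mulnC _ #|I|) IJ.
exists (fun i => val (g i) - val (h i)); split.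
- by move=> i; apply: af_sub; apply/sL/valP.
- apply/existsP; apply: contraNT gh; rewrite negb_exists => /forallP gh.
  by apply/eqP/ffunP => i; apply/val_inj/eqP; rewrite -subr_eq0; have := gh i; rewrite negbK.
- move=> j; under eq_bigr => i _ do rewrite mulrBr.
  rewrite sumrB; apply/eqP; rewrite subr_eq0; apply/eqP.
  by have /ffunP /(_ j) := fgh; rewrite !ffunE => /(congr1 val).
Qed.

Lemma multiplier_L S a : L S a -> multiplier S a.
Proof. by move=> La X x Lx; rewrite addnC; apply: af_mul. Qed.

Lemma multiplier_mono S T a : (S <= T)%N -> multiplier S a -> multiplier T a.
Proof. by move=> ST aS X x /aS; apply: af_mono; rewrite leq_add2l. Qed.

Lemma multiplier0 S : multiplier S 0.
Proof. by move=> X x _; rewrite mul0r; apply: af_0. Qed.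

Lemma multiplier1 S : multiplier S 1.
Proof. by move=> X x; rewrite mul1r; apply: af_mono; rewrite leq_addr. Qed.

Lemma multiplierN S a : multiplier S a -> multiplier S (- a).
Proof. by move=> aS X x /aS; rewrite mulNr; apply: af_N. Qed.

Lemma multiplierM S T a d : multiplier S a -> multiplier T d -> multiplier (S + T) (a * d).
Proof. by move=> aS dT X x /dT /aS; rewrite mulrA -addnA [(T + S)%N]addnC. Qed.

Lemma multiplier_sum S I (r : seq I) (P : pred I) (f : I -> C) :
  (forall i, P i -> multiplier S (f i)) -> multiplier S (\sum_(i <- r | P i) f i).
Proof.
move=> H; elim/big_rec: _ => [|i x /H fi xS]; first exact: multiplier0.
by move=> X y Ly; rewrite mulrDl; apply: af_add; [apply: fi|apply: xS].
Qed.

Lemma multiplierX S a n : multiplier S a -> multiplier (S * n) (a ^+ n).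
Proof.
move=> aS; elim: n => [|n IH]; first by rewrite expr0; apply: multiplier1.
by rewrite exprS mulnS; apply: multiplierM.
Qed.

Lemma multiplier_theta n : multiplier n (theta ^+ n).
Proof.
by rewrite -[X in multiplier X]mul1n; apply: multiplierX => X x; rewrite addn1; apply: af_theta.
Qed.

Definition pmultiplier S (p : {poly C}) := forall i, multiplier S p`_i.

Lemma pmultiplierM S T p r : pmultiplier S p -> pmultiplier T r -> pmultiplier (S + T) (p * r).
Proof. by move=> pS rT i; rewrite coefM; apply: multiplier_sum => j _; apply: multiplierM. Qed.

Lemma pmultiplier_sum S I (r : seq I) (P : pred I) (f : I -> {poly C}) :
  (forall i, P i -> pmultiplier S (f i)) -> pmultiplier S (\sum_(i <- r | P i) f i).
Proof. by move=> H i; rewrite coef_sum; apply: multiplier_sum => j /H; apply. Qed.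

Lemma pmultiplier_frob S m p :
  pmultiplier S p -> pmultiplier (S * #|F| ^ m) (map_poly (frob m) p).
Proof. by move=> pS i; rewrite coef_map; apply: multiplierX. Qed.

Lemma multiplier_horner S p d n : pmultiplier S p -> (size p <= d.+1)%N ->
  multiplier (S + n * d) p.[theta ^+ n].
Proof.
move=> pS pd; rewrite horner_coef; apply: multiplier_sum => i _; apply: multiplierM => //.
rewrite -exprM; apply: multiplier_mono (multiplier_theta _).
by rewrite leq_mul2l -ltnS (leq_trans (ltn_ord i)) ?orbT.
Qed.

End Siegel.
End Filtration.

(** * Frobenius difference systems *)

Section AlgebraicPolynomials.
Context {F : finFieldType} {R : realType} (C : Cinfty F R).
Implicit Types p r : {poly C}.

Definition algp p := forall i, alg p`_i.

Lemma algpM p r : algp p -> algp r -> algp (p * r).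
Proof. by move=> ap ar i; rewrite coefM; apply: alg_sum => j _; apply: algM. Qed.

Lemma algpC (a : C) : alg a -> algp a%:P.
Proof. by move=> aa i; rewrite coefC; case: ifP => // _; exact: alg0. Qed.

Lemma algp_nat n : algp n%:R.
Proof. by rewrite -polyC_natr; apply/algpC/alg_kfield/kpredP/rpred_nat. Qed.

Lemma algp_sum I (r : seq I) (P : pred I) (f : I -> {poly C}) :
  (forall i, P i -> algp (f i)) -> algp (\sum_(i <- r | P i) f i).
Proof. by move=> H i; rewrite coef_sum; apply: alg_sum => j /H; apply. Qed.

Lemma algpX p n : algp p -> algp (p ^+ n).
Proof. by move=> ap; elim: n => [|n IH]; rewrite ?expr0 ?exprS; [exact: (algp_nat 1)|exact: algpM]. Qed.

Lemma algp_XsubC (a : C) : alg a -> algp ('X - a%:P).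
Proof.
move=> aa i; rewrite coefB coefX coefC; apply: algD.
  exact/alg_kfield/kpredP/rpred_nat.
by apply: algN; case: ifP => // _; exact: alg0.
Qed.

Lemma algp_frob m p : algp p -> algp (map_poly (frob m) p).
Proof. by move=> ap i; rewrite coef_map; apply: algX. Qed.

Lemma alg_horner p x : algp p -> alg x -> alg p.[x].
Proof. by move=> ap ax; rewrite horner_coef; apply: alg_sum => i _; apply: algM => //; apply: algX. Qed.

Lemma frob_poly_surj m p : exists r, map_poly (frob m) r = p.
Proof.
have H i : exists y, frob m y = p`_i by apply: frob_surj.
exists (\poly_(i < size p) sval (cid (H i))); apply/polyP => i.
rewrite coef_map coef_poly; case: ltnP => [_|pi]; first exact: (svalP (cid (H i))).
by rewrite raddf0 nth_default.
Qed.

Lemma algp_unfrob m p : algp (map_poly (frob m) p) -> algp p.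
Proof. by move=> ap i; apply: (@alg_root _ _ _ _ (#|F| ^ m)); rewrite ?expq_gt0 //; have := ap i; rewrite coef_map. Qed.

Lemma horner_frob m p x : (map_poly (frob m) p).[frob m x] = frob m p.[x].
Proof. by rewrite horner_map. Qed.

End AlgebraicPolynomials.

Section FrobeniusSystems.
Context {F : finFieldType} {R : realType} (C : Cinfty F R).
Local Notation theta := (theta C).
Variable n : nat.
Implicit Types (A : 'M[{poly C}]_n).

Definition mxfrob m (p r : nat) (A : 'M[{poly C}]_(p, r)) := map_mx (map_poly (frob m)) A.
Definition mxps (p r : nat) (A : 'M[{poly C}]_(p, r)) : 'M[psr C]_(p, r) := map_mx (@psP C) A.
Definition psfrob m (p r : nat) (A : 'M[psr C]_(p, r)) := map_mx (psmap (frob m)) A.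
Definition mxev (x : C) (p r : nat) (A : 'M[{poly C}]_(p, r)) : 'M[C]_(p, r) := map_mx (horner_eval x) A.

Lemma mxpsM p r s (A : 'M[{poly C}]_(p, r)) (B : 'M[{poly C}]_(r, s)) : mxps (A *m B) = mxps A *m mxps B.
Proof. exact: map_mxM. Qed.
Lemma mxfrobM m p r s (A : 'M[{poly C}]_(p, r)) (B : 'M[{poly C}]_(r, s)) :
  mxfrob m (A *m B) = mxfrob m A *m mxfrob m B.
Proof. exact: map_mxM. Qed.
Lemma mxevM x p r s (A : 'M[{poly C}]_(p, r)) (B : 'M[{poly C}]_(r, s)) : mxev x (A *m B) = mxev x A *m mxev x B.
Proof. exact: map_mxM. Qed.

Lemma psfrob_mul m p r s (A : 'M[{poly C}]_(p, r)) (f : 'M[psr C]_(r, s)) :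
  psfrob m (mxps A *m f) = mxps (mxfrob m A) *m psfrob m f.
Proof.
rewrite /psfrob map_mxM; congr (_ *m _); apply/matrixP => i j; rewrite !mxE.
exact: psmapP.
Qed.

Lemma psfrobD m k p r (f : 'M[psr C]_(p, r)) : psfrob m (psfrob k f) = psfrob (m + k) f.
Proof. by apply/matrixP => i j; rewrite !mxE; apply: funext => l; apply/esym/frobD. Qed.

Lemma mxfrobD m k p r (A : 'M[{poly C}]_(p, r)) : mxfrob m (mxfrob k A) = mxfrob (m + k) A.
Proof. by apply/matrixP => i j; rewrite !mxE; apply/polyP => l; rewrite !coef_map; apply/esym/frobD. Qed.

(** The equation psi^(-1) = Phi psi after one twist, which frees it from q-th roots. *)
Definition frob_system (Phi : 'M[{poly C}]_n) (psi : 'cV[psr C]_n) :=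
  (forall i, egrow (psi i 0)) /\ psi = mxps (mxfrob 1 Phi) *m psfrob 1 psi.

Variables (Phi Phi' : 'M[{poly C}]_n) (beta : {poly C}) (psi : 'cV[psr C]_n).
Hypothesis sys : frob_system Phi psi.
Hypothesis inv1 : Phi *m Phi' = beta%:M.
Hypothesis inv2 : Phi' *m Phi = beta%:M.

(** The product Phi^(m+1) ... Phi^(m+k) carries psi^(m+k) to psi^(m). [Iprod] inverts it up to the
    scalar [Bprod]. *)
Fixpoint Fprod m k : 'M[{poly C}]_n :=
  if k is k'.+1 then Fprod m k' *m mxfrob (m + k) Phi else 1%:M.
Fixpoint Iprod m k : 'M[{poly C}]_n :=
  if k is k'.+1 then mxfrob (m + k) Phi' *m Iprod m k' else 1%:M.
Definition Bprod m k : {poly C} := \prod_(i < k) map_poly (frob (m + i.+1)) beta.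

Lemma psfrob_step m : psfrob m psi = mxps (mxfrob m.+1 Phi) *m psfrob m.+1 psi.
Proof. by rewrite {1}sys.2 psfrob_mul psfrobD mxfrobD addn1. Qed.

Lemma psfrob_Fprod m k : psfrob m psi = mxps (Fprod m k) *m psfrob (m + k) psi.
Proof.
elim: k => [|k IH]; first by rewrite /= /mxps map_mx1 mul1mx addn0.
by rewrite IH psfrob_step /= mxpsM -mulmxA !addnS.
Qed.

Lemma mxfrob_scalar m p : mxfrob m (p%:M : 'M[{poly C}]_n) = (map_poly (frob m) p)%:M.
Proof. exact: map_scalar_mx. Qed.

Lemma FprodK m k : Fprod m k *m Iprod m k = (Bprod m k)%:M.
Proof.
elim: k => [|k IH]; first by rewrite /Bprod big_ord0 mulmx1.
rewrite /= mulmxA -(mulmxA (Fprod m k)) -mxfrobM inv1 mxfrob_scalar.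
by rewrite scalar_mxC -mulmxA IH -scalar_mxM /Bprod big_ord_recr mulrC.
Qed.

Lemma IprodK m k : Iprod m k *m Fprod m k = (Bprod m k)%:M.
Proof.
elim: k => [|k IH]; first by rewrite /Bprod big_ord0 mulmx1.
rewrite /= mulmxA -(mulmxA _ (Iprod m k)) IH scalar_mxC -mulmxA -mxfrobM inv2.
by rewrite mxfrob_scalar -scalar_mxM /Bprod big_ord_recr.
Qed.

Lemma frob_theta_inj : injective (fun m => frob m theta).
Proof.
move=> i j /(congr1 (absv C)); rewrite !absv_frob absv_theta => /eqP.
rewrite eq_le !ler_QX -eqn_leq => /eqP /(expnI q_gt1).
by [].
Qed.

End FrobeniusSystems.

(** * Auxiliary forms *)

Section AuxiliaryForms.
Context {F : finFieldType} {R : realType} (C : Cinfty F R).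
Local Notation Q := (#|F|%:R : R).
Local Notation q := #|F|.
Local Notation abs := (absv C).
Local Notation theta := (theta C).
Variables (A : arith_filtration C) (n : nat).
Local Notation L := (af_L A).
Local Notation shift := (af_shift A).

Lemma pmultiplier_mono S T (p : {poly C}) : (S <= T)%N -> pmultiplier A S p -> pmultiplier A T p.
Proof. by move=> ST pS i; apply: multiplier_mono (pS i). Qed.

Lemma multiplier_nat S (b : bool) : multiplier A S (b%:R : C).
Proof. by case: b; [exact: multiplier1|exact: multiplier0]. Qed.

Lemma af_coef_sum X B (x : 'I_B -> C) k : (forall i, L X (x i)) ->
  L X (\sum_i x i *: 'X^i : {poly C})`_k.
Proof.
move=> Lx; rewrite coef_sum; apply: af_sum => i _; rewrite coefZ coefXn.
by case: eqP => _; rewrite ?mulr1 ?mulr0 //; apply: af_0.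
Qed.

Lemma size_coef_sum B (x : 'I_B -> C) : (size (\sum_i x i *: 'X^i : {poly C})%R <= B)%N.
Proof.
apply: leq_trans (size_sum _ _ _) _; apply/bigmax_leqP => i _.
by apply: leq_trans (size_scale_leq _ _) _; rewrite size_polyXn.
Qed.

Lemma coef_sum_ord B (x : 'I_B -> C) (k : 'I_B) : (\sum_i x i *: 'X^i : {poly C})`_k = x k.
Proof.
rewrite coef_sum (bigD1 k) //= coefZ coefXn eqxx mulr1 big1 ?addr0 // => i ik.
by rewrite coefZ coefXn; case: eqP => [/val_inj ki|_]; rewrite ?mulr0 // -ki eqxx in ik *.
Qed.

(** The factors l m are unknowns along with the coefficients of G, which makes the M n conditions
    linear and homogeneous in n D + M unknowns. G = 0 would force l = 0 because the u m are nonzero;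
    l = 0 would give G at least D zeros, hence G = 0. *)
Lemma interpolation_form M D X S (u : 'I_M -> 'rV[C]_n) (e : 'I_M -> nat) :
  (forall m i, multiplier A S (u m 0 i)) ->
  (forall m d, (d < D)%N -> (e m * d <= S)%N) ->
  (M * n * (X + S - shift) < (n * D + M) * (X - shift))%N ->
  (forall m, u m != 0) -> injective e -> (D <= M)%N ->
  exists (G : 'rV[{poly C}]_n) (l : 'I_M -> C),
    [/\ forall i, (size (G 0%R i) <= D)%N, forall i k, L X (G 0 i)`_k,
      forall m, mxev (theta ^+ e m) G = l m *: u m, G != 0 & exists m, l m != 0].
Proof.
move=> uS eS count u0 e_inj DM.
pose a (mi : 'I_M * 'I_n) (z : 'I_n * 'I_D + 'I_M) : C :=
  match z with
  | inl (i, d) => (i == mi.2)%:R * theta ^+ (e mi.1 * d)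
  | inr m => - ((m == mi.1)%:R * u mi.1 0 mi.2)
  end.
have [||x [Lx [z xz0] ax]] := @siegel _ _ C A _ _ a X S.
- case=> m i [[i' d]|m'] /=.
    rewrite -[S]add0n; apply: multiplierM; first exact: multiplier_nat.
    by apply: multiplier_mono (multiplier_theta _); apply: eS.
  by apply: multiplierN; rewrite -[S]add0n; apply: multiplierM => //; apply: multiplier_nat.
- by rewrite card_prod card_sum card_prod !card_ord.
pose G : 'rV[{poly C}]_n := \row_i \sum_d x (inl (i, d)) *: 'X^d.
pose l m := x (inr m).
have GE m : mxev (theta ^+ e m) G = l m *: u m.
  apply/rowP => i; rewrite !mxE horner_evalE horner_sum.
  have := ax (m, i); rewrite big_sumType /= => /eqP.
  rewrite addr_eq0 => /eqP H; rewrite [RHS](_ : _ = - \sum_i0 a (m, i) (inr i0) * x (inr i0)).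
    rewrite -H; under eq_bigr => d _ do rewrite hornerZ hornerXn -exprM.
    rewrite (eq_bigr (fun ij : 'I_n * 'I_D => a (m, i) (inl (ij.1, ij.2)) * x (inl (ij.1, ij.2)))).
      rewrite -(pair_bigA _ (fun i' d => a (m, i) (inl (i', d)) * x (inl (i', d)))) /=.
      rewrite (bigD1 i) //= [X in _ = _ + X]big1 ?addr0.
        by apply: eq_bigr => d _; rewrite eqxx mul1r mulrC.
      by move=> i' /negPf ii'; rewrite big1 // => d _; rewrite ii' !mul0r.
    by case.
  rewrite (bigD1 m) //= eqxx mul1r big1 ?addr0.
    by rewrite mulNr opprK mulrC.
  by move=> m' /negPf ->; rewrite mul0r oppr0 mul0r.
have G0 : G != 0.
  apply/eqP => G0; case/eqP: xz0; case: z => [[i d]|m].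
    by rewrite -(coef_sum_ord (fun d => x (inl (i, d))) d); move/rowP/(_ i): G0; rewrite !mxE => ->; rewrite coef0.
  have := GE m; rewrite G0 /mxev map_mx0 => /esym/eqP.
  by rewrite scaler_eq0 (negPf (u0 m)) orbF => /eqP.
exists G, l; split=> //.
- by move=> i; rewrite mxE; apply: size_coef_sum.
- by move=> i k; rewrite mxE; apply: af_coef_sum.
- apply/existsP; apply: contraNT G0; rewrite negb_exists => /forallP l0.
  apply/eqP/rowP => i; rewrite [RHS]mxE.
  apply: (@roots_geq_poly_eq0 _ _ [seq theta ^+ e m | m <- enum 'I_M]).
  + apply/allP => _ /mapP[m _ ->]; rewrite /root.
    have /rowP /(_ i) := GE m; rewrite !mxE horner_evalE => ->.
    by have := l0 m; rewrite negbK => /eqP ->; rewrite mul0r.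
  + rewrite map_inj_uniq ?enum_uniq // => m m' /(congr1 abs).
    rewrite !absvX absv_theta => /eqP; rewrite eq_le !ler_QX -eqn_leq => /eqP.
    exact: e_inj.
  + rewrite size_map size_enum_ord mxE; apply: leq_trans DM; exact: size_coef_sum.
Qed.

(** Meant for more rows than columns: the N B coefficients of the a j face n (B + K) equations, so
    they win once B is large compared with K. *)
Lemma polynomial_relation N B K Y S (H : 'I_N -> 'rV[{poly C}]_n) :
  (forall j i, pmultiplier A S (H j 0 i)) ->
  (forall j i, (size (H j 0%R i) <= K)%N) ->
  (n * (B + K) * (Y + S - shift) < N * B * (Y - shift))%N ->
  exists a : 'I_N -> {poly C}, [/\ forall j k, L Y (a j)`_k, exists j, a j != 0
    & \sum_j a j *: H j = 0].
Proof.
move=> HS Hsize count.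
pose c (it : 'I_n * 'I_(B + K)) (jb : 'I_N * 'I_B) : C := ('X^(jb.2) * H jb.1 0 it.1)`_(it.2).
have [||x [Lx [[j b] xz0] cx]] := @siegel _ _ C A _ _ c Y S.
- case=> i t [j b]; rewrite /c /= coefXnM; case: ifP => _; first exact: multiplier0.
  exact: HS.
- by rewrite !card_prod !card_ord.
exists (fun j => \sum_b x (j, b) *: 'X^b); split.
- by move=> j' k; apply: af_coef_sum.
- exists j; apply: contraNneq xz0 => a0.
  by rewrite -(coef_sum_ord (fun d => x (j, d)) b) a0 coef0.
- apply/rowP => i; rewrite summxE [RHS]mxE.
  under eq_bigr => j' _ do rewrite mxE.
  apply/polyP => t; rewrite coef0; have [tB|Bt] := ltnP t (B + K).
    have := cx (i, Ordinal tB); rewrite /c /= => cx0; rewrite -[RHS]cx0.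
    rewrite coef_sum.
    rewrite (eq_bigr (fun jb : 'I_N * 'I_B => ('X^(jb.2) * H jb.1 0 i)`_t * x (jb.1, jb.2))); last by case.
    rewrite -(pair_bigA _ (fun (j : 'I_N) (b : 'I_B) => ('X^b * H j 0 i)`_t * x (j, b))) /=.
    apply: eq_bigr => j' _; rewrite mulr_suml coef_sum; apply: eq_bigr => b' _.
    by rewrite -scalerAl coefZ mulrC.
  apply: nth_default; apply: leq_trans Bt; apply: leq_trans (size_sum _ _ _) _.
  apply/bigmax_leqP => j' _; apply: leq_trans (size_polyMleq _ _) _.
  by apply: leq_trans (leq_pred _) _; apply: leq_add => //; apply: size_coef_sum.
Qed.

(** Compare coefficients of t^(u+v), where u is the least order at t = 0 of the a j. Every twist of
    f starts at t^v, so only the products of the coefficients of t^u and t^v survive. *)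
Lemma leading_coef_relation N Y (a : 'I_N -> {poly C}) (f : psr C) v :
  (forall j k, L Y (a j)`_k) -> (exists j, a j != 0) ->
  (forall k, (k < v)%N -> f k = 0) ->
  \sum_j psP (a j) * psmap (frob j) f = 0 ->
  exists al : 'I_N -> C, [/\ forall j, L Y (al j), exists j, al j != 0
    & \sum_j al j * f v ^+ (q ^ j) = 0].
Proof.
move=> La [j aj0] fv af0.
have [u /existsP[j0 auj0] u_min] : exists2 u, [exists j, (a j)`_u != 0]
    & forall t, [exists j, (a j)`_t != 0] -> (u <= t)%N.
  have /ex_minnP[u] : exists u, [exists j, (a j)`_u != 0].
    exists (size (a j)).-1; apply/existsP; exists j.
    by rewrite -lead_coefE lead_coef_eq0.
  by exists u.
exists (fun j => (a j)`_u); split=> //; first by exists j0.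
move/(congr1 (fun g : psr C => g (u + v)%N)): af0; rewrite ps_sum psE0 => af0; rewrite -[RHS]af0.
apply: eq_bigr => j' _; rewrite psEM.
have uv : (u < (u + v).+1)%N by rewrite ltnS leq_addr.
rewrite (bigD1 (Ordinal uv)) //= big1 ?addr0 => [|i iu].
  by rewrite addKn.
have [ui|iu'] := ltnP u i.
  by rewrite /psmap fv ?raddf0 ?mulr0 //; have := ltn_ord i; lia.
have {}iu : (i < u)%N by rewrite ltn_neqAle iu' andbT.
rewrite /psP (_ : (a j')`_i = 0) ?mul0r //; apply/eqP; apply: contraTT iu => ai0.
by rewrite -leqNgt; apply: u_min; apply/existsP; exists j'.
Qed.

(** When abs e <= 1, every term after the first nonzero one carries at least one more factor e than
    e^(q^j0). Hence the coefficient al j0 is at most Q^Y abs e, while the Liouville bound keeps it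
    away from 0. *)
Lemma frob_root_lower_bound N Y (al : 'I_N -> C) (e : C) : e != 0 ->
  (forall j, L Y (al j)) -> (exists j, al j != 0) ->
  \sum_j al j * e ^+ (q ^ j) = 0 -> 1 <= abs e * Q ^+ ((af_liou A).+1 * Y).
Proof.
move=> e0 Lal [j1 alj1] rel.
have [e1|/ltW e1] := leP 1 (abs e).
  by rewrite -[X in X <= _]mulr1; apply: ler_pM => //; apply: QX_ge1.
pose P (k : nat) := [exists j : 'I_N, (al j != 0) && ((j : nat) == k)].
have /ex_minnP[k /existsP[j0 /andP[alj0 /eqP <-]] min_k] : exists k, P k.
  by exists (j1 : nat); apply/existsP; exists j1; rewrite alj1 eqxx.
have ae : 0 < abs e by rewrite absv_gt0.
suff H : abs (al j0) <= Q ^+ Y * abs e.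
  rewrite mulSn exprD mulrA; apply: le_trans (af_liouville (Lal j0) alj0) _.
  by apply: ler_wpM2r; [rewrite ltW ?QX_gt0|rewrite mulrC].
move/eqP: rel; rewrite (bigD1 j0) //= addr_eq0 => /eqP rel.
have eq0 : 0 < abs e ^+ (q ^ j0) by rewrite exprn_gt0.
rewrite -(ler_pM2r eq0) -absvX -absvM rel absvN.
apply: absv_sum => [|j jj0]; first by rewrite !mulr_ge0 ?absv_ge0 // ltW ?QX_gt0.
have [->|alj] := eqVneq (al j) 0.
  by rewrite mul0r absv0 !mulr_ge0 ?absv_ge0 // ltW ?QX_gt0.
have j0j : (j0 < j)%N.
  rewrite ltn_neqAle eq_sym (inj_eq val_inj) jj0 /=; apply: min_k.
  by apply/existsP; exists j; rewrite alj eqxx.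
rewrite absvM -mulrA; apply: ler_pM; rewrite ?absv_ge0 ?(af_abs (Lal j)) //.
rewrite !absvX -exprS; apply: ler_wiXn2l; rewrite ?absv_ge0 //.
by rewrite ltn_exp2l ?q_gt1.
Qed.

End AuxiliaryForms.

Section Counting.

(** Unknowns and equations are in the ratio 2n + 1 to 2n, and X is the least height for which (X + S
    - c) / (X - c) is below this ratio. *)
Lemma interpolation_count n T c S (M := (2 * n * T)%N) (X := (c + 2 * n * S + 1)%N) :
  (0 < n)%N -> (0 < T)%N -> (M * n * (X + S - c) < (n * (M - T) + M) * (X - c))%N.
Proof.
move=> n0 T0; have nT : (0 < n * T)%N by rewrite muln_gt0 n0.
have -> : (X + S - c = (2 * n + 1) * S + 1)%N by rewrite /X; lia.
have -> : (X - c = 2 * n * S + 1)%N by rewrite /X; lia.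
have -> : (n * (M - T) + M = (2 * n + 1) * (n * T))%N.
  by rewrite /M; case: n n0 nT X M => // n _ _ _ _; nia.
by rewrite /M; nia.
Qed.

(** Here the ratio is 2n + 2 to 2n + 1, and Y is again the least height that suffices. *)
Lemma relation_count n K c S (B := (2 * n * K)%N) (Y := (c + (2 * n + 1) * S + 1)%N) :
  (0 < n)%N -> (0 < K)%N -> (n * (B + K) * (Y + S - c) < n.+1 * B * (Y - c))%N.
Proof.
move=> n0 K0; have nK : (0 < n * K)%N by rewrite muln_gt0 n0.
have -> : (Y + S - c = (2 * n + 2) * S + 1)%N by rewrite /Y; lia.
have -> : (Y - c = (2 * n + 1) * S + 1)%N by rewrite /Y; lia.
by rewrite /B; nia.
Qed.

End Counting.

(** * Vanishing of the auxiliary form *)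

Section ABP.
Context {F : finFieldType} {R : realType} (C : Cinfty F R).
Local Notation Q := (#|F|%:R : R).
Local Notation q := #|F|.
Local Notation abs := (absv C).
Local Notation theta := (theta C).

Definition mxpsev (x : C) (p r : nat) (f : 'M[psr C]_(p, r)) : 'M[C]_(p, r) :=
  map_mx (fun g : psr C => ps_eval g x) f.

Lemma mxpsev_mul x p r (B : 'M[{poly C}]_(p, r)) (f : 'cV[psr C]_r) :
  (forall i, egrow (f i 0)) -> mxpsev x (mxps B *m f) = mxev x B *m mxpsev x f.
Proof.
move=> ef; apply/matrixP => i j; rewrite ord1 !mxE ps_eval_sum => [|k _].
  by apply: eq_bigr => k _; rewrite !mxE ps_evalM ?ps_evalP //; exact: egrowP.
by rewrite mxE; apply: egrowM => //; exact: egrowP.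
Qed.

Lemma mxpsev_frob m r (f : 'cV[psr C]_r) : (forall i, egrow (f i 0)) ->
  mxpsev (frob m theta) (psfrob m f) = map_mx (frob m) (mxpsev theta f).
Proof. by move=> ef; apply/colP => i; rewrite !mxE ps_eval_frob. Qed.

Section Integral.
Variables (A : arith_filtration C) (n : nat) (Phi Phi' : 'M[{poly C}]_n).
Variables (b : C) (s : nat) (psi : 'cV[psr C]_n) (rho : 'rV[C]_n) (S0 d : nat).
Local Notation beta := (b%:P * ('X - theta%:P) ^+ s).
Hypothesis b0 : b != 0.
Hypothesis sys : frob_system Phi psi.
Hypothesis inv1 : Phi *m Phi' = beta%:M.
Hypothesis Phi_mult : forall i j, pmultiplier A S0 (Phi i j).
Hypothesis Phi_size : forall i j, (size (Phi i j) <= d.+1)%N.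
Hypothesis rho_mult : forall i, multiplier A S0 (rho 0 i).
Hypothesis rho0 : rho != 0.
Hypothesis rho_psi : rho *m mxpsev theta psi = 0.

Local Notation Fp := (Fprod Phi).
Local Notation Ip := (Iprod Phi').

Lemma dim_gt0 : (0 < n)%N.
Proof.
rewrite lt0n; apply: contraNneq rho0 => n0.
by apply/eqP/rowP => i; have := ltn_ord i; rewrite {2}n0.
Qed.

Lemma egrow_psfrob m i : egrow (psfrob m psi i 0).
Proof. by rewrite mxE; apply: egrow_frob; case: sys. Qed.

Lemma Fprod_mult m k i j : pmultiplier A (S0 * q ^ (m + k) * k) (Fp m k i j).
Proof.
elim: k i j => [|k IH] i j.
  rewrite mxE muln0; case: eqP => _ l; last by rewrite mulr0n coef0; apply: multiplier0.
  by rewrite mulr1n coef1; apply: multiplier_nat.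
rewrite mxE; apply: pmultiplier_sum => l _.
apply: (@pmultiplier_mono _ _ _ _ (S0 * q ^ (m + k) * k + S0 * q ^ (m + k.+1))).
  rewrite mulnS addnC leq_add2l leq_mul2r leq_mul2l leq_exp2l ?q_gt1 //.
  by rewrite addnS leqnSn !orbT.
apply: pmultiplierM => //; rewrite mxE; exact: pmultiplier_frob.
Qed.

Lemma Fprod_size m k i j : (size (Fp m k i j) <= (k * d).+1)%N.
Proof.
elim: k i j => [|k IH] i j.
  by rewrite mxE; case: eqP => _; rewrite ?size_poly1 ?size_poly0.
rewrite (_ : Fp m k.+1 = Fp m k *m mxfrob (m + k.+1) Phi) // mxE.
apply: leq_trans (size_sum _ _ _) _; apply/bigmax_leqP => l _.
apply: leq_trans (size_polyMleq _ _) _; rewrite mxE size_map_poly mulSn.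
by rewrite -ltnS -subn1 ltnS leq_subLR; apply: leq_trans (leq_add (IH i l) (Phi_size l j)) _; lia.
Qed.

(** The twisted determinants vanish only at theta^(q^(m+i)) with i >= 1, never at theta^(q^m), so
    transporting a relation there loses nothing. *)
Lemma Bprod_neq0 m k : (Bprod beta m k).[frob m theta] != 0.
Proof.
rewrite horner_prod; apply/prodf_neq0 => i _.
rewrite rmorphM rmorphXn rmorphB /= map_polyC map_polyX map_polyC /=.
rewrite hornerM hornerC horner_exp hornerXsubC mulf_neq0 ?expf_neq0 ?fmorph_eq0 //.
by rewrite subr_eq0; apply/eqP => /frob_theta_inj /eqP; rewrite -{1}[m]addn0 eqn_add2l.
Qed.

(** The row u_m: the m-th twist of rho psi(theta) = 0, rewritten through psi^(m+k). Keeping m + k =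
    M makes all of them relations on the same vector psi^(M). *)
Definition relation_at m k : 'rV[C]_n := map_mx (frob m) rho *m mxev (frob m theta) (Fp m k).

Lemma relation_at_neq0 m k : relation_at m k != 0.
Proof.
apply: contraNneq rho0 => u0.
have : relation_at m k *m mxev (frob m theta) (Ip m k) = 0 by rewrite u0 mul0mx.
rewrite -mulmxA -mxevM (FprodK inv1) /mxev map_scalar_mx mul_mx_scalar => /eqP.
rewrite scaler_eq0 (negPf (Bprod_neq0 m k)) /= => /eqP /rowP r0.
by apply/eqP/rowP => i; have /eqP := r0 i; rewrite !mxE fmorph_eq0 => /eqP.
Qed.

Lemma relation_at_mult m k i :
  multiplier A ((k.+1) * (S0 + d + 1) * q ^ (m + k)) (relation_at m k 0 i).
Proof.
rewrite mxE; apply: multiplier_sum => j _.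
apply: (@multiplier_mono _ _ _ _ (S0 * q ^ m + (S0 * q ^ (m + k) * k + q ^ m * (k * d)))).
  have : (q ^ m <= q ^ (m + k))%N by rewrite leq_exp2l ?q_gt1 ?leq_addr.
  move: (q ^ m)%N (q ^ (m + k))%N => x y xy.
  have h1 : (S0 * x <= S0 * y)%N by rewrite leq_mul2l xy orbT.
  have h2 : (x * (k * d) <= y * (k * d))%N by rewrite leq_mul2r xy orbT.
  apply: (@leq_trans (S0 * y + (S0 * y * k + y * (k * d)))); first by rewrite leq_add // leq_add2l.
  rewrite (_ : k.+1 * (S0 + d + 1) * y = S0 * y + (S0 * y * k + y * (k * d)) + (d * y + y + k * y))%N; last by ring.
  exact: leq_addr.
apply: multiplierM; first by rewrite mxE; apply: multiplierX.
rewrite mxE; apply: multiplier_horner; [exact: Fprod_mult|exact: Fprod_size].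
Qed.

Lemma relation_at_psi m k :
  relation_at m k *m mxpsev (frob m theta) (psfrob (m + k) psi) = 0.
Proof.
rewrite -mulmxA -mxpsev_mul; last exact: egrow_psfrob.
rewrite -(psfrob_Fprod sys) mxpsev_frob; last by case: sys.
by rewrite -map_mxM rho_psi map_mx0.
Qed.

Definition form (G : 'rV[{poly C}]_n) M : psr C := (mxps G *m psfrob M psi) 0 0.

Lemma form_egrow G M : egrow (form G M).
Proof.
rewrite /form mxE; apply: egrow_sum => i _; apply: egrowM; last exact: egrow_psfrob.
by rewrite mxE; exact: egrowP.
Qed.

Lemma form_zero G M m k (l : C) : M = (m + k)%N ->
  mxev (frob m theta) G = l *: relation_at m k -> ps_eval (form G M) (frob m theta) = 0.
Proof.
move=> -> Gu; have -> : ps_eval (form G (m + k)) (frob m theta) =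
    (mxpsev (frob m theta) (mxps G *m psfrob (m + k) psi)) 0 0 by rewrite [RHS]mxE.
rewrite mxpsev_mul; last exact: egrow_psfrob.
by rewrite Gu -scalemxAl relation_at_psi scaler0 mxE.
Qed.

(** The q^M-th power of a bound for psi on the disc of radius Q^K is a bound for psi^(M) on the disc
    of radius Q^(K q^M); the polynomials G contribute their height and the D-th power of the
    radius. *)
Lemma form_bound (G : 'rV[{poly C}]_n) M X D K B :
  (forall i k, abs (G 0 i)`_k <= Q ^+ X) -> (forall i, (size (G 0%R i) <= D)%N) ->
  (forall i k, abs (psi i 0 k) * Q ^+ (K * k) <= Q ^+ B) ->
  forall k, abs (form G M k) * (Q ^+ (K * q ^ M)) ^+ k <= Q ^+ (X + K * q ^ M * D + B * q ^ M).
Proof.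
move=> GX GD psiB k; set r := Q ^+ (K * q ^ M).
have r0 : 0 < r by exact: QX_gt0.
rewrite -ler_pdivlMr ?(exprn_gt0 _ r0) //.
have pos : 0 <= Q ^+ (X + K * q ^ M * D + B * q ^ M) / r ^+ k.
  by rewrite ltW // divr_gt0 ?QX_gt0 // exprn_gt0.
rewrite /form mxE ps_sum; apply: absv_sum => // i _.
rewrite psEM; apply: absv_sum => // a _; rewrite ler_pdivlMr ?(exprn_gt0 _ r0) //.
have ak : (a <= k)%N by rewrite -ltnS.
rewrite !mxE /psP; have [aD|Da] := ltnP a D; last first.
  by rewrite nth_default ?(leq_trans (GD i)) // mul0r absv0 mul0r ltW ?QX_gt0.
have -> : r ^+ k = r ^+ a * r ^+ (k - a) by rewrite -exprD subnKC.
rewrite absvM mulrACA exprD.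
have rX j : 0 <= r ^+ j by rewrite ltW // exprn_gt0.
apply: ler_pM; rewrite ?mulr_ge0 ?absv_ge0 //.
  rewrite [leRHS]exprD; apply: ler_pM; rewrite ?absv_ge0 //.
  by rewrite -exprM ler_QX leq_mul2l (ltnW aD) orbT.
rewrite [X in X * _]absv_frob /r -exprM mulnAC exprM -exprMn [leRHS]exprM.
by apply: lerXn2r; rewrite ?nnegrE ?mulr_ge0 ?absv_ge0 // ltW ?QX_gt0.
Qed.

(** The n + 1 twists E^(j), 0 <= j <= n, all have the form H_j psi^(M+n) with rows H_j of length n.
    Such rows are dependent over polynomials of controlled height, which gives the equation for the
    first coefficient of E. *)
Lemma form_relation (G : 'rV[{poly C}]_n) M X D v (S2 := (X * q ^ n + n * S0 * q ^ (M + n))%N) : (0 < D)%N ->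
  (forall i k, af_L A X (G 0 i)`_k) -> (forall i, (size (G 0%R i) <= D)%N) ->
  form G M v != 0 -> (forall k, (k < v)%N -> form G M k = 0) ->
  1 <= abs (form G M v) * Q ^+ ((af_liou A).+1 * (af_shift A + (2 * n + 1) * S2 + 1)).
Proof.
move=> D0 GX GD Ev Elow; set Y := (_ + 1)%N.
pose H (j : 'I_n.+1) : 'rV[{poly C}]_n := mxfrob j G *m Fp (M + j) (n - j).
have HE (j : 'I_n.+1) : psmap (frob j) (form G M) = (mxps (H j) *m psfrob (M + n) psi) 0 0.
  have -> : psmap (frob j) (form G M) = (psfrob j (mxps G *m psfrob M psi)) 0 0.
    by rewrite [RHS]mxE.
  rewrite psfrob_mul psfrobD addnC (psfrob_Fprod sys (M + j) (n - j)) mulmxA -mxpsM.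
  by rewrite -addnA subnKC // -ltnS.
pose K := (D + n * d + 1)%N.
have [||/=|a [Ya a0 aH]] := @polynomial_relation _ _ C A n n.+1 (2 * n * K) K Y S2 H.
- move=> j i; rewrite mxE; apply: pmultiplier_sum => l _.
  have jn : (j <= n)%N by rewrite -ltnS.
  apply: (@pmultiplier_mono _ _ _ _ (X * q ^ j + S0 * q ^ (M + j + (n - j)) * (n - j))).
    rewrite /S2 -addnA subnKC // leq_add ?leq_mul2l ?leq_exp2l ?q_gt1 ?jn ?orbT //.
    by rewrite -(mulnA n) [X in (_ <= X)%N]mulnC leq_mul2l leq_subr orbT.
  apply: pmultiplierM; last exact: Fprod_mult.
  by rewrite mxE; apply: pmultiplier_frob => k; apply/multiplier_L/GX.
- move=> j i; rewrite mxE; apply: leq_trans (size_sum _ _ _) _; apply/bigmax_leqP => l _.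
  apply: leq_trans (size_polyMleq _ _) _; rewrite mxE size_map_poly.
  apply: leq_trans (leq_pred _) _; apply: leq_trans (leq_add (GD l) (Fprod_size _ _ _ _)) _.
  have : ((n - j) * d <= n * d)%N by rewrite leq_mul2r leq_subr orbT.
  by rewrite /K; lia.
- by apply: relation_count; rewrite ?dim_gt0 // /K; lia.
have rel : \sum_j psP (a j) * psmap (frob j) (form G M) = 0.
  under eq_bigr => j _ do rewrite HE.
  have : mxps (\sum_j a j *: H j) *m psfrob (M + n) psi = 0 by rewrite aH /mxps map_mx0 mul0mx.
  move/matrixP/(_ 0 0); rewrite [RHS]mxE => H0; rewrite -[RHS]H0.
  have -> : mxps (\sum_j a j *: H j) = \sum_j psP (a j) *: mxps (H j).
    apply/matrixP => i k; rewrite mxE !summxE raddf_sum; apply: eq_bigr => j _.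
    by rewrite !mxE; apply: rmorphM.
  rewrite mulmx_suml summxE; apply: eq_bigr => j _.
  by rewrite -scalemxAl [RHS]mxE.
have [al [Yal al0 alrel]] := leading_coef_relation Ya a0 Elow rel.
exact: (frob_root_lower_bound Ev Yal al0 alrel).
Qed.

Lemma psi_bound K : exists B, forall i k, abs (psi i 0 k) * Q ^+ (K * k) <= Q ^+ B.
Proof.
have H i : exists B, forall k, abs (psi i 0 k) * Q ^+ (K * k) <= Q ^+ B.
  by case: sys => /(_ i) /(_ K).
exists (\max_i sval (cid (H i)))%N => i k; apply: le_trans (svalP (cid (H i)) k) _.
by rewrite ler_QX (leq_bigmax i).
Qed.

(* The auxiliary form vanishes at theta^(q^m) for 1 <= m <= M, and its
   coefficients have too small a height for so many zeros unless it is 0. *)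
Lemma vanishing_form : exists (G : 'rV[{poly C}]_n) (m k : nat) (l : C),
  [/\ forall i, algp (G 0 i), l != 0,
      mxev (frob m theta) G = l *: relation_at m k & mxps G *m psfrob (m + k) psi = 0].
Proof.
have n0 := dim_gt0.
(* In the unit W = T q^M, the constants x0, s2 and y0 bound the height X of G, the cost S2 of the
   rows H_j and the height Y of their relation. K0 adds up the Liouville loss, the height of G and
   the 2n coming from the product of the zeros, plus 1 to absorb B q^M, which is less than W because
   T = B + 1. *)
pose c := af_shift A; pose C0 := (S0 + d + 1)%N.
pose x0 := (c + 1 + 2 * n * (2 * n + 1) * C0)%N.
pose s2 := (x0 * q ^ n + n * S0 * q ^ n)%N.
pose y0 := (c + 1 + (2 * n + 1) * s2)%N.
pose K0 := ((af_liou A).+1 * y0 + x0 + 2 * n + 1)%N.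
have [B psiB] := psi_bound K0.
pose T := B.+1; pose M := (2 * n * T)%N; pose W := (T * q ^ M)%N.
pose S1 := ((M + 1) * C0 * q ^ M)%N.
have TM : (T <= M)%N by rewrite /M leq_pmull ?muln_gt0.
have qM : (0 < q ^ M)%N by exact: expq_gt0.
have [|mm dd|||mm mm'||G [l [GD GX Gu G0 [m1 lm1]]]] := @interpolation_form _ _ C A n M (M - T)
    (c + 2 * n * S1 + 1) S1 (fun m : 'I_M => relation_at m.+1 (M - m.+1))
    (fun m : 'I_M => q ^ m.+1)%N.
- move=> m i; apply: multiplier_mono (relation_at_mult _ _ _).
  rewrite subnKC // /S1 leq_mul2r leq_mul2r; apply/orP; right; apply/orP; right.
  by have := ltn_ord m; lia.
- move=> dM; rewrite /S1 mulnC leq_mul ?leq_exp2l ?q_gt1 //.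
  by rewrite /C0; nia.
- exact: interpolation_count.
- by move=> m; apply: relation_at_neq0.
- by move/(expnI q_gt1) => [] /val_inj.
- exact: leq_subr.
exists G, m1.+1, (M - m1.+1)%N, (l m1); split=> [i j|//||].
- exact: af_alg (GX i j).
- exact: Gu m1.
rewrite subnKC //; apply/matrixP => i0 j0; rewrite !ord1 [RHS]mxE.
apply: contrapT => E0.
have {}E0 : exists v, form G M v != 0.
  apply: contrapT => E00; apply: E0; apply: funext => v; rewrite psE0.
  by have [//|Ev] := eqVneq (form G M v) 0; case: E00; exists v.
have /ex_minnP[v Ev v_min] := E0.
have Elow k : (k < v)%N -> form G M k = 0.
  by move=> kv; apply/eqP; apply: contraTT kv => /v_min; rewrite -leqNgt.
set X := (c + 2 * n * S1 + 1)%N in GX.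
have MT : (0 < M - T)%N.
  by rewrite subn_gt0 /M; nia.
have low := form_relation MT GX GD Ev Elow.
set Y := (_ + 1)%N in low.
have Xabs i k : abs (G 0 i)`_k <= Q ^+ X by apply: af_abs (GX i k).
have up := form_bound M Xabs GD psiB.
set r := Q ^+ (K0 * q ^ M) in up.
have r0 : 0 < r by exact: QX_gt0.
have K00 : (0 < K0)%N by rewrite /K0 addn1.
pose zs := [seq frob m.+1 theta | m <- iota 0 M].
have := @leading_coef_zeros _ _ C zs (form G M) r _ v (form_egrow G M) r0 _ _ up Elow.
rewrite size_map size_iota big_map => H.
have {H} := H _ _; rewrite map_inj_uniq ?iota_uniq; last first.
  by move=> i j /frob_theta_inj [].
move=> /(_ isT) H.
have {H} : abs (form G M v) * r ^+ (v + M) <= Q ^+ (X + K0 * q ^ M * (M - T) + B * q ^ M) *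
    \prod_(j <- iota 0 M) abs (frob j.+1 theta).
  apply: H => x /mapP[m]; rewrite mem_iota add0n => /andP[_ mM] ->; split.
  - by rewrite fmorph_eq0 theta_neq0.
  - rewrite absv_frob absv_theta ler_QX; apply: leq_trans (leq_pmull _ K00).
    by rewrite leq_exp2l ?q_gt1.
  - by apply: (form_zero (esym (subnKC mM))) (Gu (Ordinal mM)).
move=> zeros.
have prodle : \prod_(j <- iota 0 M) abs (frob j.+1 theta) <= Q ^+ (M * q ^ M).
  have -> : iota 0 M = index_iota 0 M by rewrite /index_iota subn0.
  rewrite big_mkord mulnC exprM -[X in _ ^+ X](card_ord M) -prodr_const.
  apply: ler_prod => j _; rewrite absv_ge0 absv_frob absv_theta ler_QX.
  by rewrite leq_exp2l ?q_gt1 // ltn_ord.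
have key : r ^+ M <= Q ^+ ((af_liou A).+1 * Y + (X + K0 * q ^ M * (M - T) + B * q ^ M) + M * q ^ M).
  have r1 : 1 <= r ^+ v by rewrite -exprM; apply: QX_ge1.
  have rM : 0 <= r ^+ M by rewrite ltW // exprn_gt0.
  apply: (@le_trans _ _ (r ^+ (v + M))); first by rewrite exprD ler_peMl.
  apply: le_trans (ler_peMl _ low) _; first by rewrite ltW // exprn_gt0.
  rewrite mulrAC mulrC -addnA [leRHS]exprD.
  apply: ler_wpM2l; first by rewrite ltW ?QX_gt0.
  apply: le_trans zeros _; rewrite [leRHS]exprD.
  by apply: ler_wpM2l prodle; rewrite ltW ?QX_gt0.
(* The cost K0 q^M (M - T) cancels against K0 q^M M and leaves K0 W, which exceeds all the remaining
   terms by the choice of K0 and T. *)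
move: key; rewrite /r -exprM ler_QX leqNgt => /negP; apply.
have W0 : (0 < W)%N by rewrite muln_gt0.
have qW : (q ^ M <= W)%N by rewrite leq_pmull.
have BW : (B * q ^ M + q ^ M = W)%N by rewrite /W mulSn addnC.
have MW : (M * q ^ M = 2 * n * W)%N by rewrite /M /W mulnA.
have SW : (S1 <= (2 * n + 1) * C0 * W)%N.
  rewrite /S1 (mulnAC _ C0) mulnDl mul1n MW.
  have -> : ((2 * n + 1) * C0 * W = (2 * n * W + W) * C0)%N by ring.
  by rewrite leq_mul2r leq_add2l qW orbT.
have XW : (X <= x0 * W)%N.
  have h : (2 * n * S1 <= 2 * n * ((2 * n + 1) * C0 * W))%N by rewrite leq_mul2l SW orbT.
  have h' : (c + 1 <= (c + 1) * W)%N by rewrite leq_pmulr.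
  rewrite /X /x0 addnAC mulnDl; apply: leq_add => //; apply: leq_trans h _.
  by rewrite !mulnA.
have S2W : (X * q ^ n + n * S0 * q ^ (M + n) <= s2 * W)%N.
  rewrite /s2 mulnDl; apply: leq_add; first by rewrite mulnAC leq_mul2r XW orbT.
  by rewrite expnD (mulnC (q ^ M)%N) mulnA leq_mul2l qW orbT.
have YW : (Y <= y0 * W)%N.
  have h' : (c + 1 <= (c + 1) * W)%N by rewrite leq_pmulr.
  rewrite /y0 [leqRHS]mulnDl /Y addnAC; apply: leq_add => //.
  by rewrite -[leqRHS]mulnA leq_mul2l S2W orbT.
have lY : ((af_liou A).+1 * Y <= (af_liou A).+1 * y0 * W)%N by rewrite -[leqRHS]mulnA leq_mul2l YW orbT.
have KT : (K0 * q ^ M * M = K0 * q ^ M * (M - T) + K0 * W)%N.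
  by rewrite /W (mulnC T) mulnA -mulnDr subnK.
rewrite KT MW.
have -> : (K0 * W = (af_liou A).+1 * y0 * W + x0 * W + 2 * n * W + W)%N.
  by rewrite /K0; ring.
move: lY XW qM BW.
move: (W) (q ^ M)%N (X) (B * q ^ M)%N (K0 * q ^ M * (M - T))%N (2 * n * W)%N (x0 * W)%N (_ * y0 * W)%N (_ * Y)%N.
by move=> *; lia.
Qed.

End Integral.
End ABP.

(** * The Anderson-Brownawell-Papanikolas criterion *)

Section ABPTheorem.
Context {F : finFieldType} {R : realType} (C : Cinfty F R).
Local Notation q := #|F|.
Local Notation theta := (theta C).
Implicit Types (n : nat).

Lemma psfrob_inj m n p : injective (@psfrob F R C m n p).
Proof.
move=> f g /matrixP fg; apply/matrixP => i j; apply: funext => l.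
have := fg i j; rewrite !mxE => /(congr1 (fun h : psr C => h l)).
exact: frob_inj.
Qed.

Lemma mxev_frob m n (P : 'rV[{poly C}]_n) :
  mxev (frob m theta) (mxfrob m P) = map_mx (frob m) (mxev theta P).
Proof. by apply/matrixP => i j; rewrite !mxE horner_evalE horner_frob. Qed.

Lemma algp_mul n p (P : 'rV[{poly C}]_n) (A : 'M[{poly C}]_(n, p)) :
  (forall i, algp (P 0 i)) -> (forall i j, algp (A i j)) -> forall j, algp ((P *m A) 0 j).
Proof. by move=> aP aA j; rewrite mxE; apply: algp_sum => i _; apply: algpM. Qed.

(** Multiplying G by [Iprod] turns the relation on psi^(m+k) into one on psi^(m), with value
    proportional to rho^(m) at theta^(q^m). Taking q^m-th roots of its coefficients untwists it, and
    the scalar mu left at theta is divided out. *)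
Lemma abp_integral (A : arith_filtration C) n (Phi Phi' : 'M[{poly C}]_n) (b : C) (s : nat)
    (psi : 'cV[psr C]_n) (rho : 'rV[C]_n) (S0 d : nat) (beta := b%:P * ('X - theta%:P) ^+ s) :
  b != 0 -> frob_system Phi psi -> Phi *m Phi' = beta%:M -> Phi' *m Phi = beta%:M ->
  (forall i j, pmultiplier A S0 (Phi i j)) -> (forall i j, (size (Phi i j) <= d.+1)%N) ->
  (forall i j, algp (Phi' i j)) ->
  (forall i, multiplier A S0 (rho 0 i)) -> (forall i, alg (rho 0 i)) -> rho != 0 ->
  rho *m mxpsev theta psi = 0 ->
  exists P : 'rV[{poly C}]_n, [/\ forall i, algp (P 0 i), mxev theta P = rho & mxps P *m psi = 0].
Proof.
move=> b0 sys inv1 inv2 Phi_mult Phi_size aPhi' rho_mult rho_alg rho0 rho_psi.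
have [G [m [k [l [aG l0 Gu Gpsi]]]]] :=
  vanishing_form b0 sys inv1 Phi_mult Phi_size rho_mult rho0 rho_psi.
have aI : forall i j, algp (Iprod Phi' m k i j).
  elim: k {Gu Gpsi} => [|k IH] i j; first by rewrite mxE -[_ *+ _]mulr_natr mul1r; apply: algp_nat.
  by rewrite mxE; apply: algp_sum => a _; apply: algpM; rewrite // mxE; apply: algp_frob.
pose H := G *m Iprod Phi' m k.
have aH := algp_mul aG aI.
have Hpsi : mxps H *m psfrob m psi = 0.
  rewrite (psfrob_Fprod sys m k) mulmxA -mxpsM -mulmxA (IprodK inv2) scalar_mxC.
  by rewrite mxpsM -mulmxA Gpsi mulmx0.
pose be := (Bprod beta m k).[frob m theta].
have be0 : be != 0 by apply: (Bprod_neq0 s b0).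
have Hev : mxev (frob m theta) H = (l * be) *: map_mx (frob m) rho.
  rewrite mxevM Gu -scalemxAl -mulmxA -mxevM (FprodK inv1) /mxev map_scalar_mx.
  by rewrite mul_mx_scalar scalerA.
have [P0 P0H] : exists P0 : 'rV[{poly C}]_n, mxfrob m P0 = H.
  have HP i : exists p, map_poly (frob m) p = H 0 i by exact: frob_poly_surj.
  exists (\row_i sval (cid (HP i))); apply/rowP => i; rewrite !mxE.
  by rewrite (svalP (cid (HP i))) mxE.
have aP0 i : algp (P0 0 i).
  by apply: (@algp_unfrob _ _ _ m); have := aH i; rewrite -/H -P0H mxE.
have P0psi : mxps P0 *m psi = 0.
  by apply: (@psfrob_inj m); rewrite psfrob_mul P0H Hpsi /psfrob map_mx0.
have [mu mub] := frob_surj m (l * be).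
have mu0 : mu != 0.
  by apply: contraNneq (mulf_neq0 l0 be0) => mu0; rewrite -mub mu0 (rmorph0 (frob m)).
have P0ev : mxev theta P0 = mu *: rho.
  apply/rowP => i; apply: (@frob_inj _ _ _ m).
  move: Hev; rewrite -P0H mxev_frob => /rowP /(_ i); rewrite !mxE => ->.
  by rewrite -mub; apply/esym/rmorphM.
(* Nothing is known about l beyond the linear system it solves; mu is algebraic because mu rho_i =
   P0_i(theta) for some nonzero rho_i. *)
have amu : alg mu.
  have [i ri] : exists i, rho 0 i != 0.
    apply/existsP; apply: contraNT rho0; rewrite negb_exists => /forallP r0.
    by apply/eqP/rowP => i; have := r0 i; rewrite negbK mxE => /eqP.
  have : mu * rho 0 i = (P0 0 i).[theta] by move/rowP/(_ i): P0ev; rewrite !mxE.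
  move/(canRL (mulfK ri)) => ->; apply: algM; last exact: algV.
  by apply: alg_horner => //; exact: alg_theta.
exists ((mu^-1)%:P *: P0); split.
- by move=> i; rewrite mxE; apply: algpM => //; apply/algpC/algV.
- apply/rowP => i; move/rowP/(_ i): P0ev; rewrite !mxE !horner_evalE => E.
  by rewrite hornerM hornerC E mulKf.
- have -> : mxps ((mu^-1)%:P *: P0) = psP (mu^-1)%:P *: mxps P0.
    by apply/matrixP => i j; rewrite !mxE; apply: rmorphM.
  by rewrite -scalemxAl P0psi scaler0.
Qed.

(** Reduction to the integral case: a common denominator e of Phi and rho is moved into Phi, and psi
    is rescaled so that the system persists. *)
Theorem abp n (Phi Phi' : 'M[{poly C}]_n) (b : C) (s : nat)
    (psi : 'cV[psr C]_n) (rho : 'rV[C]_n) (beta := b%:P * ('X - theta%:P) ^+ s) :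
  b != 0 -> frob_system Phi psi -> Phi *m Phi' = beta%:M -> Phi' *m Phi = beta%:M ->
  (forall i j, algp (Phi i j)) -> (forall i j, algp (Phi' i j)) ->
  (forall i, alg (rho 0 i)) -> rho *m mxpsev theta psi = 0 ->
  exists P : 'rV[{poly C}]_n, [/\ forall i, algp (P 0 i), mxev theta P = rho & mxps P *m psi = 0].
Proof.
move=> b0 sys inv1 inv2 aPhi aPhi' arho rho_psi.
have [->|rho0] := eqVneq rho 0.
  exists 0; split; first by move=> i; rewrite mxE -[0]/(0%:R); apply: algp_nat.
    by apply/matrixP => i j; rewrite !mxE horner_evalE horner0.
  by rewrite /mxps map_mx0 mul0mx.
pose cs := flatten [seq (Phi ij.1 ij.2 : seq C) | ij : 'I_n * 'I_n] ++ [seq rho 0 i | i : 'I_n].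
have [A [e [S0 [e0 ae LS0]]]] : exists (A : arith_filtration C) (d : C) (S : nat),
    [/\ d != 0, alg d & forall a, a \in cs -> af_L A S (d * a)].
  apply: arith_filtration_exists => a; rewrite mem_cat => /orP[/flatten_mapP[ij _]|/mapP[i _ ->]] //.
  by move=> /(nthP 0)[k _ <-]; apply: aPhi.
(* Replacing Phi by e Phi brings a factor e^q into the twisted system, so mu psi is a solution
   exactly when mu = e^q mu^q. *)
have [mu muE] : exists mu : C, mu ^+ q.-1 = e ^- q.
  have q1 : (0 < q.-1)%N by rewrite -ltnS prednK ?q_gt0 // q_gt1.
  have [y Hy] := solve_monicpoly (fun i => if i is 0%N then e ^- q : C else 0) q1.
  exists y; rewrite Hy -(prednK q1) big_ord_recl /= expr0 mulr1.
  by rewrite big1 ?addr0 // => i _; rewrite mul0r.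
have eq0 : e ^+ q != 0 by rewrite expf_neq0.
have mu0 : mu != 0.
  apply: contraNneq eq0 => mu0; rewrite -invr_eq0 -muE mu0 expr0n.
  by rewrite -leqn0 leqNgt -ltnS prednK ?q_gt0 // q_gt1.
pose psi1 : 'cV[psr C]_n := psP mu%:P *: psi.
have ev1 i : psi1 i 0 = psP mu%:P * psi i 0 by rewrite mxE.
have sys1 : frob_system (e%:P *: Phi) psi1.
  split=> [i|]; first by rewrite ev1; apply: egrowM; [exact: egrowP|case: sys].
  have -> : mxfrob 1 (e%:P *: Phi) = (e ^+ q)%:P *: mxfrob 1 Phi.
    apply/matrixP => i j; rewrite !mxE rmorphM /= map_polyC /=; congr (_%:P * _).
  have -> : psfrob 1 psi1 = psP (mu ^+ q)%:P *: psfrob 1 psi.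
    apply/matrixP => i j; rewrite !mxE.
    transitivity (psmap (frob 1) (psP mu%:P) * psmap (frob 1) (psi i j)); first exact: rmorphM.
    by rewrite psmapP map_polyC.
  have -> : mxps ((e ^+ q)%:P *: mxfrob 1 Phi) = psP (e ^+ q)%:P *: mxps (mxfrob 1 Phi).
    by apply/matrixP => i j; rewrite !mxE; apply: rmorphM.
  rewrite -scalemxAl -scalemxAr -sys.2 scalerA /psi1 -rmorphM -polyCM.
  congr (psP (_%:P) *: _); rewrite -[in mu ^+ q](prednK (q_gt0 (F := F))) exprS muE.
  by rewrite mulrCA divff ?mulr1.
have [P [aP Pev Ppsi]] : exists P : 'rV[{poly C}]_n, [/\ forall i, algp (P 0 i),
    mxev theta P = e *: rho & mxps P *m psi1 = 0].
  apply: (@abp_integral A n (e%:P *: Phi) Phi' (e * b) s psi1 (e *: rho) S0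
     (\max_ij size (Phi ij.1 ij.2))) => //.
  - by rewrite mulf_neq0.
  - by rewrite -scalemxAl inv1 scale_scalar_mx polyCM mulrA.
  - by rewrite -scalemxAr inv2 scale_scalar_mx polyCM mulrA.
  - move=> i j k; rewrite mxE coefCM; have [kS|Sk] := ltnP k (size (Phi i j)).
      apply/multiplier_L/LS0; rewrite mem_cat; apply/orP; left.
      by apply/flatten_mapP; exists (i, j); rewrite ?mem_enum //; apply: mem_nth.
    by rewrite nth_default // mulr0; apply: multiplier0.
  - move=> i j; rewrite mxE size_Cmul // ltnW // ltnS.
    exact: (leq_bigmax (i, j)).
  - move=> i; rewrite mxE; apply/multiplier_L/LS0; rewrite mem_cat; apply/orP; right.
    by apply/mapP; exists i; rewrite ?mem_enum.
  - by move=> i; rewrite mxE; apply: algM.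
  - by rewrite scaler_eq0 (negPf e0).
  - rewrite (_ : mxpsev theta psi1 = mu *: mxpsev theta psi).
      by rewrite -scalemxAl -scalemxAr rho_psi !scaler0.
    apply/matrixP => i j; rewrite ord1 !mxE ps_evalM ?ps_evalP ?hornerC //; first exact: egrowP.
    by case: sys.
exists ((e^-1)%:P *: P); split.
- by move=> i; rewrite mxE; apply: algpM => //; apply/algpC/algV.
- apply/rowP => i; move/rowP/(_ i): Pev; rewrite !mxE !horner_evalE => E.
  by rewrite hornerM hornerC E mulKf.
- have -> : mxps ((e^-1)%:P *: P) = psP (e^-1)%:P *: mxps P.
    by apply/matrixP => i j; rewrite !mxE; apply: rmorphM.
  have -> : psi = psP (mu^-1)%:P *: psi1.
    by rewrite /psi1 scalerA -rmorphM -polyCM mulVf // rmorph1 scale1r.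
  by rewrite -scalemxAl -scalemxAr Ppsi !scaler0.
Qed.

End ABPTheorem.

(** * The series Omega *)

Section OmegaSeries.
Context {F : finFieldType} {R : realType} (C : Cinfty F R).
Local Notation Q := (#|F|%:R : R).
Local Notation q := #|F|.
Local Notation abs := (absv C).
Local Notation theta := (theta C).

Definition om_poly n : {poly C} := \prod_(i < n) (1 - (theta ^- (q ^ i.+1))%:P * 'X).

Lemma om_polyS n : om_poly n.+1 = om_poly n * (1 - (theta ^- (q ^ n.+1))%:P * 'X).
Proof. exact: big_ord_recr. Qed.

Lemma om_polyS_frob n :
  om_poly n.+1 = (1 - (theta ^- q)%:P * 'X) * map_poly (frob 1) (om_poly n).
Proof.
rewrite /om_poly big_ord_recl /= expn1 rmorph_prod; congr (_ * _).
apply: eq_bigr => i _; rewrite rmorphB rmorph1 rmorphM /= map_polyC map_polyX /=.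
congr (1 - _%:P * 'X); change (theta ^- (q ^ i.+2) = (theta ^- (q ^ i.+1)) ^+ (q ^ 1)).
by rewrite expn1 exprVn -exprM -expnSr.
Qed.

Lemma coef_om_polyS n j : (om_poly n.+1)`_j =
  (om_poly n)`_j - theta ^- (q ^ n.+1) * (if j is j'.+1 then (om_poly n)`_j' else 0).
Proof.
rewrite om_polyS mulrBr mulr1 coefB; congr (_ - _).
by rewrite mulrCA coefCM coefMX; case: j.
Qed.

Lemma absv_theta_pow m : abs (theta ^- m) = Q ^- m.
Proof. by rewrite absvV absvX absv_theta. Qed.

Lemma leq_expq m : (m <= q ^ m)%N.
Proof. by rewrite ltnW // ltn_expl // q_gt1. Qed.

(** On the disc of radius Q^K, the factor 1 - t / theta^(q^i) has sup norm at most Q^K, and at most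
    1 as soon as i >= K because q^i >= i. So at most K factors count. *)
Lemma om_poly_bound K n j : abs (om_poly n)`_j * Q ^+ (K * j) <= Q ^+ (K * minn n K).
Proof.
elim: n j => [|n IH] j.
  rewrite /om_poly big_ord0 min0n muln0 expr0 coef1; case: j => [|j] /=.
    by rewrite absv1 muln0 mulr1.
  by rewrite absv0 mul0r.
have Qpos m : 0 < Q ^+ m := QX_gt0 _.
have mono : Q ^+ (K * minn n K) <= Q ^+ (K * minn n.+1 K).
  by rewrite ler_QX leq_mul2l; apply/orP; right; lia.
rewrite coef_om_polyS -ler_pdivlMr //; apply: absvB_le; rewrite ler_pdivlMr //.
  exact: le_trans (IH j) mono.
case: j => [|j]; first by rewrite mulr0 absv0 mul0r ltW.
rewrite absvM absv_theta_pow mulnS exprD.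
rewrite [leLHS](_ : _ = abs (om_poly n)`_j * Q ^+ (K * j) * (Q ^+ K / Q ^+ (q ^ n.+1))); last first.
  by move: (Q ^+ K) (Q ^+ (K * j)) (Q ^+ (q ^ n.+1)) => a b c; ring.
apply: (@le_trans _ _ (Q ^+ (K * minn n K) * (Q ^+ K / Q ^+ (q ^ n.+1)))).
  by apply: ler_wpM2r (IH j); rewrite divr_ge0 ?ltW.
rewrite mulrA ler_pdivrMr // -!exprD ler_QX.
have [nK|Kn] := ltnP n K.
  have -> : minn n.+1 K = n.+1 by lia.
  by rewrite mulnS addnC leq_addr.
have -> : minn n.+1 K = K by lia.
by rewrite leq_add2l (leq_trans (leq_trans Kn (leqnSn n))) // leq_expq.
Qed.

Lemma om_poly_bound' K n j : abs (om_poly n)`_j * Q ^+ (K * j) <= Q ^+ (K * K).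
Proof. by apply: le_trans (om_poly_bound K n j) _; rewrite ler_QX leq_mul2l geq_minr orbT. Qed.

Lemma om_poly_cauchy K j n m : (n <= m)%N ->
  abs ((om_poly m)`_j - (om_poly n)`_j) * Q ^+ n <= Q ^+ (K * K + K) / Q ^+ (K * j).
Proof.
have Qpos i : 0 < Q ^+ i := QX_gt0 _.
move=> nm; rewrite -ler_pdivlMr // -(subnKC nm); elim: (m - n)%N => [|i IH].
  by rewrite addn0 subrr absv0 !divr_ge0 ?ltW.
rewrite addnS coef_om_polyS addrAC; apply: absvB_le => //.
case: j IH => [|j] _; first by rewrite mulr0 absv0 !divr_ge0 ?ltW.
rewrite absvM absv_theta_pow !ler_pdivlMr // mulnS.
rewrite [leLHS](_ : _ = abs (om_poly (n + i))`_j * Q ^+ (K * j) * (Q ^+ K * (Q ^+ n / Q ^+ (q ^ (n + i).+1)))); last first.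
  rewrite exprD; move: (Q ^+ K) (Q ^+ (K * j)) (Q ^+ n) (Q ^+ (q ^ (n + i).+1)) => a b c e; ring.
have Qge i' : 0 <= Q ^+ i' by rewrite ltW.
rewrite [leRHS]exprD; apply: ler_pM; rewrite ?mulr_ge0 ?absv_ge0 ?invr_ge0 //.
  exact: om_poly_bound'.
rewrite -[leRHS]mulr1; apply: ler_wpM2l; first by rewrite ltW.
rewrite ler_pdivrMr // mul1r ler_QX; apply: leq_trans (leq_expq _).
by rewrite -addnS leq_addr.
Qed.

Definition om : psr C := fun j => limit (fun n => (om_poly n)`_j).

Lemma om_conv K j : converges (fun n => (om_poly n)`_j) (om j) /\
  forall n, abs (om j - (om_poly n)`_j) * Q ^+ n <= Q ^+ (K * K + K) / Q ^+ (K * j).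
Proof.
by have [l cl bl] := cauchy_geom (om_poly_cauchy K j); rewrite /om (limit_eq cl).
Qed.

Lemma egrow_om : egrow om.
Proof.
move=> K; exists (K * K)%N => j; rewrite -ler_pdivlMr ?QX_gt0 //.
apply: (converges_bound (om_conv 0 j).1) => n; rewrite ler_pdivlMr ?QX_gt0 //.
exact: om_poly_bound'.
Qed.

Lemma ps_eval_bound (g : psr C) x (b : R) : egrow g -> 0 <= b ->
  (forall j, abs (g j) * abs x ^+ j <= b) -> abs (ps_eval g x) <= b.
Proof.
move=> eg b0 gb; apply: (converges_bound (egrow_hasval x eg)) => n.
by apply: absv_sum => // i _; rewrite absvM absvX.
Qed.

(** The error bounds of [om_conv] are uniform on discs, so the coefficientwise limit also gives the
    pointwise limit that defines [Omega]. *)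
Lemma om_eval_conv x : converges (fun n => (om_poly n).[x]) (ps_eval om x).
Proof.
have Qpos i : 0 < Q ^+ i := QX_gt0 _.
have [K xK] := @QX_unbounded F R (abs x).
apply: (@converges_geom _ _ _ _ _ (Q ^+ (K * K + K))) => n.
rewrite absvBC -ps_evalP -ler_pdivlMr //.
have -> : ps_eval om x - ps_eval (psP (om_poly n)) x = ps_eval (om + psP (- om_poly n)) x.
  rewrite ps_evalD; [|exact: egrow_om|exact: egrowP].
  by rewrite !ps_evalP hornerN.
apply: ps_eval_bound; first by apply: egrowD; [exact: egrow_om|exact: egrowP].
  by rewrite divr_ge0 ?ltW.
move=> j; rewrite psD /psP coefN.
have := (om_conv K j).2 n; rewrite !ler_pdivlMr // => H; apply: le_trans H.
rewrite mulrAC; apply: ler_wpM2l; first by rewrite mulr_ge0 ?absv_ge0 ?ltW.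
by rewrite exprM; apply: lerXn2r => //; rewrite nnegrE ?absv_ge0 ?ltW.
Qed.

(** Twisting shifts the index of the product by one; the identity holds for the partial products and
    passes to the limit. *)
Lemma om_frob : om = psP (1 - (theta ^- q)%:P * 'X) * psmap (frob 1) om.
Proof.
apply: funext => j.
pose sh (f : nat -> C) : C := if j is j'.+1 then f j' else 0.
have RE (f : psr C) : (psP (1 - (theta ^- q)%:P * 'X) * f) j = f j - theta ^- q * sh f.
  rewrite rmorphB mulrBl rmorph1 mul1r psD psN; congr (_ - _).
  rewrite psEM /sh; case: j {sh} => [|j].
    by rewrite big_ord1 /= /psP coefCM coefX /= !(mulr0, mul0r).
  rewrite 2!big_ord_recl /= /psP !coefCM !coefX /= mulr0 mul0r add0r mulr1 subn1 /=.
  by rewrite big1 ?addr0 // => i _; rewrite coefCM coefX /= mulr0 mul0r.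
rewrite RE.
have c1 : converges (fun n => (om_poly n.+1)`_j) (om j).
  have /convergesP H := (om_conv 0 j).1; apply/convergesP => e /H[N HN].
  by exists N => n Nn; apply: HN; apply: leqW.
apply: (converges_uniq c1).
have H n : (om_poly n.+1)`_j = frob 1 (om_poly n)`_j - theta ^- q * sh (fun j => frob 1 (om_poly n)`_j).
  rewrite om_polyS_frob mulrBl mul1r coefB coef_map; congr (_ - _).
  by rewrite -mulrA coefCM coefXM /sh; case: (j) => [|j'] //=; rewrite coef_map.
have -> : (fun n => (om_poly n.+1)`_j) = (fun n => frob 1 (om_poly n)`_j - theta ^- q * sh (fun j => frob 1 (om_poly n)`_j)).
  by apply: funext => n; rewrite H.
apply: convergesB; first exact: converges_frob (om_conv 0 j).1.
apply: convergesZ; rewrite /sh; case: (j) => [|j']; first exact: converges_cst.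
exact: converges_frob (om_conv 0 j').1.
Qed.

Lemma horner_om_poly n x : (om_poly n).[x] = \prod_(i < n) (1 - x / theta ^+ (q ^ i.+1)).
Proof.
rewrite horner_prod; apply: eq_bigr => i _.
by rewrite hornerD hornerN !hornerE mulrC.
Qed.

Section Normalized.
Variable tt : C.
Hypothesis htt : tt ^+ q.-1 = - theta.

Definition OmegaS : psr C := psP (tt ^- q)%:P * om.

Lemma egrow_Omega : egrow OmegaS.
Proof. by apply: egrowM; [exact: egrowP|exact: egrow_om]. Qed.

Lemma tt_neq0 : tt != 0.
Proof.
apply: contraTneq isT => tt0; move: htt; rewrite tt0 expr0n.
have -> : q.-1 == 0%N = false by apply/negbTE; rewrite -lt0n -ltnS prednK ?q_gt0 // q_gt1.
by move/esym/eqP; rewrite oppr_eq0 (negPf (theta_neq0 C)).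
Qed.

(** The normalization tt^(q-1) = - theta gives tt^(q^2) = - tt^q theta^q, which turns the factor 1 -
    t / theta^q into t - theta^q. Thus Omega solves the scalar system with matrix t - theta. *)
Lemma Omega_frob : OmegaS = psP ('X - (theta ^+ q)%:P) * psmap (frob 1) OmegaS.
Proof.
have tt0 := tt_neq0; have th0 := theta_neq0 C.
have -> : psmap (frob 1) OmegaS = psP (tt ^- q ^+ q)%:P * psmap (frob 1) om.
  transitivity (psmap (frob 1) (psP (tt ^- q)%:P) * psmap (frob 1) om); first exact: rmorphM.
  by rewrite psmapP map_polyC /= /frob expn1.
rewrite /OmegaS {1}om_frob !mulrA -!rmorphM; congr (psP _ * _).
have thq : theta ^+ q != 0 by rewrite expf_neq0.
have ttq : tt ^+ q != 0 by rewrite expf_neq0.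
have E : (tt ^+ q) ^+ q = - (tt ^+ q * theta ^+ q).
  have -> : (tt ^+ q) ^+ q = tt ^+ q * (tt ^+ q.-1) ^+ q.
    by rewrite -exprMn -exprS prednK ?q_gt0.
  rewrite htt -mulrN; congr (_ * _).
  by have := rmorphN (frob 1) theta; rewrite /= /frob expn1.
have -> : tt ^- q ^+ q = - (tt ^- q * theta ^- q).
  by rewrite exprVn E invrN invfM.
rewrite polyCN polyCM.
have : (theta ^+ q)%:P * (theta ^- q)%:P = 1 by rewrite -polyCM divff.
move: (theta ^+ q)%:P (theta ^- q)%:P (tt ^- q)%:P => T I A TI.
by rewrite -[1]TI; ring.
Qed.

Lemma Omega_conv x : converges (fun n => tt ^- q * (om_poly n).[x]) (ps_eval OmegaS x).
Proof.
rewrite ps_evalM; [|exact: egrowP|exact: egrow_om].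
by rewrite ps_evalP hornerC; apply: convergesZ; exact: om_eval_conv.
Qed.

Lemma Omega_eval x : ps_eval OmegaS x = Omega tt x.
Proof.
rewrite -(limit_eq (Omega_conv x)); congr limit; apply: funext => n; congr (_ * _).
by rewrite horner_om_poly big_add1 /= big_mkord.
Qed.

(** Each factor has absolute value 1 at theta, so the partial products keep the absolute value of
    tt^-q and cannot tend to 0. *)
Lemma Omega_theta_neq0 : Omega tt theta != 0.
Proof.
rewrite -Omega_eval; apply/eqP => E; have := Omega_conv theta; rewrite E => /convergesP H.
have e0 : 0 < abs (tt ^- q) by rewrite absv_gt0 invr_neq0 // expf_neq0 // tt_neq0.
have [N /(_ N (leqnn _))] := H _ e0.
rewrite subr0 absvM horner_om_poly absv_prod big1 ?mulr1 ?ltxx // => i _.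
rewrite absvD_eq ?absv1 // absvN absvM absvV absvX absv_theta ltr_pdivrMr ?QX_gt0 // mul1r.
rewrite -[ltLHS]expr1 ltr_eXn2l ?Q_gt1 //.
by rewrite -[1%N](expn0 q) ltn_exp2l ?q_gt1.
Qed.

Lemma Omega_zero N : (0 < N)%N -> ps_eval OmegaS (theta ^+ (q ^ N)) = 0.
Proof.
case: N => // N _; apply: (converges_uniq (Omega_conv _)).
apply: (@converges_tail _ _ _ (fun=> 0) _ _ N.+1) => [n Nn|]; last exact: converges_cst.
rewrite horner_om_poly (bigD1 (Ordinal Nn)) //= divff ?subrr ?mul0r ?mulr0 //.
by rewrite expf_neq0 // theta_neq0.
Qed.

End Normalized.
End OmegaSeries.

(** * Systems attached to MZ values *)

Section BlockDiagonal.
Variables (p : nat) (p_ : 'I_p -> nat).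

Lemma mxdiag_entry (V : nmodType) (B : forall i, 'M[V]_(p_ i)) (P : V -> Prop) :
  P 0 -> (forall i j k, P (B i j k)) -> forall s t, P ((\mxdiag_i B i) s t).
Proof.
move=> P0 PB s t; rewrite !mxE /tagnat.sig1 /tagnat.sig2.
case: (tagnat.sig s) (tagnat.sig t) => [/= i j] [/= i' j'].
by case: eqP => [<-|_] in j' *; rewrite ?conform_mx_id // mxE.
Qed.

Lemma map_mxdiag (V W : nmodType) (f : {additive V -> W}) (B : forall i, 'M[V]_(p_ i)) :
  map_mx f (\mxdiag_i B i) = \mxdiag_i map_mx f (B i).
Proof.
apply/matrixP => s t; rewrite !mxE /tagnat.sig1 /tagnat.sig2.
case: (tagnat.sig s) (tagnat.sig t) => [/= i j] [/= i' j'].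
case: eqP => [<-|ni] in j' *; last by rewrite !mxE raddf0.
by rewrite !conform_mx_id !mxE.
Qed.

Lemma mul_mxdiag (K : pzSemiRingType) (A B : forall i, 'M[K]_(p_ i)) :
  \mxdiag_i A i *m \mxdiag_i B i = \mxdiag_i (A i *m B i).
Proof.
rewrite [X in _ *m X]/mxdiag mul_mxdiag_mxblock /mxdiag; apply/eq_mxblock => i j.
by case: eqVneq => [<-|_]; rewrite ?conform_mx_id // mulmx0.
Qed.

End BlockDiagonal.

Section Realizations.
Context {F : finFieldType} {R : realType} (C : Cinfty F R).
Local Notation q := #|F|.
Local Notation theta := (theta C).
Variable tt : C.
Hypothesis htt : tt ^+ q.-1 = - theta.

(* A system of weight W with last coordinate c Z / pi^W at theta; [top] tells
   whether that coordinate survives at the points theta^(q^N), which fails once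
   the system has been multiplied by a power of Omega. *)
Record realization (W : nat) (top : bool) (Z : C) := Realization {
  rz_n : nat;
  rz_Phi : 'M[{poly C}]_rz_n.+1;
  rz_inv : 'M[{poly C}]_rz_n.+1;
  rz_s : nat;
  rz_psi : 'cV[psr C]_rz_n.+1;
  rz_c : C;
  rz_sys : frob_system rz_Phi rz_psi;
  rz_inv1 : rz_Phi *m rz_inv = (('X - theta%:P) ^+ rz_s)%:M;
  rz_inv2 : rz_inv *m rz_Phi = (('X - theta%:P) ^+ rz_s)%:M;
  rz_alg : forall i j, algp (rz_Phi i j);
  rz_alg_inv : forall i j, algp (rz_inv i j);
  rz_kf : kfield C rz_c;
  rz_c0 : rz_c != 0;
  rz_theta : ps_eval (rz_psi ord_max 0) theta = rz_c * Z / pitilde tt ^+ W;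
  rz_zero : forall N i, (0 < N)%N -> ps_eval (rz_psi i 0) (theta ^+ (q ^ N)) =
    if (i == ord_max) && top then (rz_c * Z / pitilde tt ^+ W) ^+ (q ^ N) else 0 }.

Lemma pitilde_neq0 : pitilde tt != 0.
Proof. by rewrite /pitilde mul1r invr_neq0 ?Omega_theta_neq0. Qed.

Lemma pitildeV : (pitilde tt)^-1 = Omega tt theta.
Proof. by rewrite /pitilde mul1r invrK. Qed.

Lemma ps_evalX f x n : egrow f -> ps_eval (f ^+ n) x = ps_eval f x ^+ n :> C.
Proof.
move=> ef; elim: n => [|n IH]; last by rewrite !exprS ps_evalM ?IH //; exact: egrowX.
by rewrite !expr0 -(rmorph1 (@psP C)) ps_evalP hornerC.
Qed.

Lemma algp_prod I (r : seq I) (P : pred I) (f : I -> {poly C}) :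
  (forall i, P i -> algp (f i)) -> algp (\prod_(i <- r | P i) f i).
Proof. by move=> H; elim/big_rec: _ => [|i x /H ? ?]; [exact: (algp_nat C 1)|exact: algpM]. Qed.

Lemma algp_sign n : algp ((-1) ^+ n : {poly C}).
Proof. by apply: algpX; rewrite -polyCN; apply/algpC/algN/alg1. Qed.

Lemma algp_det n (A : 'M[{poly C}]_n) : (forall i j, algp (A i j)) -> algp (\det A).
Proof.
move=> aA; apply: algp_sum => s _; apply: algpM; first exact: algp_sign.
by apply: algp_prod => i _.
Qed.

Lemma algp_adj n (A : 'M[{poly C}]_n) : (forall i j, algp (A i j)) -> forall i j, algp ((\adj A) i j).
Proof.
move=> aA i j; rewrite mxE /cofactor; apply: algpM; first exact: algp_sign.
by apply: algp_det => k l; rewrite !mxE.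
Qed.

Lemma algp_XsubtX s : algp (('X - theta%:P) ^+ s).
Proof. by apply/algpX/algp_XsubC; exact: alg_theta. Qed.

Lemma twist_frob n (psi : 'cV[psr C]_n) (Phi : 'M[{poly C}]_n) :
  map_mx (twist (- 1)) psi = mx_ps_mul Phi psi -> psi = mxps (mxfrob 1 Phi) *m psfrob 1 psi.
Proof.
move=> E.
have -> : mxps (mxfrob 1 Phi) *m psfrob 1 psi = psfrob 1 (mxps Phi *m psi) by rewrite psfrob_mul.
have -> : mxps Phi *m psi = map_mx (twist (- 1)) psi.
  rewrite E; apply/matrixP => i j; rewrite ord1 !mxE; apply: funext => l.
  by rewrite ps_sum; apply: eq_bigr => k _; rewrite mxE.
apply/matrixP => i j; rewrite !mxE; apply: funext => l; apply/esym.
(* The negative twist chooses a q-th root by [xget]; since one exists, the default value 0 is not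
   taken and the q-th power gives back the coefficient. *)
have [y Hy] := @frob_surj F R C 1 (psi i j l).
exact: (@xgetPex _ 0 [set y : C | y ^+ (q ^ 1) = psi i j l] (ex_intro _ y Hy)).
Qed.

(** The condition on the determinant makes adj(Phi) / b an inverse of Phi up to (t - theta)^s, with
    algebraic coefficients. *)
Lemma MZ_realization w Z : MZ_property tt w Z -> $|realization w true Z|.
Proof.
case=> _ _ [d [Phi [psi [aPhi epsi [/twist_frob sys [b [s [kb b0 detE]]]] _ [c [[kc c0] _ ctheta czero]]]]]].
have {}aPhi i j : algp (Phi i j) by move=> k; apply: kbar_alg.
have bb : (b^-1)%:P * b%:P = 1 :> {poly C} by rewrite -polyCM mulVf.
apply: squash; apply: (@Realization _ _ _ _ Phi ((b^-1)%:P *: \adj Phi) s psi c) => //.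
- by split=> // i; apply: entire_egrow.
- by rewrite -scalemxAr mul_mx_adj detE scale_scalar_mx mulrA bb mul1r.
- by rewrite -scalemxAl mul_adj_mx detE scale_scalar_mx mulrA bb mul1r.
- move=> i j; rewrite mxE; apply: algpM; last exact: algp_adj.
  by apply/algpC/algV/kbar_alg.
- move=> N i N0; have [H1 H2] := czero N N0; rewrite andbT.
  by case: eqP => [-> //|/eqP]; apply: H1.
Qed.

Lemma realization_lift w W Z : (w < W)%N -> realization w true Z -> $|realization W false Z|.
Proof.
move=> wW [n Phi Phi' s psi c sys inv1 inv2 aP aP' kc c0 vt vz].
pose k := (W - w)%N; pose th := ('X - theta%:P : {poly C}).
have k0 : (0 < k)%N by rewrite subn_gt0.
have eO : egrow (OmegaS tt ^+ k) by apply/egrowX/egrow_Omega.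
apply: squash; apply: (@Realization _ _ _ n (th ^+ k *: Phi) Phi' (k + s) (OmegaS tt ^+ k *: psi) c) => //.
- split=> [i|]; first by rewrite mxE; apply: egrowM => //; case: sys.
  have -> : mxfrob 1 (th ^+ k *: Phi) = ('X - (theta ^+ q)%:P) ^+ k *: mxfrob 1 Phi.
    apply/matrixP => i j; rewrite !mxE rmorphM rmorphXn; congr (_ ^+ _ * _).
    by rewrite rmorphB /= map_polyX map_polyC /= /frob expn1.
  have -> : psfrob 1 (OmegaS tt ^+ k *: psi) = psmap (frob 1) (OmegaS tt) ^+ k *: psfrob 1 psi.
    apply/matrixP => i j; rewrite !mxE.
    transitivity (psmap (frob 1) (OmegaS tt ^+ k) * psmap (frob 1) (psi i j)); first exact: rmorphM.
    by congr (_ * _); apply: rmorphXn.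
  have -> : mxps (('X - (theta ^+ q)%:P) ^+ k *: mxfrob 1 Phi) =
      psP ('X - (theta ^+ q)%:P) ^+ k *: mxps (mxfrob 1 Phi).
    apply/matrixP => i j; rewrite !mxE.
    transitivity (psP (('X - (theta ^+ q)%:P) ^+ k) * psP (map_poly (frob 1) (Phi i j))); first exact: rmorphM.
    by congr (_ * _); apply: rmorphXn.
  by rewrite -scalemxAl -scalemxAr -sys.2 scalerA -exprMn -(Omega_frob htt).
- by rewrite -scalemxAl inv1 scale_scalar_mx exprD.
- by rewrite -scalemxAr inv2 scale_scalar_mx exprD.
- by move=> i j; rewrite mxE; apply: algpM => //; exact: algp_XsubtX.
- rewrite mxE ps_evalM //; last by case: sys.
  rewrite ps_evalX; last exact: egrow_Omega.
  rewrite vt Omega_eval -pitildeV -(subnK (ltnW wW)) -/k exprD.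
  have := expf_neq0 k pitilde_neq0; have := expf_neq0 w pitilde_neq0.
  rewrite exprVn; move: (pitilde tt ^+ k) (pitilde tt ^+ w) => a a' a0 a'0.
  by field; rewrite a0 a'0.
- move=> N i N0; rewrite andbF mxE ps_evalM //; last by case: sys.
  rewrite ps_evalX; last exact: egrow_Omega.
  by rewrite Omega_zero // expr0n eqn0Ngt k0 mul0r.
Qed.

(** The value 1 enters through the scalar system Omega^W: it equals 1 / pi^W at theta, and W > 0
    makes it vanish at the points theta^(q^N). *)
Lemma realization_one W : (0 < W)%N -> $|realization W false 1|.
Proof.
move=> W0; pose th := ('X - theta%:P : {poly C}).
have eO : egrow (OmegaS tt ^+ W) by apply/egrowX/egrow_Omega.
apply: squash; apply: (@Realization _ _ _ 0 (th ^+ W)%:M 1%:M W (const_mx (OmegaS tt ^+ W)) 1).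
- split=> [i|]; first by rewrite mxE.
  apply/matrixP => i j; rewrite !ord1 !mxE big_ord1 !mxE eqxx mulr1n.
  have -> : map_poly (frob 1) (th ^+ W) = ('X - (theta ^+ q)%:P) ^+ W.
    by rewrite rmorphXn rmorphB /= map_polyX map_polyC /= /frob expn1.
  by rewrite {1}(Omega_frob htt) exprMn; congr (_ * _); apply/esym/rmorphXn.
- by rewrite mulmx1.
- by rewrite mul1mx.
- by move=> i j; rewrite !ord1 mxE eqxx mulr1n; exact: algp_XsubtX.
- by move=> i j; rewrite !ord1 mxE eqxx mulr1n; exact: (algp_nat C 1).
- exact: kfield1.
- exact: oner_neq0.
- rewrite mxE ps_evalX; last exact: egrow_Omega.
  by rewrite Omega_eval -pitildeV exprVn !mul1r.
- move=> N i N0; rewrite andbF mxE ps_evalX; last exact: egrow_Omega.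
  by rewrite Omega_zero // expr0n eqn0Ngt W0.
Qed.

(* The criterion is applied to the direct sum of the systems. *)
Lemma relation_polynomials r W (top : 'I_r -> bool) (Z rho : 'I_r -> C) :
  (forall j, realization W (top j) (Z j)) -> (forall j, alg (rho j)) ->
  \sum_j rho j * Z j = 0 ->
  exists (c : 'I_r -> C) (f : 'I_r -> {poly C}),
    [/\ forall j, kfield C (c j) /\ c j != 0, forall j, algp (f j),
        forall j, (f j).[theta] = rho j / c j
      & forall N, (0 < N)%N ->
          \sum_(j | top j) (f j).[theta ^+ (q ^ N)] * (c j * Z j) ^+ (q ^ N) = 0].
Proof.
move=> D arho rhoZ; pose S := (\sum_j rz_s (D j))%N.
pose p_ j := (rz_n (D j)).+1; pose th := ('X - theta%:P : {poly C}).
pose Phi := \mxdiag_j (rz_Phi (D j) : 'M[{poly C}]_(p_ j)).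
(* Powers of t - theta pad the blocks to a common exponent S, as the criterion asks for a single
   scalar. *)
pose Phi' := \mxdiag_j (th ^+ (S - rz_s (D j)) *: rz_inv (D j) : 'M[{poly C}]_(p_ j)).
pose psi := \mxcol_j (rz_psi (D j) : 'cV[psr C]_(p_ j)).
have sS j : (rz_s (D j) <= S)%N by rewrite /S (bigD1 j) //= leq_addr.
have inv1 : Phi *m Phi' = (1%:P * th ^+ S)%:M.
  rewrite mul_mxdiag mul1r -mxdiagZ; apply/eq_mxdiag => j.
  by rewrite -scalemxAr rz_inv1 scale_scalar_mx -exprD subnK.
have inv2 : Phi' *m Phi = (1%:P * th ^+ S)%:M.
  rewrite mul_mxdiag mul1r -mxdiagZ; apply/eq_mxdiag => j.
  by rewrite -scalemxAl rz_inv2 scale_scalar_mx -exprD subnK.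
have psiE s : psi s 0 = rz_psi (D (tagnat.sig1 s)) (tagnat.sig2 s) 0 by rewrite mxE.
have sys : frob_system Phi psi.
  split=> [s|]; first by rewrite psiE; case: (rz_sys (D (tagnat.sig1 s))).
  have -> : psfrob 1 psi = \mxcol_j psfrob 1 (rz_psi (D j) : 'cV[psr C]_(p_ j)).
    by apply/matrixP => s t; rewrite !mxE.
  rewrite /mxps /mxfrob /Phi !map_mxdiag mul_mxdiag_mxcol; apply/eq_mxcol => j.
  by case: (rz_sys (D j)).
have algP1 s t : algp (Phi s t).
  by apply: mxdiag_entry => [|i j k]; [exact: (algp_nat C 0)|exact: rz_alg].
have algP2 s t : algp (Phi' s t).
  apply: mxdiag_entry => [|i j k]; first exact: (algp_nat C 0).
  by rewrite mxE; apply: algpM; [exact: algp_XsubtX|exact: rz_alg_inv].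
(* Dividing by the constant of each system makes the last coordinates c_j Z_j / pi^W reproduce the
   given relation, up to the factor pi^-W. *)
pose row := \mxrow_j ((rho j / rz_c (D j)) *: delta_mx 0 ord_max : 'rV[C]_(p_ j)).
have arow s : alg (row 0 s).
  rewrite mxE mxE mxE; apply: algM; last by apply/alg_kfield/kpredP/rpred_nat.
  by apply: algM => //; apply/algV/alg_kfield/rz_kf.
have evcol x : mxpsev x psi = \mxcol_j mxpsev x (rz_psi (D j) : 'cV[psr C]_(p_ j)).
  by apply/matrixP => s t; rewrite !mxE.
have row_psi : row *m mxpsev theta psi = 0.
  rewrite evcol mul_mxrow_mxcol.
  transitivity (\sum_j (rho j * Z j / pitilde tt ^+ W)%:M : 'M[C]_1).
    apply: eq_bigr => j _; rewrite -scalemxAl -rowE; apply/matrixP => a b; rewrite !ord1 !mxE.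
    by rewrite rz_theta eqxx mulr1n; field; rewrite rz_c0 expf_neq0 ?pitilde_neq0.
  rewrite -raddf_sum /= -mulr_suml rhoZ mul0r; exact: raddf0.
have one0 : (1 : C) != 0 := oner_neq0 _.
have [P [aP Pev Ppsi]] := abp one0 sys inv1 inv2 algP1 algP2 arow row_psi.
(* Only the last coordinate of each block matters: all the others vanish at the points
   theta^(q^N). *)
pose f j := submxrow P j 0 (ord_max : 'I_(p_ j)).
exists (fun j => rz_c (D j)), f; split.
- by move=> j; split; [exact: rz_kf|exact: rz_c0].
- by move=> j; rewrite /f mxE.
- move=> j; have : submxrow (mxev theta P) j 0 (ord_max : 'I_(p_ j)) = submxrow row j 0 ord_max by rewrite Pev.
  rewrite mxrowK !mxE !eqxx /= mulr1 => <-; by rewrite /f mxE horner_evalE.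
- move=> N N0; set x := theta ^+ (q ^ N).
  have : mxpsev x (mxps P *m psi) = 0.
    by rewrite Ppsi; apply/matrixP => a b; rewrite !mxE ps_eval0.
  rewrite mxpsev_mul; last by case: sys.
  rewrite -[P]submxrowK evcol.
  have -> : mxev x (\mxrow_j submxrow P j) = \mxrow_j mxev x (submxrow P j).
    by apply/matrixP => a b; rewrite !mxE.
  rewrite mul_mxrow_mxcol => /matrixP /(_ 0 0); rewrite summxE [RHS]mxE => H.
  pose u := pitilde tt ^+ W ^+ (q ^ N).
  have u0 : u != 0 by rewrite !expf_neq0 ?pitilde_neq0.
  apply: (mulfI (invr_neq0 u0)); rewrite mulr0 -[RHS]H mulr_sumr big_mkcond.
  apply: eq_bigr => j _; rewrite mxE (bigD1 ord_max) //= big1 => [|i /negPf im].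
    have mul_if (t : bool) (a b d : C) : a = b * d -> (if t then a else 0) = b * (if t then d else 0).
      by case: t; rewrite ?mulr0.
    rewrite addr0 !mxE rz_zero // eqxx; apply: mul_if.
    by rewrite expr_div_n -/u horner_evalE /f mxE mulrC -mulrA.
  by rewrite !mxE rz_zero // im mulr0.
Qed.

End Realizations.

(** * Linear independence *)

Section IndependentFamilies.
Variables (K : fieldType) (L S : set K).

Lemma linearly_independent_family (I : finType) (P : pred I) (Z rho : I -> K) :
  linearly_independent L S -> {in P &, injective Z} ->
  (forall j, P j -> S (Z j)) -> (forall j, P j -> L (rho j)) ->
  \sum_(j | P j) rho j * Z j = 0 -> forall j, P j -> rho j = 0.
Proof.
move=> indep Zinj SZ Lrho sum0 j Pj.
pose c x := if [pick i | P i && (Z i == x)] is Some i then rho i else 0.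
have cZ i : P i -> c (Z i) = rho i.
  rewrite /c => Pi; case: pickP => [k /andP[Pk /eqP ki]|/(_ i)]; last by rewrite Pi eqxx.
  by rewrite (Zinj _ _ Pk Pi ki).
pose s := [seq Z i | i <- enum P].
have memP i : i \in enum P -> P i by rewrite mem_enum.
rewrite -(cZ j Pj); apply: (indep s c).
- rewrite map_inj_in_uniq ?enum_uniq // => x y /memP Px /memP Py; exact: Zinj.
- by move=> _ /mapP[i /memP Pi ->]; apply: SZ.
- by move=> _ /mapP[i /memP Pi ->]; rewrite cZ //; apply: Lrho.
- rewrite /s big_map big_enum -[RHS]sum0; apply: eq_bigr => i Pi; by rewrite cZ.
- by apply: map_f; rewrite mem_enum.
Qed.

Lemma family_linearly_independent :
  (forall r (Z rho : 'I_r -> K), injective Z -> (forall j, S (Z j)) ->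
    (forall j, L (rho j)) -> \sum_j rho j * Z j = 0 -> forall j, rho j = 0) ->
  linearly_independent L S.
Proof.
move=> H s c us sS cL sum0 x xs.
have xi : (index x s < size s)%N by rewrite index_mem.
have := H (size s) (fun j => s`_j) (fun j => c s`_j).
move=> /(_ _ _ _ _ (Ordinal xi)) /=; rewrite nth_index //; apply.
- by move=> i j /eqP; rewrite nth_uniq // => /eqP /val_inj.
- by move=> j; apply: sS; apply: mem_nth.
- by move=> j; apply: cL; apply: mem_nth.
- by move: sum0; rewrite (big_nth 0) big_mkord.
Qed.

End IndependentFamilies.

(** * Descent of relations to F(theta), and independence over algebraic elements *)

Section Independence.
Context {F : finFieldType} {R : realType} (C : Cinfty F R).
Local Notation q := #|F|.
Local Notation theta := (theta C).

Lemma poly_eq0_theta (p : {poly C}) :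
  (forall N, (0 < N)%N -> p.[theta ^+ (q ^ N)] = 0) -> p = 0.
Proof.
move=> H; apply: (@roots_geq_poly_eq0 _ _ [seq frob N.+1 theta | N <- iota 0 (size p)]).
- by apply/allP => _ /mapP[N _ ->]; rewrite /root H.
- by rewrite map_inj_uniq ?iota_uniq // => i j /frob_theta_inj [].
- by rewrite size_map size_iota.
Qed.

Lemma frob_fixed (x : C) : frob 1 x = x -> exists a, x = embF C a.
Proof.
rewrite /frob expn1 => xq.
have /(congr1 (fun p => (map_poly (embF C) p).[x])) := finField_genPoly F.
rewrite rmorphB /= map_polyXn map_polyX rmorph_prod hornerD hornerN hornerXn hornerX xq subrr.
rewrite horner_prod => /esym/eqP; rewrite prodf_seq_eq0 => /hasP[a _].
rewrite /= rmorphB /= map_polyX map_polyC hornerXsubC subr_eq0 => /eqP ->.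
by exists a.
Qed.

Lemma frob_fixed_poly (p : {poly C}) : map_poly (frob 1) p = p ->
  exists r, p = map_poly (embF C) r.
Proof.
move=> /polyP pp; have H i : exists a, p`_i = embF C a.
  by apply: frob_fixed; have := pp i; rewrite coef_map.
exists (\poly_(i < size p) sval (cid (H i))); apply/polyP => i; rewrite coef_map coef_poly.
case: ltnP => [_|pi]; first exact: (svalP (cid (H i))).
by rewrite raddf0 nth_default.
Qed.

(* In lowest terms with monic denominator, P / S is fixed by the twist, so its
   numerator and denominator have coefficients in F. *)
Lemma twist_invariant_ratio (P S : {poly C}) : S.[theta] != 0 ->
  map_poly (frob 1) P * S = map_poly (frob 1) S * P -> kfield C (P.[theta] / S.[theta]).
Proof.
move=> S0 PS; have Sn0 : S != 0 by apply: contraNneq S0 => ->; rewrite horner0.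
pose g := gcdp P S; have g0 : g != 0 by rewrite gcdp_eq0 negb_and Sn0 orbT.
have [P1 PE] : exists P1, P = P1 * g by apply/dvdpP/dvdp_gcdl.
have [S1 SE] : exists S1, S = S1 * g by apply/dvdpP/dvdp_gcdr.
have cop : coprimep P1 S1.
  have := coprimep_div_gcd (p := P) (q := S); rewrite Sn0 orbT => /(_ isT).
  by rewrite -/g PE SE !mulpK.
have S1n0 : S1 != 0 by apply: contraNneq Sn0 => S10; rewrite SE S10 mul0r.
pose u := (lead_coef S1)^-1; have u0 : u != 0 by rewrite invr_neq0 // lead_coef_eq0.
pose P2 := u *: P1; pose S2 := u *: S1.
have S2m : S2 \is monic by rewrite monicE lead_coefZ mulVf // lead_coef_eq0.
have PS1 : map_poly (frob 1) P1 * S1 = map_poly (frob 1) S1 * P1.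
  have fg0 : map_poly (frob 1) g != 0 by rewrite map_poly_eq0.
  apply: (mulIf (mulf_neq0 fg0 g0)); move: PS; rewrite PE SE !rmorphM /= => PS.
  by rewrite mulrACA PS mulrACA.
have PS2 : map_poly (frob 1) P2 * S2 = map_poly (frob 1) S2 * P2.
  rewrite /P2 /S2 !map_polyZ /= -!scalerAl -!scalerAr PS1.
  by [].
have cop2 : coprimep S2 P2 by rewrite coprimepZl // coprimepZr // coprimep_sym.
have S2dvd : S2 %| map_poly (frob 1) S2.
  by rewrite -(Gauss_dvdpl _ cop2) -PS2 dvdp_mulIr.
have S2fix : map_poly (frob 1) S2 = S2.
  apply/eqP; rewrite -eqp_monic ?map_monic // eqp_sym -dvdp_size_eqp //.
  by rewrite size_map_poly.
have P2fix : map_poly (frob 1) P2 = P2.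
  by apply: (mulIf (monic_neq0 S2m)); rewrite PS2 S2fix mulrC.
have [p2 p2E] := frob_fixed_poly P2fix; have [s2 s2E] := frob_fixed_poly S2fix.
have g0' : g.[theta] != 0 by apply: contraNneq S0 => g0'; rewrite SE hornerM g0' mulr0.
have S10' : S1.[theta] != 0 by apply: contraNneq S0 => S10'; rewrite SE hornerM S10' mul0r.
have -> : P.[theta] / S.[theta] = P2.[theta] / S2.[theta].
  by rewrite PE SE /P2 /S2 !hornerM !hornerZ; field; rewrite u0 S10' g0'.
by apply: kfield_div; [rewrite p2E|rewrite s2E]; apply: kfield_ev.
Qed.

(** Twisting the proportionality at theta^(q^N) and comparing it with the one at theta^(q^(N+1))
    shows that P^(1) S and S^(1) P agree at theta^(q^(N+1)) for all N >= 0, hence are equal. The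
    case N = 0 uses the value at theta. *)
Lemma proportional_values_ratio (P S : {poly C}) (r : C) : S.[theta] != 0 ->
  P.[theta] = r * S.[theta] ->
  (forall N, (0 < N)%N ->
     P.[theta ^+ (q ^ N)] = r ^+ (q ^ N) * S.[theta ^+ (q ^ N)]) ->
  kfield C r.
Proof.
move=> S0 PS0 PS.
have PSN N : P.[frob N theta] = r ^+ (q ^ N) * S.[frob N theta].
  by case: N => [|N]; [rewrite frob0 expn0 expr1|apply: PS].
have -> : r = P.[theta] / S.[theta] by rewrite PS0 mulfK.
apply: twist_invariant_ratio => //; apply/eqP; rewrite -subr_eq0; apply/eqP.
apply: poly_eq0_theta => -[//|N] _; rewrite -[theta ^+ _]/(frob (1 + N) theta).
rewrite hornerD hornerN !hornerM (PSN (1 + N)%N) frobD !horner_frob PSN.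
rewrite rmorphM -/(frob (1 + N) r) frobD.
rewrite -[r ^+ (q ^ N)]/(frob N r).
by ring.
Qed.

Lemma relation_roots r (P : pred 'I_r) N (c Z y : 'I_r -> C) : (forall j, alg (y j)) ->
  \sum_(j | P j) y j * (c j * Z j) ^+ (q ^ N) = 0 ->
  exists g : 'I_r -> C, [/\ forall j, alg (g j), forall j, frob N (g j) = y j
    & \sum_(j | P j) (g j * c j) * Z j = 0].
Proof.
move=> ay rel; have H j : exists g, frob N g = y j by apply: frob_surj.
pose g j := sval (cid (H j)); have gE j : frob N (g j) = y j := svalP (cid (H j)).
exists g; split=> // [j|].
  by apply: (@alg_root _ _ _ _ (q ^ N)); [exact: expq_gt0|rewrite -/(frob N (g j)) gE].
apply: (@frob_inj _ _ _ N); rewrite raddf_sum raddf0 -[RHS]rel.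
by apply: eq_bigr => j _; rewrite -mulrA -gE; apply: rmorphM.
Qed.

Section MZValues.
Variable tt : C.
Hypothesis htt : tt ^+ q.-1 = - theta.

Lemma MZ_algebraic_independence w (V : set C) :
  (forall Z, V Z -> MZ_property tt w Z) -> linearly_independent (kfield C) V ->
  linearly_independent (@alg F R C) V.
Proof.
move=> V_MZ V_indep; apply: family_linearly_independent.
elim=> [|r IH] Z rho Zinj VZ arho rel j0; first by case: j0.
apply/eqP/contraT => rho_j0.
(* By induction a relation with a zero coefficient is trivial, so the relations among these r + 1
   values form a space of dimension at most 1. *)
have drop (tau : 'I_r.+1 -> C) i : (forall j, alg (tau j)) -> tau i = 0 ->
    \sum_j tau j * Z j = 0 -> forall j, tau j = 0.
  move=> atau ti0; rewrite (bigD1_ord i) //= ti0 mul0r add0r => tau_rel j.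
  have := IH (fun k => Z (lift i k)) (fun k => tau (lift i k)).
  move=> H; case: (unliftP i j) => [k ->|-> //]; apply: H => //.
  by move=> a b /Zinj /lift_inj.
have rho0 j : rho j != 0.
  by apply: contraNneq rho_j0 => rj; apply/eqP; apply: drop rel j0; [exact: arho|exact: rj].
have D j : realization tt w true (Z j) := unsquash (MZ_realization (V_MZ _ (VZ j))).
have [c [f [kc af fth frel]]] := relation_polynomials htt D arho rel.
pose ra j := (rho j / c j) / (rho ord0 / c ord0).
have c0 j : c j != 0 by case: (kc j).
have kra j : kfield C (ra j).
  apply: (@proportional_values_ratio (f j) (f ord0)).
  - by rewrite fth mulf_neq0 ?invr_neq0.
  - by rewrite !fth divfK // mulf_neq0 ?invr_neq0.
  move=> N N0; have ay i : alg (f i).[theta ^+ (q ^ N)].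
    by apply: alg_horner => //; apply/algX/alg_theta.
  have [g [ag gE grel]] := relation_roots ay (frel N N0).
  (* This combination of the untwisted relation with the given one has coefficient 0 at [ord0], so
     the two are proportional. *)
  have tau0 : forall i, g i * c i * rho ord0 - g ord0 * c ord0 * rho i = 0.
    apply: (drop _ ord0) => [i||]; last 2 first.
    - by ring.
    - rewrite (eq_bigr (fun i => rho ord0 * (g i * c i * Z i) - g ord0 * c ord0 * (rho i * Z i))).
        by rewrite sumrB -!mulr_sumr grel rel !mulr0 subrr.
      by move=> i _; ring.
    have ac i' : alg (c i') by apply: alg_kfield; case: (kc i').
    by apply: algD; [|apply: algN]; do !apply: algM.
  rewrite -!gE -[ra j ^+ _]/(frob N (ra j)) -rmorphM; congr (frob N _).
  have /eqP := tau0 j; rewrite subr_eq0 => /eqP E.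
  apply: (mulIf (mulf_neq0 (c0 j) (rho0 ord0))); rewrite mulrA E /ra.
  by field; rewrite !c0 rho0.
have krho j : kfield C (rho j / rho ord0).
  rewrite (_ : rho j / rho ord0 = ra j * (c j / c ord0)).
    by apply: kfieldM => //; apply: kfield_div; [case: (kc j)|case: (kc ord0)].
  by rewrite /ra; field; rewrite !c0 rho0.
have := @linearly_independent_family _ _ _ _ xpredT Z (fun j => rho j / rho ord0) V_indep.
move=> /(_ (in2W Zinj) (fun j _ => VZ j) (fun j _ => krho j)) H.
have /eqP : rho ord0 / rho ord0 = 0.
  apply: H => //; under eq_bigr => j _ do rewrite mulrAC.
  by rewrite -mulr_suml rel mul0r.
by rewrite mulf_eq0 invr_eq0 orbb (negPf (rho0 ord0)).
Qed.

End MZValues.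
End Independence.

Theorem theorem3p4p5 (F : finFieldType) (R : realType) (C : Cinfty F R)
    (tt : C) (htt : tt ^+ (#|F|.-1) = - theta C)
    (l : nat) (w : 'I_l -> nat) (w_gt0 : forall i, (0 < w i)%N)
    (w_inj : injective w)
    (V : 'I_l -> set C) (V_fin : forall i, finite_set (V i))
    (V_MZ : forall i Z, V i Z -> MZ_property tt (w i) Z)
    (V_indep : forall i, linearly_independent (kfield C) (V i)) :
  linearly_independent (kbar C) ([set 1] `|` \bigcup_i V i).
Proof.
have V_alg i := MZ_algebraic_independence htt (V_MZ i) (V_indep i).
apply: family_linearly_independent => r0 Z0 rho0 Z0inj VZ0 krho0 rel0 j0.
apply/eqP/contraT => rho_j0.
(* Only terms with nonzero coefficients are kept, so that the top weight W is attained at a value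
   whose coefficient can be contradicted. *)
pose A := [set j | rho0 j != 0]%SET.
pose r := #|A|; pose Z (k : 'I_r) := Z0 (enum_val k); pose rho (k : 'I_r) := rho0 (enum_val k).
have Zinj : injective Z by move=> a b /Z0inj /enum_val_inj.
have rho_neq0 k : rho k != 0 by have := enum_valP k; rewrite inE.
have arho k : alg (rho k) by apply/kbar_alg/krho0.
have rel : \sum_k rho k * Z k = 0.
  rewrite -[RHS]rel0 (bigID (mem A)) /= [X in _ = _ + X]big1 ?addr0.
    by rewrite [RHS]big_enum_val.
  by move=> j; rewrite inE negbK => /eqP ->; rewrite mul0r.
(* The value 1 counts as weight 0; should it also lie in some V i, either choice of its weight leads
   to a valid system. *)
have /choice[wt wtP] : forall k, exists m : nat,
    (m = 0%N /\ Z k = 1) \/ exists2 i, V i (Z k) & m = w i.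
  move=> k; case: (VZ0 (enum_val k)) => [z1|[i _ Vi]]; first by exists 0%N; left.
  by exists (w i); right; exists i.
have r_gt0 : (0 < #|'I_r|)%N by rewrite card_ord card_gt0; apply/set0Pn; exists j0; rewrite inE.
pose W := (\max_k wt k)%N.
have [j1 j1max] : {k | W = wt k} by apply: bigop.eq_bigmax.
have wtW k : (wt k <= W)%N by rewrite /W (leq_bigmax k).
have [W0|W_gt0] := posnP W.
  have Z1 k : Z k = 1.
    case: (wtP k) => [[_ //]|[i _ wi]].
    by have := wtW k; rewrite W0 wi leqNgt w_gt0.
  move: rel; rewrite (bigD1 j1) //= big1 => [|k kj1].
    by rewrite addr0 Z1 mulr1 => /eqP; rewrite (negPf (rho_neq0 j1)).
  by case/eqP: kj1; apply: Zinj; rewrite !Z1.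
have [i1 Vi1 Wi1] : exists2 i, V i (Z j1) & W = w i.
  case: (wtP j1) => [[w0 _]|[i Vi wi]]; last by exists i; rewrite // j1max.
  by rewrite j1max w0 in W_gt0.
have D k : realization tt W (wt k == W) (Z k).
  apply: unsquash; case: (wtP k) => [[w0 ->]|[i Vi wi]].
    by rewrite w0 eq_sym -[W == 0%N]negbK -lt0n W_gt0; apply: realization_one.
  have [E|neq] := eqVneq (wt k) W; first by rewrite -E wi; apply: MZ_realization; apply: V_MZ.
  have wW : (w i < W)%N by rewrite -wi ltn_neqAle neq wtW.
  exact: realization_lift wW (unsquash (MZ_realization (V_MZ i _ Vi))).
have [c [f [kc af fth frel]]] := relation_polynomials htt D arho rel.
have fj1 : f j1 = 0.
  apply: poly_eq0_theta => N N0; have ay k : alg (f k).[theta C ^+ (#|F| ^ N)].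
    by apply: alg_horner => //; apply/algX/alg_theta.
  have [g [ag gE grel]] := relation_roots ay (frel N N0).
  have : g j1 * c j1 = 0.
    (* As the weights are distinct, all values of weight W lie in the same V i1, whose independence
       over algebraic elements applies to the coefficients g k * c k. *)
    apply: (@linearly_independent_family _ _ _ _ (fun k => wt k == W) Z (fun k => g k * c k) (V_alg i1)).
    - by move=> a b _ _; apply: Zinj.
    - move=> k /eqP kW; case: (wtP k) => [[w0 _]|[i Vi wi]].
        by rewrite -kW w0 in W_gt0.
      by rewrite (w_inj i1 i) // -wi kW Wi1.
    - by move=> k _; apply: algM => //; apply: alg_kfield; case: (kc k).
    - exact: grel.
    - by rewrite j1max.
  move/eqP; rewrite mulf_eq0; case: (kc j1) => _ /negPf ->; rewrite orbF => /eqP g0.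
  by rewrite -gE g0 rmorph0.
have := fth j1; rewrite fj1 horner0 => /esym/eqP; rewrite mulf_eq0 invr_eq0.
by case: (kc j1) => _ /negPf ->; rewrite orbF (negPf (rho_neq0 j1)).
Qed.
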